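(* Let $M$ be a closed, connected, orientable smooth manifold of dimension $n$ and let $X$ be a smooth vector field on $M$. The following statements are equivalent: (1) $X$ is globally hypoelliptic (GH); (2) $X$ is $C^\infty$-cohomology free (CF); (3) $X$ is volume preserving, $X$ is $C^\infty$-stable, and every $X$-invariant distribution is a smooth $n$-form, i.e. $\mathcal{I}_X(M)\subset\Omega^n(M)$.
   Context: $C^\infty(M)$ is the Fréchet space of smooth complex-valued functions on $M$, and $\mathcal{D}'(M)$ is its dual space, the space of distributions. Distributions are identified with currents of degree $n$ (and dimension $0$), so $\mathcal{D}'(M)=\mathcal{D}'_n(M)$. The space $\Omega^n(M)$ of smooth (complex-valued) $n$-forms is regarded as a subspace of $\mathcal{D}'_n(M)$: after fixing an orientation, $\eta\in\Omega^n(M)$ defines the distribution $f\mapsto\int_M f\eta$. The Lie derivative $\mathcal{L}_X$ acts on $C^\infty(M)$ by $f\mapsto Xf$ and on $\mathcal{D}'_n(M)$ by duality, $(\mathcal{L}_XU)(f)=-U(Xf)$, extending the usual Lie derivative of smooth $n$-forms. $X$ is globally hypoelliptic (GH) if, for any $U\in\mathcal{D}'_n(M)$, $\mathcal{L}_XU\in\Omega^n(M)$ implies $U\in\Omega^n(M)$. $X$ is $C^\infty$-cohomology free (CF) if for every $f\in C^\infty(M)$ there exist a constant $c(f)\in\mathbb{C}$ and $u\in C^\infty(M)$ such that $Xu=f-c(f)$. $X$ is $C^\infty$-stable if the operator $\mathcal{L}_X:C^\infty(M)\to C^\infty(M)$ has closed range. $X$ is volume preserving if there is a smooth volume form $\omega$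 on $M$ with $\mathcal{L}_X\omega=0$. A distribution $D\in\mathcal{D}'(M)$ is $X$-invariant if $\mathcal{L}_XD=0$, i.e. $D(Xf)=0$ for all $f\in C^\infty(M)$; $\mathcal{I}_X(M)$ denotes the space of all $X$-invariant distributions. *)

(* Defs.v *)
From HB Require Import structures.
From mathcomp Require Import all_boot all_order all_algebra.
From mathcomp Require Import complex.
From mathcomp Require Import all_classical all_reals all_analysis.
Set Implicit Arguments. Unset Strict Implicit. Unset Printing Implicit Defensive.
Import Order.TTheory GRing.Theory Num.Theory.
Import numFieldNormedType.Exports.
Local Open Scope classical_set_scope.
Local Open Scope ring_scope.
Local Open Scope complex_scope.

Section Smooth.
Context {R : realType} {n : nat}.

Definition partial (W : normedModType R) (i : 'I_n) (f : 'rV[R]_n -> W) :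
  'rV[R]_n -> W := 'D_(delta_mx 0 i) f.

Definition iter_partial (W : normedModType R) (s : seq 'I_n)
  (f : 'rV[R]_n -> W) : 'rV[R]_n -> W := foldr (@partial W) f s.

(* Meant for open [D]. *)
Fixpoint Ck_on (W : normedModType R) (D : set 'rV[R]_n) (k : nat)
    (f : 'rV[R]_n -> W) : Prop :=
  if k is k'.+1 then
    (forall x, D x -> differentiable f x) /\
    (forall i, Ck_on D k' (partial i f))
  else forall x, D x -> {for x, continuous f}.

Definition smooth_on (W : normedModType R) (D : set 'rV[R]_n)
  (f : 'rV[R]_n -> W) : Prop := forall k, Ck_on D k f.

Lemma differentiable_near (W : normedModType R) (f g : 'rV[R]_n -> W) x :
  (\forall y \near x, f y = g y) -> differentiable f x -> differentiable g x.
Proof.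
move=> fg df; have fgx : f x = g x := nbhs_singleton fg.
have [dfc /eqaddoP fE] := (diff_locallyP x f).1 df.
have gE : g \o shift x = cst (g x) + 'd f x +o_ 0 id.
  apply/eqaddoP => e e0; near=> h.
  have hE : g (h + x) = f (h + x).
    apply/esym; near: h; have := fg; rewrite (near_shift 0 x) /=.
    by apply: filterS => h; rewrite /= subr0.
  rewrite [X in `|X|](_ : _ = (f \o shift x - (cst (f x) + 'd f x)) h).
    by near: h; exact: fE.
  by rewrite !fctE /= hE fgx.
apply/diff_locallyP.
by rewrite (diff_unique dfc gE).
Unshelve. all: by end_near. Qed.

Lemma open_near (T : topologicalType) (D : set T) (P : T -> Prop) x :
  open D -> D x -> (forall y, D y -> P y) -> \forall y \near x, P y.
Proof. by move=> oD Dx DP; apply: filterS (open_nbhs_nbhs (conj oD Dx)). Qed.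

Lemma eq_Ck_on (W : normedModType R) D k (f g : 'rV[R]_n -> W) : open D ->
  (forall x, D x -> f x = g x) -> Ck_on D k f -> Ck_on D k g.
Proof.
move=> oD; elim: k f g => [|k IH] f g fg.
  move=> /= cf x Dx; have nfg := open_near oD Dx fg.
  rewrite /prop_for /continuous_at -(fg x Dx).
  have cfx : f y @[y --> x] --> f x := cf x Dx.
  exact: (cvg_trans (near_eq_cvg nfg) cfx).
move=> [df pf]; split=> [x Dx|i].
  by apply: differentiable_near (df x Dx); exact: open_near oD Dx fg.
apply: IH (pf i) => x Dx; apply: near_eq_derive.
exact: open_near oD Dx fg.
Qed.

Lemma Ck_on_lt (W : normedModType R) D k (f : 'rV[R]_n -> W) :
  Ck_on D k.+1 f -> Ck_on D k f.
Proof.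
elim: k f => [|k IH] f [df pf].
  by move=> x Dx; apply: differentiable_continuous (df x Dx).
by split=> // i; apply: IH; apply: pf.
Qed.

Lemma Ck_on_cst (W : normedModType R) D k (a : W) :
  Ck_on D k (cst a : 'rV[R]_n -> W).
Proof.
elim: k a => [|k IH] a; first by move=> x _; exact: cst_continuous.
split=> [x _|i]; first exact: differentiable_cst.
suff -> : partial i (cst a) = cst 0 by exact: IH.
by apply/funext => x; rewrite /partial derive_cst.
Qed.

Lemma Ck_onD (W : normedModType R) D k (f g : 'rV[R]_n -> W) : open D ->
  Ck_on D k f -> Ck_on D k g -> Ck_on D k (f \+ g).
Proof.
move=> oD; elim: k f g => [|k IH] f g.
  by move=> cf cg x Dx; apply: continuousD; [exact: cf|exact: cg].
move=> [df pf] [dg pg]; split=> [x Dx|i].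
  by apply: differentiableD; [exact: df|exact: dg].
apply: (eq_Ck_on oD _ (IH _ _ (pf i) (pg i))) => x Dx /=.
by rewrite [RHS]deriveD//; apply: diff_derivable; [exact: df|exact: dg].
Qed.

Lemma Ck_onM D k (f g : 'rV[R]_n -> R) : open D ->
  Ck_on D k f -> Ck_on D k g -> Ck_on D k (f \* g).
Proof.
move=> oD; elim: k f g => [|k IH] f g.
  by move=> cf cg x Dx; apply: continuousM; [exact: cf|exact: cg].
move=> fk gk; have [df pf] := fk; have [dg pg] := gk; split=> [x Dx|i].
  by apply: differentiableM; [exact: df|exact: dg].
apply: (eq_Ck_on oD _ (Ck_onD oD (IH _ _ (Ck_on_lt fk) (pg i))
  (IH _ _ (Ck_on_lt gk) (pf i)))) => x Dx /=.
by rewrite [RHS]deriveM//; apply: diff_derivable; [exact: df|exact: dg].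
Qed.

Lemma Ck_on_sum D k m (f : 'I_m -> 'rV[R]_n -> R) : open D ->
  (forall i, Ck_on D k (f i)) -> Ck_on D k (fun x => \sum_i f i x).
Proof.
move=> oD fk.
have -> : (fun x => \sum_i f i x) = \sum_i f i by apply/funext=> x; rewrite fct_sumE.
elim/big_ind : _ => [|g h gk hk|i _]; [exact: Ck_on_cst|exact: Ck_onD|exact: fk].
Qed.

Lemma Ck_on_coord D k m (f : 'rV[R]_n -> 'rV[R]_m) j : open D ->
  Ck_on D k f -> Ck_on D k (fun x => f x 0 j).
Proof.
move=> oD; elim: k f => [|k IH] f.
  move=> cf x Dx.
  apply: (@continuous_comp _ _ _ f (fun v : 'rV[R]_m => v 0 j)); first exact: cf.
  exact: coord_continuous.
move=> [df pf]; split=> [x Dx|i].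
  apply: (@differentiable_comp _ _ _ _ f (fun v : 'rV[R]_m => v 0 j)); first exact: df.
  exact: differentiable_coord.
apply: (eq_Ck_on oD _ (IH _ (pf i))) => x Dx.
rewrite /partial derive_mx ?mxE//.
by apply: diff_derivable; exact: df.
Qed.

Lemma derive_partial (f : 'rV[R]_n -> R) x v : differentiable f x ->
  'D_v f x = \sum_i v 0 i * partial i f x.
Proof.
move=> df; rewrite deriveE// {1}(row_sum_delta v) linear_sum.
by apply: eq_bigr => i _; rewrite linearZ /= /partial deriveE.
Qed.

Lemma smooth_on_derive D (X : 'rV[R]_n -> 'rV[R]_n) (f : 'rV[R]_n -> R) :
  open D -> smooth_on D X -> smooth_on D f ->
  smooth_on D (fun x => 'D_(X x) f x).
Proof.
move=> oD sX sf k.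
have [df pf] := sf k.+1.
apply: (@eq_Ck_on _ _ _ (fun x => \sum_i X x 0 i * partial i f x)) => // [x Dx|].
  by rewrite derive_partial//; exact: df.
apply: Ck_on_sum => // i; apply: Ck_onM => //; last exact: pf.
by apply: Ck_on_coord => //; exact: sX.
Qed.
End Smooth.

(* The integral over R^n as an iterated Lebesgue integral; it is only applied
   to continuous functions with compact support. *)
Fixpoint int_rV (R : realType) n : ('rV[R]_n -> R) -> R :=
  if n is n'.+1 return ('rV[R]_n -> R) -> R then fun g =>
    \int[lebesgue_measure]_t
      int_rV (fun v : 'rV[R]_n' => g (row_mx (const_mx t : 'rV[R]_1) v))
  else fun g => g 0.

Section Manifold.
Context {R : realType} {n : nat} {M : topologicalType}.

(* The maps are total; only [chart_fwd] on [chart_dom] and [chart_bwd] on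
   [chart_cod] matter. *)
Record chart := Chart {
  chart_dom : set M;
  chart_cod : set 'rV[R]_n;
  chart_fwd : M -> 'rV[R]_n;
  chart_bwd : 'rV[R]_n -> M;
  chart_dom_open : open chart_dom;
  chart_cod_open : open chart_cod;
  chart_fwd_cod : forall p, chart_dom p -> chart_cod (chart_fwd p);
  chart_bwd_dom : forall x, chart_cod x -> chart_dom (chart_bwd x);
  chart_fwdK : forall p, chart_dom p -> chart_bwd (chart_fwd p) = p;
  chart_bwdK : forall x, chart_cod x -> chart_fwd (chart_bwd x) = x;
  chart_fwd_cont : forall p, chart_dom p -> {for p, continuous chart_fwd};
  chart_bwd_cont : forall x, chart_cod x -> {for x, continuous chart_bwd} }.

Definition overlap (c d : chart) : set 'rV[R]_n :=
  chart_cod c `&` chart_bwd c @^-1` chart_dom d.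

Definition transition (c d : chart) : 'rV[R]_n -> 'rV[R]_n :=
  chart_fwd d \o chart_bwd c.

Definition compatible (c d : chart) : Prop :=
  smooth_on (overlap c d) (transition c d) /\
  smooth_on (overlap d c) (transition d c).

(* A maximal atlas.  The Hausdorff property is not included; second
   countability is automatic for compact [M]. *)
Record smooth_structure := SmoothStructure {
  atlas : set chart;
  atlas_cover : forall p, exists2 c, atlas c & chart_dom c p;
  atlas_compatible : forall c d, atlas c -> atlas d -> compatible c d;
  atlas_maximal : forall c,
    (forall d, atlas d -> compatible c d) -> atlas c }.

(* Jacobian matrices follow the row-vector convention of [jacobian]. *)
Record orientation (S : smooth_structure) := Orientation {
  oriented : set chart;
  oriented_atlas : oriented `<=` atlas S;
  oriented_cover : forall p, exists2 c, oriented c & chart_dom c p;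
  oriented_det : forall c d x, oriented c -> oriented d -> overlap c d x ->
    0 < \det ('J (transition c d) x) }.

Lemma overlap_open c d : open (overlap c d).
Proof.
rewrite openE => x [cx dx]; apply: filterI.
  exact: open_nbhs_nbhs (conj (@chart_cod_open c) cx).
exact: (chart_bwd_cont cx (open_nbhs_nbhs (conj (@chart_dom_open d) dx))).
Qed.

Section Functions.
Variable S : smooth_structure.

Definition chart_at (p : M) : chart := sval (cid2 (atlas_cover S p)).

Lemma chart_at_atlas p : atlas S (chart_at p).
Proof. exact: s2valP (cid2 (atlas_cover S p)). Qed.

Lemma chart_at_dom p : chart_dom (chart_at p) p.
Proof. exact: s2valP' (cid2 (atlas_cover S p)). Qed.

Definition smooth_real (h : M -> R) : Prop :=
  forall c, atlas S c -> smooth_on (chart_cod c) (h \o chart_bwd c).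

Definition smooth_complex (f : M -> R[i]^o) : Prop :=
  smooth_real (@complex.Re R \o f) /\ smooth_real (@complex.Im R \o f).

Definition smooth_pred : {pred M -> R[i]^o} := [pred f | `[< smooth_complex f >]].

Lemma smooth_realD h k : smooth_real h -> smooth_real k -> smooth_real (h \+ k).
Proof.
by move=> sh sk c Sc m; apply: Ck_onD; [exact: chart_cod_open|exact: sh|exact: sk].
Qed.

Lemma smooth_realZ (a : R) h : smooth_real h -> smooth_real (fun p => a * h p).
Proof.
move=> sh c Sc m; apply: (@Ck_onM _ _ _ _ (cst a)); last exact: sh.
  exact: chart_cod_open.
exact: Ck_on_cst.
Qed.

Lemma smooth_submod_closed : submod_closed smooth_pred.
Proof.
split.
  by apply/asboolP; split=> c Sc m; exact: Ck_on_cst.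
move=> a f g /asboolP[f1 f2] /asboolP[g1 g2]; apply/asboolP; split.
  have -> : @complex.Re R \o (a *: f + g) =
      ((fun p => complex.Re a * complex.Re (f p)) \+
       (fun p => (- complex.Im a) * complex.Im (f p))) \+ (@complex.Re R \o g).
    apply/funext => p; rewrite /= !fctE/=.
    by case: a (f p) (g p) => [a b] [u v] [s t] /=; rewrite mulNr.
  by do ?apply: smooth_realD => //; exact: smooth_realZ.
have -> : @complex.Im R \o (a *: f + g) =
    ((fun p => complex.Re a * complex.Im (f p)) \+
     (fun p => complex.Im a * complex.Re (f p))) \+ (@complex.Im R \o g).
  apply/funext => p; rewrite /= !fctE/=.
  by case: a (f p) (g p) => [a b] [u v] [s t] /=.
by do ?apply: smooth_realD => //; exact: smooth_realZ.
Qed.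

HB.instance Definition _ :=
  GRing.isSubmodClosed.Build _ _ smooth_pred smooth_submod_closed.

Record Cinf := MkCinf { cinf_fun :> M -> R[i]^o; _ : cinf_fun \in smooth_pred }.

HB.instance Definition _ := [isSub for cinf_fun].
HB.instance Definition _ := [Choice of Cinf by <:].
HB.instance Definition _ := [SubChoice_isSubLmodule of Cinf by <:].

Lemma cinf_smooth (f : Cinf) : smooth_complex f.
Proof. by apply/asboolP; exact: (valP f). Qed.

(* The Frechet topology of C^oo(M): uniform convergence of each iterated partial
   derivative, read in each chart, on each compact subset of the chart. *)
Definition cinf_close (c : chart) (K : set 'rV[R]_n) (s : seq 'I_n) (e : R)
    (f g : Cinf) : Prop :=
  forall x, K x ->
    `|iter_partial s (@complex.Re R \o f \o chart_bwd c) x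
      - iter_partial s (@complex.Re R \o g \o chart_bwd c) x| < e /\
    `|iter_partial s (@complex.Im R \o f \o chart_bwd c) x
      - iter_partial s (@complex.Im R \o g \o chart_bwd c) x| < e.

Definition cinf_index : set (chart * set 'rV[R]_n * seq 'I_n) :=
  [set t | [/\ atlas S t.1.1, compact t.1.2 & t.1.2 `<=` chart_cod t.1.1]].

Definition cinf_ball (F : set (chart * set 'rV[R]_n * seq 'I_n)) (e : R)
    (f : Cinf) : set Cinf :=
  [set g | forall t, F t -> cinf_close t.1.1 t.1.2 t.2 e f g].

Definition cinf_nbhs (f : Cinf) : set_system Cinf :=
  [set A | exists F e, [/\ finite_set F, F `<=` cinf_index, 0 < e &
                           cinf_ball F e f `<=` A]].

Lemma cinf_ball_refl F e f : 0 < e -> cinf_ball F e f f.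
Proof. by move=> e0 t _ x _; rewrite !subrr normr0. Qed.

Lemma cinf_ball_mono F F' e e' f : F `<=` F' -> e' <= e ->
  cinf_ball F' e' f `<=` cinf_ball F e f.
Proof.
move=> FF' ee' g fg t Ft x Kx; have [fg1 fg2] := fg t (FF' t Ft) x Kx.
by split; [exact: lt_le_trans fg1 _|exact: lt_le_trans fg2 _].
Qed.

Lemma cinf_ball_trans F e f g h :
  cinf_ball F (e / 2) f g -> cinf_ball F (e / 2) g h -> cinf_ball F e f h.
Proof.
move=> fg gh t Ft x Kx.
have [fg1 fg2] := fg t Ft x Kx; have [gh1 gh2] := gh t Ft x Kx.
split; rewrite (splitr e).
  by apply: le_lt_trans (ler_distD _ _ _) (ltrD fg1 gh1).
by apply: le_lt_trans (ler_distD _ _ _) (ltrD fg2 gh2).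
Qed.

Lemma cinf_nbhs_filter f : ProperFilter (cinf_nbhs f).
Proof.
split.
  by move=> [F [e [_ _ e0 /(_ f (@cinf_ball_refl F e f e0))]]].
split.
- by exists set0, 1; split=> //; exact: finite_set0.
- move=> A B [F [e [Ff FI e0 FA]]] [G [d [Gf GI d0 GB]]].
  exists (F `|` G), (Num.min e d); split.
  + by rewrite finite_setU.
  + by move=> t [/FI|/GI].
  + by rewrite lt_min e0 d0.
  + move=> g fg; split.
      by apply: FA; apply: cinf_ball_mono fg; [exact: subsetUl|rewrite ge_min lexx].
    by apply: GB; apply: cinf_ball_mono fg;
      [exact: subsetUr|rewrite ge_min lexx orbT].
- move=> A B AB [F [e [Ff FI e0 FA]]].
  by exists F, e; split=> //; exact: subset_trans FA AB.
Qed.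

Lemma cinf_nbhs_singleton f A : cinf_nbhs f A -> A f.
Proof. by move=> [F [e [_ _ e0]]]; apply; exact: cinf_ball_refl. Qed.

Lemma cinf_nbhs_nbhs f A : cinf_nbhs f A -> cinf_nbhs f (cinf_nbhs^~ A).
Proof.
move=> [F [e [Ff FI e0 FA]]]; exists F, (e / 2); split=> //; first exact: divr_gt0.
move=> g fg; exists F, (e / 2); split=> //; first exact: divr_gt0.
by move=> h gh; apply: FA; exact: cinf_ball_trans fg gh.
Qed.

HB.instance Definition _ := hasNbhs.Build Cinf cinf_nbhs.
HB.instance Definition _ := Nbhs_isNbhsTopological.Build Cinf
  cinf_nbhs_filter cinf_nbhs_singleton cinf_nbhs_nbhs.

(* A smooth real vector field, given by its components in the charts of the
   atlas, which transform by the differentials of the transition maps. *)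
Record vector_field := VectorField {
  vf_comp :> chart -> 'rV[R]_n -> 'rV[R]_n;
  vf_smooth : forall c, atlas S c -> smooth_on (chart_cod c) (vf_comp c);
  vf_change : forall c d x, atlas S c -> atlas S d -> overlap c d x ->
    vf_comp d (transition c d x) = vf_comp c x *m 'J (transition c d) x }.

Definition lie_real (X : vector_field) (h : M -> R) (p : M) : R :=
  let c := chart_at p in
  'D_(X c (chart_fwd c p)) (h \o chart_bwd c) (chart_fwd c p).

Lemma lie_real_chart X h c x : smooth_real h -> atlas S c -> chart_cod c x ->
  lie_real X h (chart_bwd c x) = 'D_(X c x) (h \o chart_bwd c) x.
Proof.
move=> sh Sc cx; rewrite /lie_real.
set p := chart_bwd c x; set d := chart_at p.
have Sd : atlas S d := chart_at_atlas p.
have dp : chart_dom d p := chart_at_dom p.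
have cdx : overlap c d x by split.
have tE : chart_fwd d p = transition c d x by [].
rewrite tE vf_change//.
have [/(_ 1%N) [dT _] _] := atlas_compatible Sc Sd.
have dh : differentiable (h \o chart_bwd d) (transition c d x).
  have [+ _] := sh d Sd 1%N; apply.
  exact: chart_fwd_cod dp.
rewrite -deriveEjacobian; last exact: dT.
transitivity ('D_(X c x) ((h \o chart_bwd d) \o transition c d) x).
  have dhT := differentiable_comp (dT x cdx) dh.
  have E := diff_comp (dT x cdx) dh.
  rewrite (deriveE _ dhT).
  rewrite (deriveE _ dh).
  rewrite (deriveE (X c x) (dT x cdx)).
  exact: (esym (congr1 (fun k => k (X c x)) E)).
apply: near_eq_derive.
apply: (open_near (@overlap_open c d) cdx) => y [cy dy].
by rewrite /= chart_fwdK.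
Qed.

Lemma lie_real_smooth X h : smooth_real h -> smooth_real (lie_real X h).
Proof.
move=> sh c Sc k.
apply: (@eq_Ck_on _ _ _ _ _ (fun x => 'D_(X c x) (h \o chart_bwd c) x)).
- exact: chart_cod_open.
- by move=> x cx; rewrite /= lie_real_chart.
- apply: smooth_on_derive; [exact: chart_cod_open|exact: vf_smooth|exact: sh].
Qed.

(* A real vector field acts on complex functions C-linearly. *)
Definition lie_fun (X : vector_field) (f : M -> R[i]^o) : M -> R[i]^o :=
  fun p => lie_real X (@complex.Re R \o f) p +i* lie_real X (@complex.Im R \o f) p.

Lemma lie_fun_smooth X (f : Cinf) : lie_fun X f \in smooth_pred.
Proof.
by apply/asboolP; have [f1 f2] := cinf_smooth f; split; exact: lie_real_smooth.
Qed.

Definition lie (X : vector_field) (f : Cinf) : Cinf := MkCinf (lie_fun_smooth X f).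

Definition cpartial (i : 'I_n) (g : 'rV[R]_n -> R[i]) (x : 'rV[R]_n) : R[i] :=
  partial i (@complex.Re R \o g) x +i* partial i (@complex.Im R \o g) x.

(* A smooth complex n-form: in the chart c it is
   [nf_coef c x dx_1 /\ ... /\ dx_n]. *)
Record nform := NForm {
  nf_coef :> chart -> 'rV[R]_n -> R[i];
  nf_smooth : forall c, atlas S c ->
    smooth_on (chart_cod c) (@complex.Re R \o nf_coef c) /\
    smooth_on (chart_cod c) (@complex.Im R \o nf_coef c);
  nf_change : forall c d x, atlas S c -> atlas S d -> overlap c d x ->
    nf_coef c x = (\det ('J (transition c d) x))%:C * nf_coef d (transition c d x) }.

(* Real-valued and nowhere vanishing. *)
Definition volume_form (w : nform) : Prop :=
  forall c x, atlas S c -> chart_cod c x ->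
    complex.Im (w c x) = 0 /\ w c x != 0.

(* By Cartan's formula L_X w = d(i_X w), as w has top degree. *)
Definition lie_nform (X : vector_field) (w : nform) (c : chart)
    (x : 'rV[R]_n) : R[i] :=
  \sum_i cpartial i (fun y => (X c y 0 i)%:C * w c y) x.

Definition volume_preserving (X : vector_field) : Prop :=
  exists2 w : nform, volume_form w &
    forall c x, atlas S c -> chart_cod c x -> lie_nform X w c x = 0.

Definition cohomology_free (X : vector_field) : Prop :=
  forall f : Cinf, exists (a : R[i]) (u : Cinf), forall p, lie X u p = f p - a.

Definition stable (X : vector_field) : Prop := closed (range (lie X)).

Definition lie_dist (X : vector_field) (U : Cinf -> R[i]^o) : Cinf -> R[i]^o :=
  fun f => - U (lie X f).

Definition distributions : set {linear Cinf -> R[i]^o} :=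
  [set U | continuous U].

Definition invariant_dist (X : vector_field) : set {linear Cinf -> R[i]^o} :=
  [set U | distributions U /\ forall f, lie_dist X U f = 0].

End Functions.

Section Integral.
Variables (S : smooth_structure) (O : orientation S).

Record partition_of_unity := PartitionOfUnity {
  pu_size : nat;
  pu_chart : 'I_pu_size -> chart;
  pu_fun : 'I_pu_size -> M -> R;
  pu_oriented : forall j, oriented O (pu_chart j);
  pu_smooth : forall j, smooth_real S (pu_fun j);
  pu_ge0 : forall j p, 0 <= pu_fun j p;
  pu_support : forall j,
    closure [set p | pu_fun j p != 0] `<=` chart_dom (pu_chart j);
  pu_sum : forall p, \sum_j pu_fun j p = 1 }.

Definition int_partition (P : partition_of_unity)
    (w : chart -> 'rV[R]_n -> R[i]) : R[i] :=
  \sum_(j < pu_size P) let c := pu_chart j in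
    let g := fun x => if x \in chart_cod c
                      then (pu_fun j (chart_bwd c x))%:C * w c x else 0 in
    int_rV (@complex.Re R \o g) +i* int_rV (@complex.Im R \o g).

(* The integral over the oriented compact manifold of the n-form with local
   coefficients [w].  Its value does not depend on the partition of unity; the
   branch [0] is never taken when [M] is compact Hausdorff. *)
Definition int_nform (w : chart -> 'rV[R]_n -> R[i]) : R[i] :=
  if pselect (exists P : partition_of_unity, True) is left e
  then int_partition (sval (cid e)) w else 0.

(* The distribution f |-> \int_M f w. *)
Definition nform_dist (w : nform S) : Cinf S -> R[i]^o :=
  fun f => int_nform (fun c x => f (chart_bwd c x) * w c x).

(* Omega^n(M), as a set of functionals on C^oo(M). *)
Definition smooth_dist : set (Cinf S -> R[i]^o) := range nform_dist.

Definition globally_hypoelliptic (X : vector_field S) : Prop :=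
  forall U : {linear Cinf S -> R[i]^o}, distributions U ->
    smooth_dist (lie_dist X U) -> smooth_dist U.

End Integral.
End Manifold.

(* Main.v *)
(* All three conditions are compared through integration: fixing a positive density,
   smooth n-forms become smooth functions h and the distribution f |-> int f h, and
   h defines an invariant distribution iff X h + h div X = 0.

   Under (1) or (3) every invariant distribution is such an h.  By
   Hahn-Banach against sup_M (a smooth function has X g = 0 at its maximum) there is
   an invariant h >= 0 of mass 1.  It vanishes nowhere: on the boundary B of {h > 0}
   either some X g is negative, and then the flow crosses a level set of
   h e^(lambda g) in one direction only, which is impossible, or Hahn-Banach against
   sup_B gives an invariant density supported in the nowhere dense set B.  Comparing
   f with min(f / h) h shows that h is unique up to a factor.

   If X is cohomology free, solving X u = div X - a gives the density e^(-u), and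
   invariant distributions, the range of X and the solutions U of L_X U = w are all
   read off from f = c(f) + X u.  If X is stable and satisfies (3), a separating
   functional shows that the range of X is the kernel of h.  If X is globally
   hypoelliptic, a gliding-hump argument bounds the local Lipschitz constants of
   functions phi_k with |phi_k| <= 1 and X phi_k -> 0; their weak limits are
   invariant, so that no such sequence of mean zero has maximum 1.  This gives an
   estimate |phi| <= C q(X phi), hence by Hahn-Banach a distribution solving
   X u = g, and hypoellipticity makes u smooth. *)
Require Import Defs.
From HB Require Import structures.
From mathcomp Require Import all_boot all_order all_algebra.
From mathcomp Require Import complex.
From mathcomp Require Import all_classical all_reals all_analysis.
From mathcomp Require Import lra ring.
Set Implicit Arguments. Unset Strict Implicit. Unset Printing Implicit Defensive.
Import Order.TTheory GRing.Theory Num.Theory.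
Import numFieldNormedType.Exports.
Local Open Scope classical_set_scope.
Local Open Scope ring_scope.

(** * Integration of compactly supported functions on R^n *)

Section RowVectorNorm.
Context {R : realType}.

(** The integral over M is given by iterated one-dimensional integrals in charts, so it says nothing
    about a second chart until the change of variables formula is known. That formula is obtained by
    mollifying a push-forward, which rests on Fubini and on the linear case. It also shows that the
    divergence does not depend on the chart: the candidates of two charts have the same integrals
    against bumps. Hahn-Banach is stated over the reals with a cone of prescribed lower bounds; on a
    subspace of constraints the bounds become equalities, such as T (X f) = 0 and T v = 1 at once.
    Distributions are therefore replaced by real functionals on real smooth functions.
    Hypoellipticity is a qualitative statement, whereas solving X u = g needs an inequality. In
    place of a closed graph argument, a concrete series is built whose sum would have a smooth
    derivative along X without being Lipschitz on a chart ball. Connectedness enters only when the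
    set where an invariant density is positive turns out to be open and closed. *)

Lemma rV_norm_leP n (x : 'rV[R]_n) (r : R) : 0 <= r ->
  (`|x| <= r) <-> (forall i, `|x 0 i| <= r).
Proof.
move=> r0; rewrite [`|x|]/Num.norm/= mx_normrE; split.
  move=> /bigmax_leP[_ H] i; exact: (H (0, i)).
by move=> H; apply/bigmax_leP; split=> // -[i j] _ /=; rewrite (ord1 i).
Qed.

Lemma rV_coord_le n (x : 'rV[R]_n) i : `|x 0 i| <= `|x|.
Proof. exact: (rV_norm_leP _ (normr_ge0 x)).1. Qed.

Lemma row_mx_norm_leP m n (x : 'rV[R]_m) (y : 'rV[R]_n) (r : R) : 0 <= r ->
  (`|row_mx x y| <= r) <-> (`|x| <= r /\ `|y| <= r).
Proof.
move=> r0; rewrite !rV_norm_leP//; split.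
  by move=> H; split=> i; [have := H (lshift n i)|have := H (rshift m i)];
    rewrite ?row_mxEl ?row_mxEr.
by move=> [H1 H2] i; rewrite mxE; case: (fintype.split i) => j.
Qed.

Lemma const_mx_norm (t : R) : `|const_mx t : 'rV[R]_1| = `|t|.
Proof.
apply/eqP; rewrite eq_le; apply/andP; split.
  by apply/rV_norm_leP => // i; rewrite mxE.
by have := rV_coord_le (const_mx t : 'rV[R]_1) 0; rewrite mxE.
Qed.

Lemma closed_ball_rV_compact n (a : 'rV[R]_n) (r : R) :
  compact [set x : 'rV[R]_n | `|x - a| <= r].
Proof.
apply: bounded_closed_compact.
  exists (`|a| + r); split; first by rewrite num_real.
  move=> M arM x /= xar; apply: (le_trans _ (ltW arM)).
  by have := ler_normD (x - a) a; rewrite subrK => /le_trans; apply; rewrite addrC lerD2l.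
have -> : [set x : 'rV[R]_n | `|x - a| <= r] =
  (fun x => `|x - a|) @^-1` [set t | t <= r] by [].
apply: closed_comp; last exact: closed_le.
move=> x _; apply: continuous_comp; last exact: norm_continuous.
by apply: continuousB; [exact: cvg_id|exact: cst_continuous].
Qed.

Lemma rV_ball_normP n (x y : 'rV[R]_n) (e : R) : ball x e y <-> `|x - y| < e.
Proof. by rewrite -ball_normE. Qed.
End RowVectorNorm.

Section ContinuousArith.
Context {R : realType} {T : topologicalType}.
Implicit Types f g : T -> R.

Lemma contD f g : continuous f -> continuous g -> continuous (fun x => f x + g x).
Proof. by move=> cf cg x; apply: cvgD; [exact: cf|exact: cg]. Qed.

Lemma contB f g : continuous f -> continuous g -> continuous (fun x => f x - g x).
Proof. by move=> cf cg x; apply: cvgB; [exact: cf|exact: cg]. Qed.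

Lemma contM f g : continuous f -> continuous g -> continuous (fun x => f x * g x).
Proof. by move=> cf cg x; apply: cvgM; [exact: cf|exact: cg]. Qed.

Lemma cont_norm (V : normedModType R) (f : T -> V) :
  continuous f -> continuous (fun x => `|f x|).
Proof. by move=> cf x; apply: cvg_norm; exact: cf. Qed.

Lemma cont_cst (V : topologicalType) (a : V) : continuous (fun _ : T => a).
Proof. by move=> x; exact: cvg_cst. Qed.

Lemma cont_id : continuous (fun x : T => x).
Proof. by move=> x; exact: cvg_id. Qed.

Lemma cont_comp (U V : topologicalType) (f : T -> U) (g : U -> V) :
  continuous f -> continuous g -> continuous (fun x => g (f x)).
Proof. by move=> cf cg x; apply: (continuous_comp (cf x)); exact: cg. Qed.
End ContinuousArith.

(** Stated over any normed module, so that it serves for [R] and for row vectors alike. A radius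
    replaces the compact support; the two agree in finite dimension. *)
Definition compactly_supported {R : realType} {V : normedModType R} (g : V -> R) : Prop :=
  continuous g /\ exists r, forall x, r < `|x| -> g x = 0.
Notation Cc := compactly_supported.

Section CompactSupport.
Context {R : realType} {V : normedModType R}.
Implicit Types f g : V -> R.

Lemma Cc_supp g : Cc g -> exists2 r, 0 < r & forall x, r <= `|x| -> g x = 0.
Proof.
move=> [_ [r rg]]; exists (Num.max 0 r + 1); first by rewrite ltr_wpDl// le_max lexx.
move=> x rx; apply: rg; apply: lt_le_trans rx.
by rewrite (@le_lt_trans _ _ (Num.max 0 r))// ?le_max ?lexx ?orbT// ltrDl.
Qed.

Lemma Cc0 : Cc (cst 0 : V -> R).
Proof. by split; [exact: cst_continuous|exists 0]. Qed.

Lemma CcD f g : Cc f -> Cc g -> Cc (fun x => f x + g x).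
Proof.
move=> [cf [r rf]] [cg [s sg]]; split.
  by move=> x; apply: continuousD; [exact: cf|exact: cg].
by exists (Num.max r s) => x; rewrite gt_max => /andP[/rf-> /sg->]; rewrite addr0.
Qed.

Lemma CcMl (h : V -> R) g : continuous h -> Cc g -> Cc (fun x => h x * g x).
Proof.
move=> ch [cg [r rg]]; split.
  by move=> x; apply: continuousM; [exact: ch|exact: cg].
by exists r => x /rg ->; rewrite mulr0.
Qed.

Lemma CcZ (a : R) g : Cc g -> Cc (fun x => a * g x).
Proof. by move=> cg; apply: (@CcMl (cst a)) => //; exact: cst_continuous. Qed.

Lemma CcN g : Cc g -> Cc (fun x => - g x).
Proof. by move=> /(CcZ (-1)); under eq_fun do rewrite mulN1r. Qed.

Lemma CcB f g : Cc f -> Cc g -> Cc (fun x => f x - g x).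
Proof. by move=> cf cg; apply: CcD => //; exact: CcN. Qed.

Lemma Cc_sum (I : Type) (s : seq I) (F : I -> V -> R) :
  (forall i, Cc (F i)) -> Cc (fun x => \sum_(i <- s) F i x).
Proof.
move=> cF; elim: s => [|i s IH].
  by under eq_fun do rewrite big_nil; exact: Cc0.
by under eq_fun do rewrite big_cons; apply: CcD.
Qed.

Lemma Cc_norm g : Cc g -> Cc (fun x => `|g x|).
Proof.
move=> [cg [r rg]]; split.
  by move=> x; apply: continuous_comp; [exact: cg|exact: norm_continuous].
by exists r => x /rg ->; rewrite normr0.
Qed.

(** The affine bound is properness of [h] in quantitative form: a bounded image forces a bounded
    argument. *)
Lemma Cc_comp (W : normedModType R) (h : W -> V) g (a b : R) :
  continuous h -> (forall w, `|w| <= a * `|h w| + b) -> 0 <= a -> Cc g -> Cc (g \o h).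
Proof.
move=> ch ab a0 [cg [r rg]]; split.
  by move=> x; apply: continuous_comp; [exact: ch|exact: cg].
exists (a * r + b) => w rw; apply: rg; rewrite ltNge; apply/negP => hr.
have := le_lt_trans (le_trans (ab w) _) rw.
by rewrite ltxx => H; suff : false by []; apply: H; rewrite lerD2r ler_wpM2l.
Qed.

Lemma Cc_shift (a : V) g : Cc g -> Cc (fun x => g (x + a)).
Proof.
move=> cg; apply: (@Cc_comp _ (fun x => x + a) _ 1 `|a|) => //.
  by move=> x; apply: continuousD; [exact: cvg_id|exact: cst_continuous].
by move=> w; rewrite mul1r -{1}[w](addrK a) ler_normB.
Qed.
End CompactSupport.

(** * One-dimensional integrals of compactly supported functions *)

Section Integral1.
Context {R : realType}.
Notation mu := (@lebesgue_measure R).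
Implicit Types f g : R -> R.

Lemma Cc_integrable g : Cc g -> mu.-integrable setT (EFin \o g).
Proof.
move=> cg; have [r r0 rg] := Cc_supp cg.
have -> : EFin \o g = (EFin \o g) \_ `[-r, r].
  apply/funext => x; rewrite patchE; case: ifPn => //; rewrite notin_setE/= in_itv/=.
  move/negP; rewrite -ler_norml -ltNge => /ltW/rg /= -> //.
apply: (integrable_mkcond _ _).1 => //.
apply: continuous_compact_integrable; first exact: segment_compact.
by apply: continuous_subspaceT; case: cg.
Qed.

Lemma Rint_itv g (r : R) : (forall x, r <= `|x| -> g x = 0) ->
  \int[mu]_t g t = \int[mu]_(t in `[-r, r]) g t.
Proof.
move=> rg; rewrite [RHS]Rintegral_mkcond; congr (Rintegral _ _ _).
apply/funext => x; rewrite patchE; case: ifPn => //; rewrite notin_setE/= in_itv/=.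
by move/negP; rewrite -ler_norml -ltNge => /ltW/rg.
Qed.

Lemma Rint_bound g (r C : R) : Cc g -> 0 <= C -> 0 <= r -> (forall x, `|g x| <= C) ->
  (forall x, r < `|x| -> g x = 0) -> `|\int[mu]_t g t| <= C * (2 * r).
Proof.
move=> cg C0 r0 gC rg.
apply: (le_trans (le_normr_Rintegral _ _)) => //; first exact: Cc_integrable.
have -> : \int[mu]_t `|g t| = \int[mu]_(t in `[-r, r]) `|g t|.
  rewrite [RHS]Rintegral_mkcond; congr (Rintegral _ _ _).
  apply/funext => x; rewrite patchE; case: ifPn => //; rewrite notin_setE/= in_itv/=.
  by move/negP; rewrite -ler_norml -ltNge => /rg ->; rewrite normr0.
have -> : C * (2 * r) = \int[mu]_(t in `[-r, r]) (cst C t).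
  rewrite Rintegral_cst//= lebesgue_measure_itv/= lte_fin.
  case: ltgtP => [|//|] h; [|lra|]; last first.
    by rewrite /= (_ : r = 0) ?mulr0//; lra.
  by congr (_ * _); rewrite /= opprK; lra.
apply: le_Rintegral => //.
- apply: continuous_compact_integrable; first exact: segment_compact.
  by apply: continuous_subspaceT; case: (Cc_norm cg).
- apply: continuous_compact_integrable; first exact: segment_compact.
  by apply: continuous_subspaceT; exact: cst_continuous.
Qed.

Lemma Rint_sub_pos g : Cc g -> exists f h, [/\ Cc f, Cc h, forall x, 0 <= f x,
  forall x, 0 <= h x & forall x, g x = f x - h x].
Proof.
move=> cg; exists (fun x => 2^-1 * (`|g x| + g x)), (fun x => 2^-1 * (`|g x| - g x)); split.
- by apply: CcZ; apply: CcD => //; exact: Cc_norm.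
- by apply: CcZ; apply: CcB => //; exact: Cc_norm.
- by move=> x; rewrite mulr_ge0// -[X in _ + X]opprK subr_ge0 -normrN ler_norm.
- by move=> x; rewrite mulr_ge0// subr_ge0 ler_norm.
- by move=> x; field.
Qed.

(** The substitution theorem used here concerns nonnegative functions, so [g] is split by
    [Rint_sub_pos] and each part is treated separately. A positive [a] keeps the map increasing. *)
Lemma Rint_affine g (a b : R) : Cc g -> 0 < a ->
  \int[mu]_t g t = \int[mu]_t (a * g (a * t + b)).
Proof.
have H g0 (c : R) : Cc g0 -> 0 < a -> (forall x, 0 <= g0 x) ->
    \int[mu]_t g0 t = \int[mu]_t (a * g0 (a * t + b)).
  move=> [cg _] a0 gge; rewrite /Rintegral; congr fine.
  pose F := fun t : R => a * t + b.
  have dF x : is_derive x (1 : R) F a.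
    rewrite (_ : F = a *: id + cst b)//; apply: is_derive_eq.
    by rewrite addr0 [_ *: _]mulr1.
  have F'E : derive1 F = cst a.
    by apply/funext => x; rewrite derive1E; have [] := dF x.
  rewrite (@increasing_ge0_integration_by_substitutionT _ F)//.
  - apply: eq_integral => x _; rewrite F'E/= /F /=; congr (_%:E).
    by rewrite [LHS]mulrC.
  - by move=> x y xy; rewrite /F ltrD2r ltr_pM2l.
  - by rewrite F'E; exact: cst_continuous.
  - by rewrite F'E; exact: is_cvg_cst.
  - by rewrite F'E; exact: is_cvg_cst.
  - apply/cvgrNyPle => M; near=> x; rewrite /F -lerBrDr -ler_pdivlMl//.
  - apply/cvgryPge => M; near=> x; rewrite /F -lerBlDr -ler_pdivrMl//.
move=> cg a0; have [f [h [cf ch f0 h0 gE]]] := Rint_sub_pos cg.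
have cA k : Cc k -> Cc (fun t => a * k (a * t + b)).
  move=> ck; apply: CcZ; apply: (@Cc_comp _ _ _ (fun t : R => a * t + b) _ a^-1 `|a^-1 * b|) => //.
  - move=> x; apply: continuousD; last exact: cst_continuous.
    by apply: continuousM; [exact: cst_continuous|exact: cvg_id].
  - move=> w; have {1}-> : w = a^-1 * (a * w + b) - a^-1 * b by field; rewrite gt_eqF.
    by rewrite (le_trans (ler_normB _ _))// lerD2r normrM gtr0_norm ?invr_gt0.
  - by rewrite ltW// invr_gt0.
rewrite (_ : g = fun x => f x - h x); last exact/funext.
rewrite RintegralB//; [|exact: Cc_integrable..].
under [RHS]eq_Rintegral do rewrite mulrBr.
rewrite RintegralB//; [|by apply: Cc_integrable; exact: cA..].
by rewrite -!H.
Unshelve. all: by end_near. Qed.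

Lemma Rint_opp g : Cc g -> \int[mu]_t g t = \int[mu]_t g (- t).
Proof.
move=> cg; have [r r0 rg] := Cc_supp cg.
rewrite (Rint_itv rg) (@Rint_itv (fun t => g (- t)) r); last first.
  by move=> x; rewrite -normrN => /rg.
rewrite /Rintegral; congr fine.
rewrite -[in LHS](opprK r) -[X in `[_, X]]opprK.
rewrite -integration_by_substitution_oppr ?opprK//.
  by rewrite -subr_ge0 opprK addr_ge0// ltW.
by apply: continuous_subspaceT; case: cg.
Qed.

Lemma Rint_gt0 g : Cc g -> (forall x, 0 <= g x) -> (exists x, 0 < g x) ->
  0 < \int[mu]_t g t.
Proof.
move=> cg g0 [x0 gx0].
have cgx : g x @[x --> x0] --> g x0 by case: cg => + _; exact.
have : \forall y \near x0, g x0 / 2 < g y.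
  have lt2 : g x0 / 2 < g x0 by lra.
  by move/cvgr_gt: cgx; apply.
move=> /nbhs_ballP[e /= e0 eg].
set I := `[x0 - e/2, x0 + e/2]%classic.
have mI : measurable I by exact: measurable_itv.
apply: (@lt_le_trans _ _ (\int[mu]_(t in I) (cst (g x0 / 2) t))).
  rewrite Rintegral_cst//= lebesgue_measure_itv/= lte_fin ifT; last by lra.
  by rewrite /= mulr_gt0//; lra.
apply: (@le_trans _ _ (\int[mu]_(t in I) g t)).
  apply: le_Rintegral => //.
  - apply: continuous_compact_integrable; first exact: segment_compact.
    by apply: continuous_subspaceT; exact: cst_continuous.
  - apply: continuous_compact_integrable; first exact: segment_compact.
    by apply: continuous_subspaceT; case: cg.
  - move=> x; rewrite /I/= in_itv/= => /andP[x1 x2]; apply/ltW/eg.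
    by rewrite /ball/= ltr_distlC; apply/andP; split; lra.
rewrite Rintegral_mkcond; apply: le_Rintegral => //.
- apply: (@eq_integrable _ _ _ mu setT _ ((EFin \o g) \_ I)) => //.
    by move=> x _; rewrite /= !patchE; case: ifP.
  apply: (integrable_mkcond _ _).1 => //.
  apply: continuous_compact_integrable; first exact: segment_compact.
  by apply: continuous_subspaceT; case: cg.
- exact: Cc_integrable.
- by move=> x _; rewrite patchE; case: ifP.
Qed.
End Integral1.

Lemma continuous_distP {R : realType} (V W : normedModType R) (f : V -> W) :
  continuous f <-> forall x e, 0 < e ->
    exists2 d, 0 < d & forall y, `|x - y| < d -> `|f x - f y| < e.
Proof.
split=> [cf x e e0|H x].
  have /cvgrPdist_lt/(_ e e0)/nbhs_ballP[d /= d0 dP] := cf x.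
  by exists d => // y xy; apply: dP; rewrite -ball_normE.
apply/cvgrPdist_lt => e e0; have [d d0 dP] := H x e e0.
by apply/nbhs_ballP; exists d => //= y; rewrite -ball_normE => /dP.
Qed.

(** * The iterated integral over R^n *)

Section IntRV.
Context {R : realType}.
Notation mu := (@lebesgue_measure R).

Lemma Cc_bounded n (g : 'rV[R]_n -> R) : Cc g ->
  exists2 C, 0 <= C & forall x, `|g x| <= C.
Proof.
move=> cg; have [r r0 rg] := Cc_supp cg.
have K0 : [set x : 'rV[R]_n | `|x - 0| <= r] !=set0.
  by exists 0; rewrite /= subrr normr0 ltW.
have [|c _ cM] := EVT_max_rV K0 (@closed_ball_rV_compact R n 0 r) (f := fun x => `|g x|).
  by apply: continuous_subspaceT; case: (Cc_norm cg).
exists `|g c| => // x; have [xr|/ltW xr] := leP `|x| r.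
  by apply: cM; rewrite inE /= subr0.
by rewrite (rg _ xr) normr0.
Qed.

(** Compactness, along the filter of right neighbourhoods of 0, turns the local moduli into one
    modulus on a closed ball. A margin of 1 in the radius takes care of the points outside: their
    neighbours within distance 1 still lie where [g] vanishes. *)
Lemma Cc_unif_continuous n (g : 'rV[R]_n -> R) (e : R) : Cc g -> 0 < e ->
  exists2 d, 0 < d & forall x y, `|x - y| < d -> `|g x - g y| < e.
Proof.
move=> cg e0; have [r r0 rg] := Cc_supp cg.
pose P d (x : 'rV[R]_n) := forall y, `|x - y| < d -> `|g x - g y| < e.
have /compact_near_coveringP/(_ R (0 : R)^'+ P) := @closed_ball_rV_compact R n 0 (r + 1).
case=> [x _|].
  have : \forall y \near x, `|g x - g y| < e / 2.
    by case: cg => /(_ x)/cvgrPdist_lt/(_ (e / 2)) + _; apply; rewrite divr_gt0.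
  move=> /nbhs_ballP[d /= d0 xd].
  exists (ball x (d / 2), [set d' | d' < d / 2]).
    split=> /=; first by apply: nbhsx_ballx; rewrite divr_gt0.
    by apply: nbhs_right_lt; rewrite divr_gt0.
  move=> [x' d'] /= [/rV_ball_normP xx' dd'] y x'y.
  have h1 : `|g x - g x'| < e / 2.
    by apply: xd; apply/rV_ball_normP; apply: (lt_trans xx'); lra.
  have h2 : `|g x - g y| < e / 2.
    apply: xd; apply/rV_ball_normP; apply: (le_lt_trans (ler_distD x' _ _)).
    by rewrite (splitr d) ltrD// (lt_trans x'y).
  rewrite distrC in h1; apply: (le_lt_trans (ler_distD (g x) _ _)).
  by rewrite (splitr e) ltrD.
move=> d /= d0 dP; pose d1 := Num.min (d / 2) 1.
have d10 : 0 < d1 by rewrite lt_min divr_gt0// ltr01.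
exists d1 => // x y xy; have [xr|xr] := leP `|x| (r + 1).
  apply: (dP d1) => //=; last by rewrite subr0.
  rewrite sub0r normrN gtr0_norm// gt_min; apply/orP; left; lra.
have xy1 : `|x - y| < 1 by rewrite (lt_le_trans xy)// ge_min lexx orbT.
have yr : r <= `|y|.
  by have := ler_normD (x - y) y; rewrite subrK => h; lra.
by rewrite (rg _ yr) (rg x) ?subr0 ?normr0//; lra.
Qed.

Lemma row_mx_dist m n (x x' : 'rV[R]_m) (y y' : 'rV[R]_n) :
  `|row_mx x y - row_mx x' y'| <= Num.max `|x - x'| `|y - y'|.
Proof.
by rewrite opp_row_mx add_row_mx; apply/row_mx_norm_leP; rewrite ?le_max ?lexx ?normr_ge0 ?orbT.
Qed.

Lemma row_mx_norm_ge m n (x : 'rV[R]_m) (y : 'rV[R]_n) :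
  `|x| <= `|row_mx x y| /\ `|y| <= `|row_mx x y|.
Proof. exact/row_mx_norm_leP. Qed.

Lemma row_mx_continuousr m n (x : 'rV[R]_m) :
  continuous (fun y : 'rV[R]_n => row_mx x y).
Proof.
apply/continuous_distP => y e e0; exists e => // y' yy'.
by apply: (le_lt_trans (row_mx_dist _ _ _ _)); rewrite subrr normr0 gt_max e0/=.
Qed.

Lemma row_mx_continuousl m n (y : 'rV[R]_n) :
  continuous (fun x : 'rV[R]_m => row_mx x y).
Proof.
apply/continuous_distP => x e e0; exists e => // x' xx'.
by apply: (le_lt_trans (row_mx_dist _ _ _ _)); rewrite subrr normr0 gt_max e0 andbT.
Qed.

Lemma Cc_row_mxr m n (g : 'rV[R]_(m + n) -> R) (x : 'rV[R]_m) : Cc g ->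
  Cc (fun y => g (row_mx x y)).
Proof.
move=> cg; apply: (@Cc_comp _ _ _ (fun y => row_mx x y) g 1 0) => //.
  exact: row_mx_continuousr.
by move=> y; rewrite mul1r addr0; case: (row_mx_norm_ge x y).
Qed.

Lemma Cc_row_mxl m n (g : 'rV[R]_(m + n) -> R) (y : 'rV[R]_n) : Cc g ->
  Cc (fun x => g (row_mx x y)).
Proof.
move=> cg; apply: (@Cc_comp _ _ _ (fun x => row_mx x y) g 1 0) => //.
  exact: row_mx_continuousl.
by move=> x; rewrite mul1r addr0; case: (row_mx_norm_ge x y).
Qed.

Definition row_cons n (t : R) (v : 'rV[R]_n) : 'rV[R]_n.+1 :=
  row_mx (const_mx t : 'rV[R]_1) v.

Definition row_tail n (x : 'rV[R]_n.+1) : 'rV[R]_n := rsubmx (x : 'rV_(1 + n)).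

Lemma row_consK n (x : 'rV[R]_n.+1) : row_cons (x 0 0) (row_tail x) = x.
Proof.
transitivity (row_mx (lsubmx (x : 'rV_(1 + n))) (row_tail x)); last exact: (@hsubmxK _ 1 1 n x).
suff -> : lsubmx (x : 'rV_(1 + n)) = const_mx (x 0 0) by [].
by apply/rowP => i; rewrite !mxE (ord1 i); congr (x _ _); exact/val_inj.
Qed.

Lemma row_consD n (s t : R) (v w : 'rV[R]_n) :
  row_cons s v + row_cons t w = row_cons (s + t) (v + w).
Proof.
transitivity (row_mx (const_mx s + const_mx t : 'rV[R]_1) (v + w)); first exact: (@add_row_mx _ 1 1 n).
by suff -> : const_mx s + const_mx t = const_mx (s + t) :> 'rV[R]_1; last apply/rowP => i; rewrite ?mxE.
Qed.

Lemma row_cons_norm_ge n (t : R) (v : 'rV[R]_n) :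
  `|t| <= `|row_cons t v| /\ `|v| <= `|row_cons t v|.
Proof. by rewrite -(const_mx_norm t); exact: row_mx_norm_ge. Qed.

Lemma row_cons_dist n (t t' : R) (v v' : 'rV[R]_n) :
  `|row_cons t v - row_cons t' v'| <= Num.max `|t - t'| `|v - v'|.
Proof.
have := row_mx_dist (const_mx t : 'rV[R]_1) (const_mx t') v v'.
rewrite (_ : const_mx t - const_mx t' = const_mx (t - t')) ?const_mx_norm//.
by apply/matrixP => i j; rewrite !mxE.
Qed.

Lemma int_rVS n (g : 'rV[R]_n.+1 -> R) :
  int_rV g = \int[mu]_t int_rV (fun v => g (row_cons t v)).
Proof. by []. Qed.

Lemma Cc_row_cons n (g : 'rV[R]_n.+1 -> R) t : Cc g -> Cc (fun v => g (row_cons t v)).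
Proof. exact: (@Cc_row_mxr 1 n g (const_mx t)). Qed.

(** Linearity and the cube bound are proved together by induction on the dimension: the outer
    integral is linear only once the inner one is known to be continuous in [t], and that continuity
    uses all three properties one dimension below. *)
Definition int_rV_spec n :=
  [/\ forall f g : 'rV[R]_n -> R, Cc f -> Cc g ->
        int_rV (fun x => f x + g x) = int_rV f + int_rV g,
      forall a (g : 'rV[R]_n -> R), Cc g -> int_rV (fun x => a * g x) = a * int_rV g &
      forall (g : 'rV[R]_n -> R) (r C : R), Cc g -> 0 <= C -> 0 <= r -> (forall x, `|g x| <= C) ->
        (forall x, r < `|x| -> g x = 0) -> `|int_rV g| <= C * (2 * r) ^+ n].

Lemma spec_Cc_int n (g : 'rV[R]_n.+1 -> R) : int_rV_spec n -> Cc g ->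
  Cc (fun t => int_rV (fun v => g (row_cons t v))).
Proof.
move=> [sD sZ sB] cg; have [r r0 rg] := Cc_supp cg; split; last first.
  exists r => t rt.
  have -> : (fun v : 'rV[R]_n => g (row_cons t v)) = fun v => 0 * (0 : R).
    apply/funext => v; rewrite mul0r rg//.
    by apply: (le_trans (ltW rt)); case: (row_cons_norm_ge t v).
  by rewrite (sZ 0 (cst 0)) ?mul0r//; exact: Cc0.
apply/continuous_distP => t e e0.
(* The volume of the cube that contains the supports of both slices. *)
pose c := (2 * r) ^+ n; have c0 : 0 < c by rewrite exprn_gt0// mulr_gt0.
have ec : 0 < e / 2 / c by rewrite !divr_gt0.
have [d d0 dg] := Cc_unif_continuous cg ec; exists d => // t' tt'.
have -> : int_rV (fun v => g (row_cons t v)) - int_rV (fun v => g (row_cons t' v)) =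
  int_rV (fun v => g (row_cons t v) + (-1) * g (row_cons t' v)).
  by rewrite sD ?sZ ?mulN1r//; [exact: Cc_row_cons|exact: Cc_row_cons|apply: CcZ; exact: Cc_row_cons].
apply: (@le_lt_trans _ _ (e / 2)); last by lra.
rewrite -[leRHS](divfK (lt0r_neq0 c0)); apply: sB.
- by apply: CcD; [|apply: CcZ]; exact: Cc_row_cons.
- exact: ltW.
- exact: ltW.
- move=> v; rewrite mulN1r; apply/ltW/dg; apply: (le_lt_trans (row_cons_dist _ _ _ _)).
  by rewrite subrr normr0 gt_max d0 andbT.
- move=> v /ltW rv; rewrite !rg ?mulr0 ?addr0//.
    by apply: (le_trans rv); case: (row_cons_norm_ge t' v).
  by apply: (le_trans rv); case: (row_cons_norm_ge t v).
Qed.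

Lemma int_rV_specP n : int_rV_spec n.
Proof.
elim: n => [|n IH].
  by split=> //= g r C _ _ _ gC _; rewrite expr0 mulr1.
have [sD sZ sB] := IH; split.
- move=> f g cf cg; rewrite !int_rVS -RintegralD//; last 2 first.
  + by apply: Cc_integrable; exact: spec_Cc_int.
  + by apply: Cc_integrable; exact: spec_Cc_int.
  apply: eq_Rintegral => t _; rewrite -sD//; exact: Cc_row_cons.
- move=> a g cg; rewrite !int_rVS -RintegralZl//; last first.
  + by apply: Cc_integrable; exact: spec_Cc_int.
  apply: eq_Rintegral => t _; rewrite -sZ//; exact: Cc_row_cons.
- move=> g r C cg C0 r0 gC rg; rewrite int_rVS exprSr mulrA; apply: Rint_bound => //.
  + exact: spec_Cc_int.
  + by rewrite mulr_ge0// exprn_ge0// mulr_ge0.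
  + move=> t; apply: sB => //; first exact: Cc_row_cons.
    move=> v rv; apply: rg; apply: (lt_le_trans rv).
    by case: (row_cons_norm_ge t v).
  + move=> t rt; rewrite (_ : (fun _ => _) = fun v => 0 * (0 : R)); last first.
      apply/funext => v; rewrite mul0r rg//; apply: (lt_le_trans rt).
      by case: (row_cons_norm_ge t v).
    by rewrite (sZ 0 (cst 0)) ?mul0r//; exact: Cc0.
Qed.

Lemma int_rVD n (f g : 'rV[R]_n -> R) : Cc f -> Cc g ->
  int_rV (fun x => f x + g x) = int_rV f + int_rV g.
Proof. by have [+ _ _] := int_rV_specP n; apply. Qed.

Lemma int_rVZ n a (g : 'rV[R]_n -> R) : Cc g ->
  int_rV (fun x => a * g x) = a * int_rV g.
Proof. by have [_ + _] := int_rV_specP n; apply. Qed.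

Lemma int_rV_bound n (g : 'rV[R]_n -> R) (r C : R) : Cc g -> 0 <= C -> 0 <= r ->
  (forall x, `|g x| <= C) -> (forall x, r < `|x| -> g x = 0) ->
  `|int_rV g| <= C * (2 * r) ^+ n.
Proof. by have [_ _ +] := int_rV_specP n; apply. Qed.

Lemma Cc_int_row_cons n (g : 'rV[R]_n.+1 -> R) : Cc g ->
  Cc (fun t => int_rV (fun v => g (row_cons t v))).
Proof. exact: spec_Cc_int (int_rV_specP n). Qed.

Lemma int_rVN n (g : 'rV[R]_n -> R) : Cc g -> int_rV (fun x => - g x) = - int_rV g.
Proof. by move=> cg; rewrite -mulN1r -int_rVZ//; congr int_rV; apply/funext => x; rewrite mulN1r. Qed.

Lemma int_rVB n (f g : 'rV[R]_n -> R) : Cc f -> Cc g ->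
  int_rV (fun x => f x - g x) = int_rV f - int_rV g.
Proof. by move=> cf cg; rewrite int_rVD ?int_rVN//; exact: CcN. Qed.

Lemma int_rV0 n : int_rV (cst 0 : 'rV[R]_n -> R) = 0.
Proof.
rewrite (_ : cst 0 = fun x : 'rV[R]_n => 0 * (cst 0 x)); first by rewrite int_rVZ ?mul0r//; exact: Cc0.
by apply/funext => x; rewrite mul0r.
Qed.

Lemma int_rV_sum n (I : Type) (s : seq I) (F : I -> 'rV[R]_n -> R) :
  (forall i, Cc (F i)) ->
  int_rV (fun x => \sum_(i <- s) F i x) = \sum_(i <- s) int_rV (F i).
Proof.
move=> cF; elim: s => [|i s IH].
  by under eq_fun do rewrite big_nil; rewrite big_nil int_rV0.
under eq_fun do rewrite big_cons.
by rewrite big_cons int_rVD// ?IH//; exact: Cc_sum.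
Qed.

Lemma int_rV_pos n (g : 'rV[R]_n -> R) : Cc g -> (forall x, 0 <= g x) ->
  0 <= int_rV g /\ ((exists x, 0 < g x) -> 0 < int_rV g).
Proof.
elim: n g => [|n IH] g cg g0.
  by rewrite /=; split=> // -[x]; rewrite (_ : x = 0)//; apply/rowP => -[].
have h t : 0 <= int_rV (fun v => g (row_cons t v)).
  by apply: (IH _ _ _).1; [exact: Cc_row_cons|].
split; first by rewrite int_rVS; apply: Rintegral_ge0.
move=> [x gx]; rewrite int_rVS; apply: Rint_gt0 => //; first exact: Cc_int_row_cons.
exists (x 0 0); apply: (IH _ _ _).2; [exact: Cc_row_cons|by []|].
by exists (row_tail x); rewrite row_consK.
Qed.

Lemma int_rV_shift n (g : 'rV[R]_n -> R) a : Cc g ->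
  int_rV (fun x => g (x + a)) = int_rV g.
Proof.
elim: n g a => [|n IH] g a cg; first by rewrite /=; congr g; apply/rowP => -[].
pose b := row_tail a.
have E t v : row_cons t v + a = row_cons (t + a 0 0) (v + b).
  by rewrite -{1}[a]row_consK row_consD.
rewrite int_rVS; transitivity (\int[mu]_t int_rV (fun v => g (row_cons (t + a 0 0) v))).
  apply: eq_Rintegral => t _; rewrite -[RHS](IH _ b); last exact: Cc_row_cons.
  by congr int_rV; apply/funext => v; rewrite E.
rewrite int_rVS [RHS](@Rint_affine _ _ 1 (a 0 0))//; last exact: Cc_int_row_cons.
by apply: eq_Rintegral => t _; rewrite !mul1r.
Qed.

End IntRV.

(** * Exchange of the order of integration *)

Section Fubini.
Context {R : realType}.
Notation mu := (@lebesgue_measure R).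

Lemma row_cons_row_mx m n (t : R) (x : 'rV[R]_m) (y : 'rV[R]_n) :
  row_cons t (row_mx x y) = row_mx (row_cons t x) y.
Proof.
have := @row_mxA R 1 1 m n (const_mx t) x y; rewrite /row_cons => ->.
by rewrite (_ : esym _ = erefl) ?castmx_id//; exact: eq_irrelevance.
Qed.

(** The truncation of [u] to the interval [0, 1]. Differences of translates give the tent [hat],
    whose integer translates telescope to a partition of unity. *)
Definition clamp (u : R) : R := (`|u| + 1 - `|u - 1|) / 2.
Definition hat (u : R) : R := clamp (u + 1) - clamp u.

Lemma clamp_cont : continuous clamp.
Proof.
apply: contM; last exact: cont_cst; apply: contB.
  by apply: contD; [apply: cont_norm; exact: cont_id|exact: cont_cst].
by apply: cont_norm; apply: contB; [exact: cont_id|exact: cont_cst].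
Qed.

Lemma hat_cont : continuous hat.
Proof.
apply: contB; last exact: clamp_cont.
apply: (cont_comp _ clamp_cont); apply: contD; [exact: cont_id|exact: cont_cst].
Qed.

Lemma clampE (u : R) :
  [/\ u <= 0 -> clamp u = 0, 1 <= u -> clamp u = 1, 0 <= u <= 1 -> clamp u = u,
      0 <= clamp u <= 1 & forall v, u <= v -> clamp u <= clamp v].
Proof.
rewrite /clamp; split.
- by move=> u0; rewrite ler0_norm// ler0_norm; lra.
- by move=> u0; rewrite ger0_norm ?ger0_norm; lra.
- by move=> /andP[u0 u1]; rewrite ger0_norm ?ler0_norm; lra.
- by case: (ger0P u) => h; case: (ger0P (u - 1)) => h'; apply/andP; split; lra.
- move=> v uv; case: (ger0P u) => h; case: (ger0P (u - 1)) => h';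
  case: (ger0P v) => k; case: (ger0P (v - 1)) => k'; lra.
Qed.

Lemma hat_ge0 u : 0 <= hat u.
Proof. by rewrite /hat subr_ge0; case: (clampE u) => _ _ _ _; apply; lra. Qed.

Lemma hat_supp u : 1 <= `|u| -> hat u = 0.
Proof.
rewrite /hat ler_normr => /orP[h|h].
  have [_ h1 _ _ _] := clampE u; have [_ h2 _ _ _] := clampE (u + 1).
  by rewrite h1 ?h2 ?subrr//; lra.
have [h1 _ _ _ _] := clampE u; have [h2 _ _ _ _] := clampE (u + 1).
by rewrite h1 ?h2 ?subrr//; lra.
Qed.

Lemma hat_Cc : Cc hat.
Proof. by split; [exact: hat_cont|exists 1 => u /ltW/hat_supp]. Qed.

Lemma sum_hat (s : R) (K m : nat) :
  \sum_(i < m) hat (s - (i%:R - K%:R)) = clamp (s + K%:R + 1) - clamp (s + K%:R + 1 - m%:R).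
Proof.
elim: m => [|m IH]; first by rewrite big_ord0 subr0 subrr.
rewrite big_ord_recr/= IH /hat -natr1.
have -> : s - (m%:R - K%:R) + 1 = s + K%:R + 1 - m%:R by ring.
have -> : s - (m%:R - K%:R) = s + K%:R + 1 - (m%:R + 1) by ring.
by ring.
Qed.

(** Interpolation in the first variable: near [t], the slices of [g] at the nodes [d' * p i] are
    averaged with tents of radius d'. The support radius [rho] does not depend on [e], and this is
    what lets the error be integrated. *)
Lemma hat_approx n (g : 'rV[R]_n.+1 -> R) : Cc g -> exists2 rho : R, 0 < rho &
  forall e : R, 0 < e -> exists m (a : 'I_m -> R -> R) (b : 'I_m -> 'rV[R]_n -> R),
  [/\ forall i, Cc (a i), forall i, Cc (b i),
      forall t v, `|g (row_cons t v) - \sum_i a i t * b i v| <= e &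
      forall t v, rho < `|t| \/ rho < `|v| ->
        g (row_cons t v) = 0 /\ \sum_i a i t * b i v = 0].
Proof.
move=> cg; have [r r0 rg] := Cc_supp cg.
exists (r + 1); first by rewrite addr_gt0.
move=> e e0; have [d d0 dg] := Cc_unif_continuous cg e0.
pose d' := Num.min (d / 2) 1.
have d'0 : 0 < d' by rewrite lt_min divr_gt0// ltr01.
have d'd : d' < d by rewrite gt_min; apply/orP; left; lra.
have d'1 : d' <= 1 by rewrite ge_min lexx orbT.
(* Enough nodes to cover [-r, r]: they run from - K d' to K d', hence the number 2 K + 1 below. *)
pose K := (Num.truncn (r / d')).+1.
have rK : r / d' <= K%:R.
  by apply/ltW; have /truncn_itv/andP[] : 0 <= r / d' by rewrite divr_ge0// ltW.
pose m := (2 * K).+1.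
pose p (i : 'I_m) : R := i%:R - K%:R.
pose a (i : 'I_m) t := hat (d'^-1 * t - p i).
pose b (i : 'I_m) v := g (row_cons (d' * p i) v).
have d'U : d' != 0 by rewrite gt_eqF.
have aE i t : d' <= `|t - d' * p i| -> a i t = 0.
  move=> h; apply: hat_supp; rewrite (_ : _ - _ = (t - d' * p i) / d'); last by field.
  by rewrite normrM (@gtr0_norm _ d'^-1) ?invr_gt0// ler_pdivlMr// mul1r.
exists m, a, b; split.
- move=> i; apply: (@Cc_comp _ _ _ (fun t : R => d'^-1 * t - p i) hat d' (d' * `|p i|)).
  + move=> t; apply: continuousB; last exact: cst_continuous.
    by apply: continuousM; [exact: cst_continuous|exact: cvg_id].
  + move=> t; have {1}-> : t = d' * (d'^-1 * t - p i) + d' * p i by field.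
    by rewrite (le_trans (ler_normD _ _))// !normrM (gtr0_norm d'0).
  + exact: ltW.
  + exact: hat_Cc.
- by move=> i; exact: Cc_row_cons.
- move=> t v.
  have SE : \sum_i a i t = clamp (d'^-1 * t + K%:R + 1) - clamp (d'^-1 * t + K%:R + 1 - m%:R).
    by rewrite -sum_hat; apply: eq_bigr => i _.
  have -> : g (row_cons t v) = (\sum_i a i t) * g (row_cons t v).
    have [tr|tr] := leP r `|t|.
      by rewrite rg ?mulr0// (le_trans tr)//; case: (row_cons_norm_ge t v).
    have : `|d'^-1 * t| <= K%:R.
      rewrite normrM gtr0_norm ?invr_gt0// (le_trans _ rK)// mulrC ler_pM2r ?invr_gt0//.
      exact: ltW.
    rewrite ler_norml => /andP[h1 h2].
    have [_ k1 _ _ _] := clampE (d'^-1 * t + K%:R + 1).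
    have [k2 _ _ _ _] := clampE (d'^-1 * t + K%:R + 1 - m%:R).
    rewrite SE k1 ?k2 ?subr0 ?mul1r//; last by lra.
    by rewrite /m -natr1 natrM; lra.
  rewrite mulr_suml -sumrB.
  apply: (@le_trans _ _ (\sum_i a i t * e)).
    apply: (le_trans (ler_norm_sum _ _ _)); apply: ler_sum => i _.
    rewrite -mulrBr normrM ger0_norm ?hat_ge0//.
    have [h|h] := leP d' `|t - d' * p i|; first by rewrite aE// !mul0r.
    rewrite ler_wpM2l ?hat_ge0//; apply/ltW/dg; apply: (le_lt_trans (row_cons_dist _ _ _ _)).
    by rewrite subrr normr0 gt_max d0 andbT (lt_trans h).
  rewrite -mulr_suml ler_piMl ?(ltW e0)// SE.
  have [_ _ _ /andP[_ k1] _] := clampE (d'^-1 * t + K%:R + 1).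
  have [_ _ _ /andP[k2 _] _] := clampE (d'^-1 * t + K%:R + 1 - m%:R).
  by lra.
- move=> t v tv.
  have [h1 h2] := row_cons_norm_ge t v.
  split; first by rewrite rg//; case: tv => ?; lra.
  apply: big1 => i _; case: tv => tv; last first.
    rewrite /b rg ?mulr0//; have [_ h3] := row_cons_norm_ge (d' * p i) v; lra.
  have [h|h] := leP d' `|t - d' * p i|; first by rewrite aE// !mul0r.
  rewrite /b rg ?mulr0//; have [h3 _] := row_cons_norm_ge (d' * p i) v.
  have := ler_normD (t - d' * p i) (d' * p i); rewrite subrK => h4; lra.
Qed.

Lemma Cc_cons_l n (g : 'rV[R]_n.+1 -> R) v : Cc g -> Cc (fun t => g (row_cons t v)).
Proof.
move=> cg; apply: (@Cc_comp _ _ _ (fun t => row_cons t v) g 1 0) => //.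
  apply/continuous_distP => t e e0; exists e => // t' tt'.
  by apply: (le_lt_trans (row_cons_dist _ _ _ _)); rewrite subrr normr0 gt_max e0 andbT.
by move=> t; rewrite mul1r addr0; case: (row_cons_norm_ge t v).
Qed.

Lemma Cc_int_cons_l n (g : 'rV[R]_n.+1 -> R) : Cc g ->
  Cc (fun v => \int[mu]_t g (row_cons t v)).
Proof.
move=> cg; have [r r0 rg] := Cc_supp cg; split; last first.
  exists r => v rv; under eq_Rintegral => t _.
    rewrite rg; first over.
    by case: (row_cons_norm_ge t v) => _; apply: le_trans; exact: ltW.
  by rewrite Rintegral_cst//= mul0r.
apply/continuous_distP => v e e0.
have ec : 0 < e / 2 / (2 * r) by rewrite !divr_gt0// mulr_gt0.
have [d d0 dg] := Cc_unif_continuous cg ec; exists d => // v' vv'.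
rewrite -RintegralB//; try by apply: Cc_integrable; exact: Cc_cons_l.
apply: (@le_lt_trans _ _ (e / 2)); last by lra.
rewrite -[leRHS](@divfK _ (2 * r)) ?gt_eqF ?mulr_gt0//; apply: Rint_bound.
- by apply: CcB; exact: Cc_cons_l.
- exact: ltW.
- exact: ltW.
- move=> t; apply/ltW/dg; apply: (le_lt_trans (row_cons_dist _ _ _ _)).
  by rewrite subrr normr0 gt_max d0.
- move=> t /ltW rt; rewrite !rg ?subr0//.
    by apply: (le_trans rt); case: (row_cons_norm_ge t v').
  by apply: (le_trans rt); case: (row_cons_norm_ge t v).
Qed.

Lemma Rint_sum (I : Type) (s : seq I) (F : I -> R -> R) : (forall i, Cc (F i)) ->
  \int[mu]_t (\sum_(i <- s) F i t) = \sum_(i <- s) \int[mu]_t F i t.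
Proof.
move=> cF; elim: s => [|i s IH].
  under eq_Rintegral do rewrite big_nil.
  by rewrite big_nil Rintegral_cst//= mul0r.
under eq_Rintegral do rewrite big_cons.
rewrite big_cons RintegralD ?IH//; apply: Cc_integrable => //; exact: Cc_sum.
Qed.

(** For a finite sum of products both orders of integration give [S], and the approximation puts
    each side within [e] times the volume of a fixed cube of [S]. *)
Lemma int_rV_swap1 n (g : 'rV[R]_n.+1 -> R) : Cc g ->
  int_rV g = int_rV (fun v => \int[mu]_t g (row_cons t v)).
Proof.
move=> cg; have [rho rho0 H] := hat_approx cg.
suff HB (e : R) : 0 < e ->
    `|int_rV g - int_rV (fun v => \int[mu]_t g (row_cons t v))| <=
    e * (2 * ((2 * rho) ^+ n.+1)).
  apply/eqP; rewrite -subr_eq0 -normr_le0; apply/ler_addgt0Pl => e e0; rewrite addr0.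
  have c0 : 0 < 2 * (2 * rho) ^+ n.+1 by rewrite mulr_gt0// exprn_gt0// mulr_gt0.
  by rewrite -[leRHS](divfK (lt0r_neq0 c0)) HB// divr_gt0.
move=> e0; have [m [a [b [ca cb ab s]]]] := H e e0.
have r2 : 0 <= 2 * rho by rewrite mulr_ge0// ltW.
pose S := \sum_i (\int[mu]_t a i t) * int_rV (b i).
have I1 t : int_rV (fun v => g (row_cons t v) - \sum_i a i t * b i v) =
    int_rV (fun v => g (row_cons t v)) - \sum_i int_rV (b i) * a i t.
  rewrite int_rVB ?int_rV_sum; [|by move=> i; exact: CcZ|exact: Cc_row_cons|
    by apply: Cc_sum => i; exact: CcZ].
  by congr (_ - _); apply: eq_bigr => i _; rewrite int_rVZ// mulrC.
have I2 v : \int[mu]_t (g (row_cons t v) - \sum_i b i v * a i t) =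
    \int[mu]_t g (row_cons t v) - \sum_i (\int[mu]_t a i t) * b i v.
  rewrite RintegralB ?Rint_sum//; [|by move=> i; exact: CcZ|
    by apply: Cc_integrable; exact: Cc_cons_l|
    by apply: Cc_integrable; apply: Cc_sum => i; exact: CcZ].
  congr (_ - _); apply: eq_bigr => i _; rewrite RintegralZl//; first by rewrite mulrC.
  exact: Cc_integrable.
have B1 : `|int_rV g - S| <= e * (2 * rho) ^+ n.+1.
  have -> : int_rV g - S = \int[mu]_t (int_rV (fun v => g (row_cons t v)) -
      \sum_i int_rV (b i) * a i t).
    rewrite RintegralB ?Rint_sum//; [|by move=> i; exact: CcZ|
      by apply: Cc_integrable; exact: Cc_int_row_cons|
      by apply: Cc_integrable; apply: Cc_sum => i; exact: CcZ].
    congr (_ - _); apply: eq_bigr => i _; rewrite RintegralZl//; first by rewrite mulrC.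
    exact: Cc_integrable.
  rewrite exprSr mulrA; apply: Rint_bound.
  - by apply: CcB; [exact: Cc_int_row_cons|apply: Cc_sum => i; exact: CcZ].
  - by rewrite mulr_ge0// ?exprn_ge0// ltW.
  - exact: ltW.
  - move=> t; rewrite -I1; apply: int_rV_bound.
    + by apply: CcB; [exact: Cc_row_cons|apply: Cc_sum => i; exact: CcZ].
    + exact: ltW.
    + exact: ltW.
    + by move=> v; exact: ab.
    + by move=> v tv; have [-> ->] := s t v (or_intror tv); rewrite subrr.
  - move=> t rt; rewrite -I1 (_ : (fun v => _) = cst 0) ?int_rV0//.
    by apply/funext => v; have [-> ->] := s t v (or_introl rt); rewrite subrr.
have B2 : `|int_rV (fun v => \int[mu]_t g (row_cons t v)) - S| <= e * (2 * rho) ^+ n.+1.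
  have -> : int_rV (fun v => \int[mu]_t g (row_cons t v)) - S =
      int_rV (fun v => \int[mu]_t g (row_cons t v) - \sum_i (\int[mu]_t a i t) * b i v).
    rewrite int_rVB ?int_rV_sum; [|by move=> i; exact: CcZ|exact: Cc_int_cons_l|
      by apply: Cc_sum => i; exact: CcZ].
    by congr (_ - _); apply: eq_bigr => i _; rewrite int_rVZ.
  rewrite exprS mulrA; apply: int_rV_bound.
  - by apply: CcB; [exact: Cc_int_cons_l|apply: Cc_sum => i; exact: CcZ].
  - by rewrite mulr_ge0// ltW.
  - exact: ltW.
  - move=> v; rewrite -I2; apply: Rint_bound.
    + by apply: CcB; [exact: Cc_cons_l|apply: Cc_sum => i; exact: CcZ].
    + exact: ltW.
    + exact: ltW.
    + by move=> t; under eq_bigr do rewrite mulrC; exact: ab.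
    + move=> t tv; under eq_bigr do rewrite mulrC.
      by have [-> ->] := s t v (or_introl tv); rewrite subrr.
  - move=> v rv; rewrite -I2; under eq_Rintegral => t _.
      under eq_bigr do rewrite mulrC.
      have [-> ->] := s t v (or_intror rv); rewrite subrr; over.
    by rewrite Rintegral_cst//= mul0r.
apply: (le_trans (ler_distD S _ _)); rewrite (distrC S).
by rewrite mulrCA mulrDl mul1r lerD.
Qed.
End Fubini.

(** * Linear changes of variables *)

Section LinearChange.
Context {R : realType}.
Notation mu := (@lebesgue_measure R).

Lemma row_mx_norm m n (x : 'rV[R]_m) (y : 'rV[R]_n) :
  `|row_mx x y| = Num.max `|x| `|y|.
Proof.
apply/eqP; rewrite eq_le; apply/andP; split.
  by apply/row_mx_norm_leP; rewrite ?le_max ?lexx ?normr_ge0 ?orbT.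
by rewrite ge_max; apply/andP; exact: row_mx_norm_ge.
Qed.

Lemma row_cons_norm n (t : R) (v : 'rV[R]_n) :
  `|row_cons t v| = Num.max `|t| `|v|.
Proof. by rewrite -(const_mx_norm t); exact: (@row_mx_norm 1 n). Qed.

Lemma Cc_int_rV_l m n (g : 'rV[R]_(m + n) -> R) : Cc g ->
  Cc (fun y : 'rV_n => int_rV (fun x : 'rV_m => g (row_mx x y))).
Proof.
move=> cg; have [r r0 rg] := Cc_supp cg; split; last first.
  exists r => y ry; rewrite (_ : (fun x => _) = cst 0) ?int_rV0//.
  by apply/funext => x; rewrite rg//= row_mx_norm le_max (ltW ry) orbT.
apply/continuous_distP => y e e0.
pose c := (2 * r) ^+ m; have c0 : 0 < c by rewrite exprn_gt0// mulr_gt0.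
have ec : 0 < e / 2 / c by rewrite !divr_gt0.
have [d d0 dg] := Cc_unif_continuous cg ec; exists d => // y' yy'.
rewrite -int_rVB; [|exact: Cc_row_mxl|exact: Cc_row_mxl].
apply: (@le_lt_trans _ _ (e / 2)); last by lra.
rewrite -[leRHS](divfK (lt0r_neq0 c0)); apply: int_rV_bound.
- by apply: CcB; exact: Cc_row_mxl.
- exact: ltW.
- exact: ltW.
- move=> x; apply/ltW/dg; apply: (le_lt_trans (row_mx_dist _ _ _ _)).
  by rewrite subrr normr0 gt_max d0.
- by move=> x /ltW rx; rewrite !rg ?subr0// row_mx_norm le_max rx.
Qed.

(** Induction on the first block: its leading coordinate is moved across [y] by [int_rV_swap1]. *)
Lemma int_rV_swap m n (g : 'rV[R]_(m + n) -> R) : Cc g ->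
  int_rV (fun x : 'rV_m => int_rV (fun y : 'rV_n => g (row_mx x y))) =
  int_rV (fun y : 'rV_n => int_rV (fun x : 'rV_m => g (row_mx x y))).
Proof.
elim: m g => [|m IH] g cg; first by rewrite /=.
rewrite int_rVS.
(* [h] carries (x, (t, y)) to ((t, x), y). It permutes coordinates, so it preserves the norm, and
   with it continuity and compact support. *)
pose h (w : 'rV[R]_(m + n.+1)) : 'rV[R]_(m.+1 + n) :=
  row_mx (row_cons (rsubmx w 0 0) (lsubmx w)) (row_tail (rsubmx w)).
have hE x t y : h (row_mx x (row_cons t y)) = row_mx (row_cons t x) y.
  rewrite /h row_mxKl row_mxKr; congr (row_mx (row_cons _ _) _).
    by rewrite /row_cons mxE; case: splitP => // j _; rewrite mxE.
  by rewrite /row_tail; exact: (@row_mxKr _ 1 1 n).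
have hN w : `|h w| = `|w|.
  transitivity `|row_mx (lsubmx w) (row_cons (rsubmx w 0 0) (row_tail (rsubmx w)))|.
    by rewrite /h !row_mx_norm !row_cons_norm -maxA maxCA.
  by rewrite row_consK hsubmxK.
have hB w w' : h w - h w' = h (w - w').
  rewrite /h; apply/rowP => i; rewrite !mxE; case: splitP => j _; rewrite !mxE//.
  by case: splitP => k _; rewrite !mxE.
have cgh : Cc (g \o h).
  apply: (@Cc_comp _ _ _ h g 1 0) => //.
    apply/continuous_distP => w e e0; exists e => // w' ww'.
    by rewrite hB hN.
  by move=> w; rewrite hN mul1r addr0.
transitivity (\int[mu]_t int_rV (fun y : 'rV_n =>
    int_rV (fun x : 'rV_m => (g \o h) (row_mx x (row_cons t y))))).
  apply: eq_Rintegral => t _.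
  have := IH (fun z => g (row_cons t z)) (Cc_row_cons _ cg).
  under eq_fun do under eq_fun do rewrite row_cons_row_mx.
  by under [in X in _ = X -> _]eq_fun do under eq_fun do rewrite row_cons_row_mx -hE.
transitivity (int_rV (fun z : 'rV_n.+1 => int_rV (fun x : 'rV_m => (g \o h) (row_mx x z)))).
  by rewrite int_rVS.
rewrite int_rV_swap1; last exact: Cc_int_rV_l.
congr int_rV; apply/funext => y; rewrite int_rVS; apply: eq_Rintegral => t _.
by congr int_rV; apply/funext => x; rewrite /= hE.
Qed.

Lemma mulmx_norm_le m n (B : 'M[R]_(m, n)) : exists2 c, 0 <= c &
  forall x : 'rV_m, `|x *m B| <= c * `|x|.
Proof.
have c0 : 0 <= \sum_i \sum_j `|B i j| by do 2 (apply: sumr_ge0 => ? _).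
exists (\sum_i \sum_j `|B i j|) => // x.
apply/rV_norm_leP; first by rewrite mulr_ge0.
move=> j; rewrite mxE; apply: (le_trans (ler_norm_sum _ _ _)).
rewrite mulr_suml; apply: ler_sum => i _; rewrite normrM mulrC.
apply: ler_pM => //; last exact: rV_coord_le.
by rewrite (bigD1 j)//= lerDl; apply: sumr_ge0.
Qed.

Lemma mulmx_cont m n (B : 'M[R]_(m, n)) : continuous (fun x : 'rV[R]_m => x *m B).
Proof.
have [c c0 cB] := mulmx_norm_le B; apply/continuous_distP => x e e0.
have c1 : 0 < c + 1 by rewrite ltr_wpDl.
exists (e / (c + 1)); first by rewrite divr_gt0.
move=> y xy; rewrite -mulmxBl; apply: (le_lt_trans (cB _)).
apply: (@le_lt_trans _ _ ((c + 1) * `|x - y|)).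
  by rewrite ler_wpM2r// lerDl.
by rewrite -ltr_pdivlMl// mulrC.
Qed.

Lemma Cc_mulmx n (A : 'M[R]_n) (g : 'rV[R]_n -> R) : A \in unitmx -> Cc g ->
  Cc (fun x => g (x *m A)).
Proof.
move=> uA cg; have [c c0 cB] := mulmx_norm_le (invmx A).
apply: (@Cc_comp _ _ _ (fun x => x *m A) g c 0) => //; first exact: mulmx_cont.
by move=> x; rewrite addr0 (le_trans _ (cB _))// mulmxK.
Qed.

Lemma Rint_scale (f : R -> R) (a : R) : a != 0 -> Cc f ->
  \int[mu]_t f (t * a) * `|a| = \int[mu]_t f t.
Proof.
have H (b : R) (h : R -> R) : 0 < b -> Cc h -> \int[mu]_t h (t * b) * b = \int[mu]_t h t.
  move=> b0 ch; rewrite (Rint_affine 0 ch b0) RintegralZl//; last first.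
    apply: Cc_integrable; apply: (@Cc_comp _ _ _ (fun t => b * t + 0) h b^-1 0) => //.
    - by apply: contD; [apply: contM; [exact: cont_cst|exact: cont_id]|exact: cont_cst].
    - by move=> w; rewrite !addr0 normrM (gtr0_norm b0) mulKf ?gt_eqF.
    - by rewrite invr_ge0 ltW.
  by rewrite mulrC; congr (_ * _); apply: eq_Rintegral => t _; rewrite addr0 mulrC.
move=> aN0 cf; case: (ltrgt0P a) aN0 => // a0 _; first exact: H.
have cfN : Cc (fun t => f (- t)).
  apply: (@Cc_comp _ _ _ (fun t : R => - t) f 1 0) => //.
    by move=> x; apply: cvgN; exact: cvg_id.
  by move=> w; rewrite normrN mul1r addr0.
rewrite [RHS]Rint_opp// -(H (- a) _ _ cfN) ?oppr_gt0//; congr (_ * _).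
by apply: eq_Rintegral => t _; rewrite mulrN opprK.
Qed.

(** Invertibility is part of the predicate, which makes it stable under products, the form needed
    for Gaussian elimination. *)
Definition linear_change n (A : 'M[R]_n) := A \in unitmx /\ forall g, Cc g ->
  int_rV (fun x => g (x *m A)) * `|\det A| = int_rV g.

Lemma linear_change_mul n (A B : 'M[R]_n) :
  linear_change A -> linear_change B -> linear_change (A *m B).
Proof.
move=> [uA hA] [uB hB]; split; first by rewrite unitmx_mul uA.
move=> g cg; rewrite det_mulmx normrM mulrA -[RHS]hB// -[in RHS]hA//.
  by congr (int_rV _ * _ * _); apply/funext => x; rewrite mulmxA.
exact: Cc_mulmx.
Qed.

Lemma row_cons_mul_block n (t : R) (v : 'rV[R]_n) (a : R) (b : 'rV[R]_n) (c : 'cV[R]_n) (D : 'M[R]_n) :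
  row_cons t v *m (block_mx a%:M b c D : 'M[R]_(1 + n)) =
  row_cons (t * a + (v *m c) 0 0) (t *: b + v *m D).
Proof.
transitivity (row_mx ((const_mx t : 'rV_1) *m a%:M + v *m c) ((const_mx t : 'rV_1) *m b + v *m D)).
  exact: (@mul_row_block _ 1 1 n 1 n).
suff -> : (const_mx t : 'rV_1) *m a%:M + v *m c = const_mx (t * a + (v *m c) 0 0) :> 'rV_1.
  suff -> : (const_mx t : 'rV_1) *m b = t *: b by [].
  by apply/rowP => i; rewrite !mxE big_ord1 mxE.
by apply/rowP => i; rewrite [in LHS]mxE [RHS]mxE (ord1 i) mul_mx_scalar; congr (_ + _); rewrite !mxE mulrC.
Qed.

(** For fixed [t] the row [t *: b] only translates the remaining coordinates, and translation
    invariance removes it; then [a] scales the outer integral. *)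
Lemma linear_change_upper n (a : R) (b : 'rV[R]_n) (D : 'M[R]_n) : a != 0 ->
  linear_change D -> linear_change (block_mx a%:M b 0 D : 'M[R]_(1 + n)).
Proof.
move=> a0 [uD hD].
have dE : \det (block_mx a%:M b 0 D : 'M[R]_(1 + n)) = a * \det D.
  by rewrite det_ublock det_scalar1.
have u : (block_mx a%:M b 0 D : 'M[R]_(1 + n)) \in unitmx.
  by rewrite unitmxE dE unitrM unitfE a0 -unitmxE.
split => // g cg; rewrite dE normrM mulrA (int_rVS g).
rewrite -(Rint_scale a0 (Cc_int_row_cons cg)) mulrAC; congr (_ * _).
rewrite (@int_rVS _ n) -RintegralZr//; last first.
  exact: Cc_integrable (@Cc_int_row_cons _ n _ (Cc_mulmx u cg)).
apply: eq_Rintegral => t _; rewrite -(hD (fun v => g (row_cons (t * a) v))); last exact: Cc_row_cons.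
congr (_ * _).
rewrite -[RHS](int_rV_shift (t *: b *m invmx D)); last first.
  exact: (Cc_mulmx uD (Cc_row_cons (t * a) cg)).
congr int_rV; apply/funext => v; congr g.
by rewrite row_cons_mul_block mulmx0 mxE addr0 mulmxDl mulmxKV// addrC.
Qed.

Lemma linear_change1 n : linear_change (1%:M : 'M[R]_n).
Proof.
split; first exact: unitmx1.
by move=> g cg; rewrite det1 normr1 mulr1; congr int_rV; apply/funext => x; rewrite mulmx1.
Qed.

(** Here the shear moves the first coordinate by an amount depending on the others, so it becomes a
    translation only after the order of integration is exchanged. *)
Lemma linear_change_lower n (c : 'cV[R]_n) :
  linear_change (block_mx 1%:M 0 c 1%:M : 'M[R]_(1 + n)).
Proof.
have dE : \det (block_mx 1%:M 0 c 1%:M : 'M[R]_(1 + n)) = 1.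
  by rewrite det_lblock !det1 mulr1.
have u : (block_mx 1%:M 0 c 1%:M : 'M[R]_(1 + n)) \in unitmx by rewrite unitmxE dE unitr1.
split=> // g cg; rewrite dE normr1 mulr1 (int_rV_swap1 cg).
rewrite (@int_rV_swap1 _ n _ (Cc_mulmx u cg)).
congr int_rV; apply/funext => v.
rewrite [RHS](@Rint_affine _ _ 1 ((v *m c) 0 0))//; last exact: Cc_cons_l.
apply: eq_Rintegral => t _; rewrite mul1r; congr g.
by rewrite row_cons_mul_block mulr1 mul1r scaler0 add0r mulmx1.
Qed.

(** Gaussian elimination. A nonzero corner entry gives a factorization into a lower shear and a
    block triangular matrix with the Schur complement; a zero corner is first repaired by adding
    another row to the top one. *)
Lemma linear_changeP n (A : 'M[R]_n) : A \in unitmx -> linear_change A.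
Proof.
elim: n A => [|n IH] A uA.
  split=> // g cg; rewrite det_mx00 normr1 mulr1 /=; congr g; by apply/rowP => -[].
have step (B : 'M[R]_(1 + n)) : B \in unitmx -> B 0 0 != 0 -> linear_change B.
  move=> uB b0; pose a := B 0 0; pose b := ursubmx B; pose c := dlsubmx B; pose D := drsubmx B.
  have BE : B = block_mx 1%:M 0 (a^-1 *: c) 1%:M *m block_mx a%:M b 0 (D - a^-1 *: (c *m b)).
    rewrite mulmx_block !mul1mx !mul0mx !addr0 -!scalemxAl [X in block_mx _ _ _ X]addrC subrK.
    rewrite -[LHS]submxK; congr block_mx; last by rewrite mul_mx_scalar scalerA mulVf// scale1r.
    by apply/matrixP => i j; rewrite (ord1 i) (ord1 j) !mxE mulr1n; congr (B _ _); exact/val_inj.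
  rewrite BE; apply: linear_change_mul; first exact: linear_change_lower.
  apply: linear_change_upper => //; apply: IH.
  move: uB; rewrite BE unitmx_mul => /andP[_].
  by rewrite !unitmxE det_ublock unitrM => /andP[].
have [A00|] := eqVneq (A 0 0) 0; last exact: step.
(* Otherwise the first column would vanish, and with it the determinant. *)
have [i ci] : exists i, (dlsubmx (A : 'M[R]_(1 + n))) i 0 != 0.
  apply: contrapT => /forallNP ci.
  have : \det A = 0.
    rewrite -det_tr; apply/eqP/det0P; exists (delta_mx 0 0).
      by apply/eqP => /rowP/(_ 0); rewrite !mxE /= => /eqP; rewrite oner_eq0.
    rewrite -rowE; apply/rowP => j; rewrite !mxE; apply/eqP; apply/negPn/negP.
    have [->|[k ->]] : j = 0 \/ exists k, j = rshift 1 k.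
      case: (@splitP 1 n j) => k jk; [left|right; exists k]; apply/val_inj => //=.
      by rewrite jk (ord1 k).
      by rewrite A00 eqxx.
    move: (ci k); rewrite !mxE (_ : lshift n 0 = 0)//; exact/val_inj.
  by move: uA; rewrite unitmxE => /[swap] ->; rewrite unitr0.
pose E (s : R) : 'M[R]_(1 + n) := block_mx 1%:M (s *: delta_mx 0 i) 0 1%:M.
have EE : E (-1) *m E 1 = 1%:M.
  rewrite mulmx_block !mul1mx !mul0mx !mulmx1 mulmx0 !addr0 add0r scale1r scaleN1r subrr.
  by rewrite -scalar_mx_block.
have lE : linear_change (E (-1)).
  by apply: linear_change_upper; [exact: oner_neq0|exact: linear_change1].
have -> : A = E (-1) *m (E 1 *m (A : 'M[R]_(1 + n))) by rewrite mulmxA EE mul1mx.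
apply: linear_change_mul => //; apply: step.
  by rewrite unitmx_mul uA andbT; have /mulmx1_unit[] := EE.
rewrite -(@submxK _ 1 n 1 n A) mulmx_block scale1r !mul1mx.
rewrite (_ : (0 : 'I_(1 + n)) = lshift n 0); last exact/val_inj.
rewrite block_mxEul mxE -rowE [row _ _ _ _]mxE mxE.
suff -> : usubmx (A : 'M[R]_(1 + n)) 0 (lshift n 0) = 0 by rewrite add0r.
by rewrite mxE -A00; congr (A _ _); exact/val_inj.
Qed.

Lemma int_rV_mulmx n (A : 'M[R]_n) (g : 'rV[R]_n -> R) : A \in unitmx -> Cc g ->
  int_rV (fun x => g (x *m A)) * `|\det A| = int_rV g.
Proof. by move=> /linear_changeP[_]; apply. Qed.
End LinearChange.

(** * Mean value inequality and change of variables *)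

Section MeanValue.
Context {R : realType}.

Lemma MVT_rV n (f : 'rV[R]_n -> R) (x y : 'rV[R]_n) :
  (forall t : R, 0 <= t <= 1 -> differentiable f (x + t *: (y - x))) ->
  exists2 t : R, 0 <= t <= 1 &
    f y - f x = \sum_i (y - x) 0 i * partial i f (x + t *: (y - x)).
Proof.
move=> df; pose v := y - x; pose h (t : R) := x + t *: v.
have dg (t : R) : 0 <= t <= 1 -> is_derive t 1 (f \o h) ('D_v f (h t)).
  move=> t01; have dft : derivable f (h t) v by exact: diff_derivable (df t t01).
  have E : (fun s : R => s^-1 *: (((f \o h) \o shift t) (s *: 1) - (f \o h) t)) =
           (fun s => s^-1 *: ((f \o shift (h t)) (s *: v) - f (h t))).
    apply/funext => s /=; congr (_ *: (f _ - _)).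
    by rewrite /h [s *: 1]mulr1 scalerDl addrCA.
  by split; rewrite /derivable /derive E.
have [| |c c01 E] := @MVT_segment R (f \o h) (fun t => 'D_v f (h t)) 0 1 ler01.
- by move=> t; rewrite in_itv/= => /andP[t0 t1]; apply: dg; rewrite !ltW.
- apply: continuous_in_subspaceT => t; rewrite inE/= in_itv/= => t01.
  have [dt _] := dg t t01; apply: differentiable_continuous; exact/derivable1_diffP.
move: E; rewrite /= /h scale1r scale0r addr0 subr0 mulr1 /v [x + _]addrC subrK => E.
exists c; first by move: c01; rewrite in_itv.
by rewrite E derive_partial//; apply: df; move: c01; rewrite in_itv.
Qed.

Lemma MVT_rV_le n (f : 'rV[R]_n -> R) (a x y : 'rV[R]_n) (r C : R) :
  (forall z, `|z - a| <= r -> differentiable f z) ->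
  (forall z i, `|z - a| <= r -> `|partial i f z| <= C) ->
  `|x - a| <= r -> `|y - a| <= r -> `|f y - f x| <= n%:R * C * `|y - x|.
Proof.
move=> df pC xr yr.
have seg (t : R) : 0 <= t <= 1 -> `|x + t *: (y - x) - a| <= r.
  move=> /andP[t0 t1]; have -> : x + t *: (y - x) - a = (1 - t) *: (x - a) + t *: (y - a).
    by apply/rowP => k; rewrite !mxE; ring.
  rewrite (le_trans (ler_normD _ _))// !normrZ (ger0_norm t0) ger0_norm ?subr_ge0//.
  apply: (@le_trans _ _ ((1 - t) * r + t * r)); last by rewrite -mulrDl subrK mul1r.
  by rewrite lerD// ler_wpM2l// subr_ge0.
have [t t01 ->] := MVT_rV (fun t t01 => df _ (seg t t01)).
apply: (le_trans (ler_norm_sum _ _ _)).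
apply: (@le_trans _ _ (\sum_(i < n) `|y - x| * C)).
  apply: ler_sum => i _; rewrite normrM; apply: ler_pM => //; first exact: rV_coord_le.
  by apply: pC; exact: seg.
by rewrite sumr_const card_ord -[leLHS]mulr_natl [`|_| * C]mulrC mulrA.
Qed.

Lemma partial_coord n m (T : 'rV[R]_n -> 'rV[R]_m) x i j : differentiable T x ->
  partial i (fun z => T z 0 j) x = partial i T x 0 j.
Proof. by move=> dT; rewrite /partial derive_mx ?mxE//; exact: diff_derivable. Qed.

Lemma jacobian_partial n m (T : 'rV[R]_n -> 'rV[R]_m) x i j : differentiable T x ->
  'J T x i j = partial i T x 0 j.
Proof. by move=> dT; rewrite /partial deriveEjacobian// -rowE [RHS]mxE. Qed.

(** The mean value theorem is applied to each coordinate of [T] on the segment from [x] to [x'];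
    continuity of the partial derivatives at [x0] bounds the deviation from the Jacobian there. *)
Lemma strict_diff n m (A : set 'rV[R]_n) (T : 'rV[R]_n -> 'rV[R]_m) x0 (e : R) :
  open A -> Ck_on A 1 T -> A x0 -> 0 < e ->
  exists2 r : R, 0 < r & (forall x, `|x - x0| < r -> A x) /\
    forall x x', `|x - x0| < r -> `|x' - x0| < r ->
      `|T x' - T x - (x' - x) *m 'J T x0| <= e * `|x' - x|.
Proof.
move=> oA [dT cT] Ax0 e0.
(* Division by n + 1 rather than n also covers dimension 0, and the sum over n coordinates still
   stays below [e]. *)
pose e1 := e / n.+1%:R; have e10 : 0 < e1 by rewrite divr_gt0.
have : \forall x \near x0, A x /\ forall i, `|partial i T x0 - partial i T x| < e1.
  apply: filterI; first exact: open_nbhs_nbhs.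
  apply: (@filter_forall _ _ (fun i (x : 'rV[R]_n) => `|partial i T x0 - partial i T x| < e1) (nbhs x0) (nbhs_filter x0)) => i.
  by have /cvgrPdist_lt/(_ e1 e10) := cT i x0 Ax0.
move=> /nbhs_ballP[r /= r0 rP].
have {}rP x : `|x - x0| < r -> A x /\ forall i, `|partial i T x0 - partial i T x| < e1.
  by move=> xr; apply: rP; rewrite -ball_normE/= distrC.
exists r => //; split=> [x /rP[]//|x x' xr x'r].
apply/rV_norm_leP; first by rewrite mulr_ge0// ltW.
move=> j.
have seg (t : R) : 0 <= t <= 1 -> `|x + t *: (x' - x) - x0| < r.
  move=> /andP[t0 t1].
  have -> : x + t *: (x' - x) - x0 = (1 - t) *: (x - x0) + t *: (x' - x0).
    by apply/rowP => k; rewrite !mxE; ring.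
  rewrite (le_lt_trans (ler_normD _ _))// !normrZ (ger0_norm t0) ger0_norm ?subr_ge0//.
  have [->|tN0] := eqVneq t 0; first by rewrite mul0r addr0 subr0 mul1r.
  have tp : 0 < t by rewrite lt_neqAle eq_sym tN0.
  apply: (@lt_le_trans _ _ ((1 - t) * r + t * r)); last by rewrite -mulrDl subrK mul1r.
  by rewrite ler_ltD// ?ltr_pM2l// ler_wpM2l ?subr_ge0// ltW.
have [|t t01 E] := @MVT_rV n (fun z => T z 0 j) x x'.
  move=> t t01; apply: (@differentiable_comp _ _ _ _ T (fun v : 'rV[R]_m => v 0 j)).
    by apply: dT; have [] := rP _ (seg t t01).
  exact: differentiable_coord.
have [Az zP] := rP _ (seg t t01); set z := x + t *: (x' - x) in E Az zP.
have -> : (T x' - T x - (x' - x) *m 'J T x0) 0 j =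
    \sum_i (x' - x) 0 i * (partial i T z 0 j - partial i T x0 0 j).
  transitivity ((T x' 0 j - T x 0 j) - ((x' - x) *m 'J T x0) 0 j); first by rewrite !mxE.
  rewrite E [X in _ - X]mxE -sumrB; apply: eq_bigr => i _.
  by rewrite mulrBr partial_coord ?jacobian_partial//; exact: dT.
apply: (le_trans (ler_norm_sum _ _ _)).
apply: (@le_trans _ _ (\sum_(i < n) `|x' - x| * e1)).
  apply: ler_sum => i _; rewrite normrM; apply: ler_pM => //; first exact: rV_coord_le.
  rewrite distrC; apply/ltW; apply: le_lt_trans (zP i).
  by have := rV_coord_le (partial i T x0 - partial i T z) j; rewrite !mxE.
rewrite sumr_const card_ord -mulrnAr mulrC ler_wpM2r//.
apply: (@le_trans _ _ (e1 *+ n.+1)); first by rewrite ler_pMn2l.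
by rewrite /e1 -mulr_natr divfK// pnatr_eq0.
Qed.
End MeanValue.

(** * Change of variables under a diffeomorphism *)

Section ChangeOfVariables.
Context {R : realType}.

Definition zero_ext (V : Type) (A : set V) (f : V -> R) (x : V) : R :=
  if x \in A then f x else 0.

Lemma zero_ext_in (V : Type) (A : set V) f x : A x -> zero_ext A f x = f x.
Proof. by move=> Ax; rewrite /zero_ext mem_set. Qed.

Lemma zero_ext_out (V : Type) (A : set V) f x : ~ A x -> zero_ext A f x = 0.
Proof. by move=> Ax; rewrite /zero_ext memNset. Qed.

Lemma zero_ext_continuous (V : topologicalType) (A K : set V) f :
  open A -> closed K -> (forall x, A x -> {for x, continuous f}) ->
  (forall x, A x -> ~ K x -> f x = 0) -> K `<=` A -> continuous (zero_ext A f).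
Proof.
move=> oA cK cf f0 KA x; have [Ax|nAx] := pselect (A x).
  have E : \forall y \near x, f y = zero_ext A f y.
    by apply: (open_near oA Ax) => y Ay; rewrite zero_ext_in.
  rewrite /continuous_at zero_ext_in//; apply: cvg_trans (cf x Ax).
  exact: near_eq_cvg E.
have nKx : (~` K) x by move=> /KA.
have E : \forall y \near x, 0 = zero_ext A f y.
  apply: (open_near (closed_openC cK) nKx) => y nKy.
  have [Ay|nAy] := pselect (A y); last by rewrite zero_ext_out.
  by rewrite zero_ext_in// f0.
rewrite /continuous_at zero_ext_out//.
apply: cvg_trans (near_eq_cvg E) _; exact: cvg_cst.
Qed.

Lemma contM_at (V : topologicalType) (f g : V -> R) x : {for x, continuous f} ->
  {for x, continuous g} -> {for x, continuous (fun y => f y * g y)}.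
Proof. by move=> cf cg; apply: cvgM; [exact: cf|exact: cg]. Qed.

Lemma contB_at (V : topologicalType) (W : normedModType R) (f g : V -> W) x :
  {for x, continuous f} -> {for x, continuous g} ->
  {for x, continuous (fun y => f y - g y)}.
Proof. by move=> cf cg; apply: cvgB; [exact: cf|exact: cg]. Qed.

Lemma cont_comp_at (U V W : topologicalType) (f : U -> V) (g : V -> W) x :
  {for x, continuous f} -> {for (f x), continuous g} ->
  {for x, continuous (fun y => g (f y))}.
Proof. by move=> cf cg; exact: (@continuous_comp _ _ _ f g). Qed.

Lemma compact_rV_closed n (K : set 'rV[R]_n) : compact K -> closed K.
Proof. by apply: compact_closed; exact: norm_hausdorff. Qed.

Lemma compact_rV_bounded n (K : set 'rV[R]_n) : compact K ->
  exists2 r : R, 0 < r & forall x, K x -> `|x| <= r.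
Proof.
move=> /compact_bounded[M [_ KM]]; exists (`|M| + 1); first by rewrite ltr_wpDl.
by move=> x Kx; apply: KM => //; rewrite (le_lt_trans (ler_norm M))// ltrDl.
Qed.

Lemma Cc_zero_ext n (A K : set 'rV[R]_n) f : open A -> compact K -> K `<=` A ->
  (forall x, A x -> {for x, continuous f}) ->
  (forall x, A x -> ~ K x -> f x = 0) -> Cc (zero_ext A f).
Proof.
move=> oA cK KA cf f0; split.
  by apply: (zero_ext_continuous oA (compact_rV_closed cK) cf f0 KA).
have [r r0 rK] := compact_rV_bounded cK; exists r => x rx.
have [Ax|nAx] := pselect (A x); last by rewrite zero_ext_out.
by rewrite zero_ext_in// f0// => /rK; rewrite leNgt rx.
Qed.

Lemma continuous_at_dist (V W : normedModType R) (f : V -> W) x :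
  {for x, continuous f} -> forall e : R, 0 < e ->
  exists2 d : R, 0 < d & forall y, `|x - y| < d -> `|f x - f y| < e.
Proof.
move=> cf e e0; have /cvgrPdist_lt/(_ e e0)/nbhs_ballP[d /= d0 dP] := cf.
by exists d => // y xy; apply: dP; rewrite -ball_normE.
Qed.

Lemma sum_continuous_at (V : topologicalType) (I : Type) (s : seq I) (G : I -> V -> R) x :
  (forall i, {for x, continuous (G i)}) ->
  {for x, continuous (fun v => \sum_(i <- s) G i v)}.
Proof.
move=> cG; elim: s => [|i s IH].
  rewrite /prop_for /continuous_at; under eq_fun do rewrite big_nil.
  by rewrite big_nil; exact: cst_continuous.
rewrite /prop_for /continuous_at; under eq_fun do rewrite big_cons.
by rewrite big_cons; apply: cvgD; [exact: cG|exact: IH].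
Qed.

Lemma prod_continuous_at (V : topologicalType) (I : Type) (s : seq I) (G : I -> V -> R) x :
  (forall i, {for x, continuous (G i)}) ->
  {for x, continuous (fun v => \prod_(i <- s) G i v)}.
Proof.
move=> cG; elim: s => [|i s IH].
  rewrite /prop_for /continuous_at; under eq_fun do rewrite big_nil.
  by rewrite big_nil; exact: cst_continuous.
rewrite /prop_for /continuous_at; under eq_fun do rewrite big_cons.
by rewrite big_cons; apply: cvgM; [exact: cG|exact: IH].
Qed.

Lemma det_continuous n (V : topologicalType) (M : V -> 'M[R]_n) x :
  (forall i j, {for x, continuous (fun v => M v i j)}) ->
  {for x, continuous (fun v => \det (M v))}.
Proof.
move=> cM; apply: sum_continuous_at => s.
by apply: cvgM; [exact: cvg_cst|apply: prod_continuous_at => i; exact: cM].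
Qed.

Lemma near_eq_continuous (V W : topologicalType) (f g : V -> W) x :
  (\forall y \near x, f y = g y) -> {for x, continuous f} -> {for x, continuous g}.
Proof.
move=> fg cf; rewrite /prop_for /continuous_at -(nbhs_singleton fg).
exact: cvg_trans (near_eq_cvg fg) cf.
Qed.

Lemma det_jacobian_continuous n (A : set 'rV[R]_n) (T : 'rV[R]_n -> 'rV[R]_n) x :
  open A -> Ck_on A 1 T -> A x -> {for x, continuous (fun z => \det ('J T z))}.
Proof.
move=> oA [dT cT] Ax; apply: det_continuous => i j.
apply: (@near_eq_continuous _ _ (fun z => partial i T z 0 j)).
  by apply: (open_near oA Ax) => y Ay; rewrite jacobian_partial//; exact: dT.
apply: (@continuous_comp _ _ _ (partial i T) (fun v : 'rV[R]_n => v 0 j)).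
  exact: cT.
exact: coord_continuous.
Qed.

(** The mollifier. It is only continuous, since mollified functions are never differentiated. *)
Lemma bump_exists n : exists phi : 'rV[R]_n -> R,
  [/\ Cc phi, forall z, 1 <= `|z| -> phi z = 0 & int_rV phi = 1].
Proof.
pose f (z : 'rV[R]_n) := hat `|z|.
have cf : Cc f.
  split; last by exists 1 => z /ltW z1; rewrite /f hat_supp// normr_id.
  by apply: (cont_comp _ (@hat_cont R)); apply: cont_norm; exact: cont_id.
have If : 0 < int_rV f.
  apply: (int_rV_pos cf _).2 => [z|]; first exact: hat_ge0.
  exists 0; rewrite /f normr0 /hat add0r.
  have [_ -> // _ _ _] := clampE (1 : R); by have [-> // _ _ _ _] := clampE (0 : R); rewrite subr0 ltr01.
exists (fun z => (int_rV f)^-1 * f z); split; first exact: CcZ.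
  by move=> z z1; rewrite /f hat_supp ?mulr0// normr_id.
by rewrite int_rVZ// mulVf// gt_eqF.
Qed.

Lemma Cc_scale n (g : 'rV[R]_n -> R) (a : R) : a != 0 -> Cc g -> Cc (fun x => g (a *: x)).
Proof.
move=> a0 cg; have u : (a%:M : 'M[R]_n) \in unitmx.
  by rewrite unitmxE det_scalar unitrX// unitfE.
by have := Cc_mulmx u cg; under eq_fun do rewrite mul_mx_scalar.
Qed.

Lemma int_rV_scale n (g : 'rV[R]_n -> R) (a : R) : 0 < a -> Cc g ->
  int_rV (fun x => g (a *: x)) * a ^+ n = int_rV g.
Proof.
move=> a0 cg.
have u : (a%:M : 'M[R]_n) \in unitmx by rewrite unitmxE det_scalar unitrX// unitfE gt_eqF.
rewrite -(int_rV_mulmx u cg) det_scalar ger0_norm ?exprn_ge0 ?ltW//; congr (_ * _).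
by congr int_rV; apply/funext => x; rewrite mul_mx_scalar.
Qed.

Lemma prod_close (a b p q M N d : R) : 0 <= M -> 0 <= N -> `|a| <= M -> `|p| <= N ->
  `|b - a| < d / (2 * (N + 1)) -> `|q - p| < d / (2 * (M + 1)) ->
  `|a * q - b * p| <= d.
Proof.
move=> M0 N0 aM pN ab pq.
have -> : a * q - b * p = (a - b) * p + a * (q - p) by ring.
rewrite (le_trans (ler_normD _ _))// !normrM [leRHS](splitr d) lerD//.
  apply: (@le_trans _ _ (d / (2 * (N + 1)) * (N + 1))).
    by rewrite ler_pM// ?(distrC a) ?(ltW ab)// (le_trans pN)// lerDl.
  by rewrite invfM mulrA divfK// gt_eqF// ltr_wpDl.
apply: (@le_trans _ _ ((M + 1) * (d / (2 * (M + 1))))).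
  by rewrite ler_pM// ?(ltW pq)// (le_trans aM)// lerDl.
by rewrite mulrC invfM mulrA divfK// gt_eqF// ltr_wpDl.
Qed.

Section Diffeo.
Variables (n : nat) (A B : set 'rV[R]_n) (T S : 'rV[R]_n -> 'rV[R]_n).
Variables (F : 'rV[R]_n -> R) (K : set 'rV[R]_n).
Hypotheses (oA : open A) (oB : open B).
Hypotheses (SBA : forall y, B y -> A (S y)).
Hypotheses (TK : forall x, A x -> S (T x) = x) (SK : forall y, B y -> T (S y) = y).
Hypotheses (C1T : Ck_on A 1 T) (cS : forall y, B y -> {for y, continuous S}).
Hypothesis JT : forall x, A x -> 'J T x \in unitmx.
Hypotheses (cF : Cc F) (cK : compact K) (KB : K `<=` B)
  (FK : forall y, ~ K y -> F y = 0).

Let L : set 'rV[R]_n := S @` K.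
Let D (x : 'rV[R]_n) := `|\det ('J T x)|.
Let H := zero_ext A (fun x => F (T x) * D x).

Let cT x : A x -> {for x, continuous T}.
Proof. by move=> Ax; apply: differentiable_continuous; case: C1T => + _; apply. Qed.

Let LA : L `<=` A.
Proof. by move=> _ [y Ky <-]; exact/SBA/KB. Qed.

Let cL : compact L.
Proof.
apply: continuous_compact => //; apply: continuous_in_subspaceT => y.
by rewrite inE => /KB; exact: cS.
Qed.

Let FT0 x : A x -> ~ L x -> F (T x) = 0.
Proof. by move=> Ax nLx; apply: FK => KTx; apply: nLx; exists (T x) => //; exact: TK. Qed.

Let cH : Cc H.
Proof.
apply: (Cc_zero_ext oA cL LA) => [x Ax|x Ax nLx]; last by rewrite FT0// mul0r.
apply: (@continuousM _ _ (F \o T) D).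
  by apply: continuous_comp; [exact: cT|case: cF => + _; apply].
apply: continuous_comp; last exact: norm_continuous.
exact: (det_jacobian_continuous oA C1T Ax).
Qed.

Let H0 x : ~ L x -> H x = 0.
Proof.
move=> nLx; have [Ax|nAx] := pselect (A x); last exact: zero_ext_out.
by rewrite /H zero_ext_in// FT0// mul0r.
Qed.

(** Fubini is applied to this kernel on the product space, which requires joint continuity. [T] is
    only controlled on [A], but the factor [H] vanishes outside the compact subset [L] of [A]. *)
Let Cc_kernel (phi : 'rV[R]_n -> R) : Cc phi ->
  Cc (fun w : 'rV[R]_(n + n) => H (lsubmx w) * phi (rsubmx w - T (lsubmx w))).
Proof.
move=> cp.
have cl : continuous (fun w : 'rV[R]_(n + n) => lsubmx w).
  apply/continuous_distP => w e e0; exists e => // w' ww'; apply: le_lt_trans ww'.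
  by rewrite -[w - w']hsubmxK row_mx_norm !linearB le_max lexx.
have cr : continuous (fun w : 'rV[R]_(n + n) => rsubmx w).
  apply/continuous_distP => w e e0; exists e => // w' ww'; apply: le_lt_trans ww'.
  by rewrite -[w - w']hsubmxK row_mx_norm !linearB le_max lexx orbT.
split.
  pose AA := [set w : 'rV[R]_(n + n) | A (lsubmx w)].
  rewrite (_ : (fun w => _) = zero_ext AA
      (fun w => H (lsubmx w) * phi (rsubmx w - T (lsubmx w)))); last first.
    apply/funext => w; have [Aw|nAw] := pselect (AA w); first by rewrite zero_ext_in.
    by rewrite zero_ext_out// H0 ?mul0r// => /LA.
  apply: (@zero_ext_continuous _ AA [set w | L (lsubmx w)]).
  - by apply: open_comp => // w _; exact: cl.
  - by apply: closed_comp; [move=> w _; exact: cl|exact: compact_rV_closed].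
  - move=> w Aw; apply: (@contM_at _ (fun w : 'rV[R]_(n + n) => H (lsubmx w))).
      by apply: (cont_comp_at (cl w)); case: cH => + _; apply.
    apply: (@cont_comp_at _ _ _ (fun w : 'rV[R]_(n + n) => rsubmx w - T (lsubmx w)));
      last by case: cp => + _; apply.
    apply: (@contB_at _ _ (fun w : 'rV[R]_(n + n) => rsubmx w)); first exact: cr.
    by apply: (cont_comp_at (cl w)); exact: cT.
  - by move=> w _ nLw; rewrite H0 ?mul0r.
  - by move=> w /= /LA.
have [r r0 rL] := compact_rV_bounded cL.
have cTL : compact (T @` L).
  apply: continuous_compact => //; apply: continuous_in_subspaceT => y.
  by rewrite inE => /LA; exact: cT.
have [s s0 sT] := compact_rV_bounded cTL.
have [p p0 pp] := Cc_supp cp.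
exists (Num.max r (p + s)) => w; rewrite -[w in `|w|]hsubmxK row_mx_norm => wr.
have [Lw|nLw] := pselect (L (lsubmx w)); last by rewrite H0 ?mul0r.
have h1 := rL _ Lw; have h2 : `|T (lsubmx w)| <= s by apply: sT; exists (lsubmx w).
have h3 : p + s < `|rsubmx w|.
  rewrite ltNge; apply/negP => h; move: wr.
  by rewrite ltNge ge_max !le_max h1 h orbT.
rewrite pp ?mulr0//.
have := ler_normD (rsubmx w - T (lsubmx w)) (T (lsubmx w)); rewrite subrK => h4; lra.
Qed.

Let phi := sval (cid (bump_exists n)).
Let phi_Cc : Cc phi. Proof. by have [] := svalP (cid (bump_exists n)). Qed.
Let phi_supp z : 1 <= `|z| -> phi z = 0.
Proof. by have [_ h _] := svalP (cid (bump_exists n)); exact: h. Qed.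
Let phi_int : int_rV phi = 1. Proof. by have [] := svalP (cid (bump_exists n)). Qed.
Let phie (e : R) z := e^-1 ^+ n * phi (e^-1 *: z).

Let phie_Cc e : 0 < e -> Cc (phie e).
Proof.
by move=> e0; apply: CcZ; apply: Cc_scale => //; rewrite invr_neq0// gt_eqF.
Qed.

Let phie_int e a : 0 < e -> int_rV (fun y => phie e (y - a)) = 1.
Proof.
move=> e0; rewrite (int_rV_shift (- a) (phie_Cc e0)).
rewrite int_rVZ; last by apply: Cc_scale => //; rewrite invr_neq0// gt_eqF.
by rewrite mulrC int_rV_scale// invr_gt0.
Qed.

(** The density H dx pushed forward by [T] and mollified at scale [e]. Its integral is that of [H]
    for every [e], and it tends uniformly to [F]; comparing the two gives the formula. *)
Let E (e : R) y := int_rV (fun x => H x * phie e (y - T x)).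

Let E_Cc e : 0 < e -> Cc (E e).
Proof.
move=> e0; have := Cc_int_rV_l (Cc_kernel (phie_Cc e0)).
by under eq_fun do under eq_fun do rewrite row_mxKl row_mxKr.
Qed.

Let E_int e : 0 < e -> int_rV (E e) = int_rV H.
Proof.
move=> e0; have := int_rV_swap (Cc_kernel (phie_Cc e0)).
under eq_fun do under eq_fun do rewrite row_mxKl row_mxKr.
under [in X in _ = X -> _]eq_fun do under eq_fun do rewrite row_mxKl row_mxKr.
move=> <-; congr int_rV; apply/funext => x.
rewrite int_rVZ; last by apply: Cc_shift; exact: phie_Cc.
by rewrite phie_int// mulr1.
Qed.

(** The integrand after the substitution x = S y + e z, whose Jacobian cancels the normalization of
    the mollifier. At this scale [T] is close to its linear part. *)
Let k (e : R) (y z : 'rV[R]_n) := H (S y + e *: z) * phi (e^-1 *: (y - T (S y + e *: z))).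

Let k_Cc e y : 0 < e -> Cc (k e y).
Proof.
move=> e0.
have cg : Cc (fun x => H x * phie e (y - T x)).
  have := Cc_row_mxl y (Cc_kernel (phie_Cc e0)).
  by under eq_fun do rewrite row_mxKl row_mxKr.
have := CcZ (e ^+ n) (Cc_scale (lt0r_neq0 e0) (Cc_shift (S y) cg)).
rewrite [X in Cc X -> _](_ : _ = k e y)//.
apply/funext => z; rewrite /phie /k addrC mulrCA (mulrA (e ^+ n)) -exprMn mulfV ?gt_eqF//.
by rewrite expr1n mul1r.
Qed.

Let E_rescale e y : 0 < e -> B y -> E e y = int_rV (k e y).
Proof.
move=> e0 By; rewrite /E.
have cg : Cc (fun x => H x * phie e (y - T x)).
  have := Cc_row_mxl y (Cc_kernel (phie_Cc e0)).
  by under eq_fun do rewrite row_mxKl row_mxKr.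
rewrite -(int_rV_shift (S y) cg) -(int_rV_scale e0 (Cc_shift (S y) cg)).
have -> : (fun x => H (e *: x + S y) * phie e (y - T (e *: x + S y))) =
    fun x => e^-1 ^+ n * k e y x.
  by apply/funext => x; rewrite /phie /k addrC mulrCA.
rewrite int_rVZ; last exact: k_Cc.
by rewrite mulrAC -exprMn mulVf ?gt_eqF// expr1n mul1r.
Qed.

(* Where the kernel is centred at [y0] in [K], strict differentiability of [T]
   replaces it by the linear kernel, whose integral is known. *)
Let E_cvg_in y0 (eta : R) : K y0 -> 0 < eta -> exists2 d : R, 0 < d &
  forall y e, `|y - y0| < d -> 0 < e -> e < d -> `|E e y - F y| <= eta.
Proof.
move=> Ky0 eta0; have By0 := KB Ky0; pose x0 := S y0; have Ax0 : A x0 := SBA By0.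
pose J0 := 'J T x0; have uJ : J0 \in unitmx := JT Ax0.
have [c c0 cP] := mulmx_norm_le (invmx J0).
have cJ (v : 'rV[R]_n) : `|v| <= c * `|v *m J0| by rewrite (le_trans _ (cP _))// mulmxK.
(* Outside the radius [C] both the rescaled kernel and its linear model vanish: [c] bounds the
   inverse of the Jacobian, and the factor 2 is the loss in [expand]. *)
pose C := 2 * c + 1; have C0 : 0 < C by rewrite /C; lra.
have [M M0 HM] := Cc_bounded cH.
have [N N0 phiN] := Cc_bounded phi_Cc.
pose V := (2 * C) ^+ n; have V0 : 0 < V by rewrite exprn_gt0// mulr_gt0.
(* Chosen for [prod_close]: the product then errs by at most eta / 2 / V, which integrates to eta /
   2 over a cube of volume [V]. The other half is spent on F y0 - F y. *)
pose e2 := eta / 2 / V / (2 * (N + 1)) : R.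
pose e3 := eta / 2 / V / (2 * (M + 1)).
have e20 : 0 < e2 by rewrite !divr_gt0// mulr_gt0// ltr_wpDl.
have e30 : 0 < e3 by rewrite !divr_gt0// mulr_gt0// ltr_wpDl.
have [d3 d30 phiU] := Cc_unif_continuous phi_Cc e30.
have [r2 r20 H2] : exists2 r : R, 0 < r & forall x, `|x0 - x| < r -> `|H x0 - H x| < e2.
  by apply: continuous_at_dist => //; case: cH => + _; apply.
(* With this tolerance the nonlinear error, after applying the inverse Jacobian, is at most half of
   |x' - x| and can be absorbed. *)
have e10 : 0 < (2 * (c + 1))^-1 by rewrite invr_gt0 mulr_gt0// ltr_wpDl.
have [r1 r10 [A1 T1]] := strict_diff oA C1T Ax0 e10.
have e40 : 0 < d3 / (2 * C) by rewrite divr_gt0// mulr_gt0.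
have [r3 r30 [_ T3]] := strict_diff oA C1T Ax0 e40.
pose r := Num.min r1 (Num.min r2 r3).
have r0 : 0 < r by rewrite !lt_min r10 r20.
have expand x x' : `|x - x0| < r -> `|x' - x0| < r -> `|x' - x| <= 2 * c * `|T x' - T x|.
  rewrite !lt_min => /andP[xr _] /andP[x'r _].
  have h1 := T1 x x' xr x'r; have h2 := cJ (x' - x).
  have h3 : `|(x' - x) *m J0| <= `|T x' - T x| + (2 * (c + 1))^-1 * `|x' - x|.
    rewrite -[X in `|X| <= _](subKr (T x' - T x)) (le_trans (ler_normB _ _))// lerD2l.
    exact: h1.
  have h4 : c * ((2 * (c + 1))^-1 * `|x' - x|) <= `|x' - x| / 2.
    rewrite mulrA [leRHS]mulrC ler_wpM2r// invfM mulrCA ler_piMr// ler_pdivrMr ?ltr_wpDl//.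
    by rewrite mul1r lerDl.
  have h5 := ler_wpM2l c0 h3; rewrite mulrDr in h5; lra.
have [r4 r40 S4] : exists2 r' : R, 0 < r' & forall y, `|y0 - y| < r' -> `|x0 - S y| < r / 2.
  by apply: (continuous_at_dist (cS By0)); rewrite divr_gt0.
have [r5 r50 B5] : exists2 r' : R, 0 < r' & forall y, `|y - y0| < r' -> B y.
  have /nbhs_ballP[r' /= r'0 r'P] := open_nbhs_nbhs (conj oB By0).
  by exists r' => // y yr; apply: r'P; rewrite -ball_normE/= distrC.
have [r6 r60 F6] : exists2 r' : R, 0 < r' & forall y, `|y0 - y| < r' -> `|F y0 - F y| < eta / 2.
  by apply: continuous_at_dist; [case: cF => + _; apply|rewrite divr_gt0].
pose q := Num.min r4 (Num.min r5 r6).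
have q0 : 0 < q by rewrite !lt_min r40 r50 r60.
exists (Num.min (q / 2) (r / 2 / C)); first by rewrite lt_min !divr_gt0.
move=> y e; rewrite !lt_min => /andP[yq _] e0 /andP[eq eC].
have yr4 : `|y0 - y| < r4 by rewrite distrC; apply: (@lt_le_trans _ _ q); [lra|rewrite ge_min lexx].
have By : B y by apply: B5; apply: (@lt_le_trans _ _ q); [lra|rewrite !ge_min lexx orbT].
have F6y : `|F y0 - F y| < eta / 2.
  by apply: F6; rewrite distrC; apply: (@lt_le_trans _ _ q); [lra|rewrite !ge_min lexx !orbT].
have Syr : `|S y - x0| < r / 2 by rewrite distrC; exact: S4.
rewrite (E_rescale e0 By).
(* By the linear change of variables; the determinant in [H] cancels the one produced by the
   integral. *)
have FE : F y0 = int_rV (fun z => H x0 * phi (z *m (- J0))).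
  have uN : - J0 \in unitmx by rewrite -scaleN1r unitmxZ ?unitrN1.
  rewrite int_rVZ; last exact: Cc_mulmx.
  have /(canRL (mulfK _)) -> : int_rV (fun z => phi (z *m - J0)) * `|\det (- J0)| = 1.
    by rewrite int_rV_mulmx.
  - rewrite /H zero_ext_in// /D SK// -scaleN1r detZ normrM normrX normrN1 expr1n !mul1r mulfK//.
    by rewrite normr_eq0 -unitfE -unitmxE.
  - by rewrite normr_eq0 -unitfE -unitmxE.
have -> : int_rV (k e y) - F y = (int_rV (k e y) - F y0) + (F y0 - F y).
  by rewrite addrA subrK.
rewrite (le_trans (ler_normD _ _))// [leRHS](splitr eta) lerD ?(ltW F6y)//.
have farz z : C < `|z| -> k e y z = 0 /\ H x0 * phi (z *m - J0) = 0.
  move=> Cz; split; last first.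
    rewrite phi_supp ?mulr0// mulmxN normrN leNgt; apply/negP => h.
    have h1 := cJ z; have h2 := ler_wpM2l c0 (ltW h); rewrite /C in Cz; lra.
  rewrite /k; set x := S y + e *: z.
  have [Lx|nLx] := pselect (L x); last by rewrite H0 ?mul0r.
  rewrite phi_supp ?mulr0// normrZ gtr0_norm ?invr_gt0// ler_pdivlMl// mulr1.
  rewrite leNgt; apply/negP => yTx.
  have KTx : K (T x) by case: Lx => y' Ky' <-; rewrite SK//; exact: KB.
  have xS : S (T x) = x by apply: TK; exact: LA.
  have xr : `|x - x0| < r.
    have : `|x0 - S (T x)| < r / 2.
      apply: S4; apply: (@lt_le_trans _ _ q); last by rewrite ge_min lexx.
      rewrite (le_lt_trans (ler_distD y _ _))// (distrC y0); lra.
    by rewrite xS distrC => h; lra.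
  have Syr' : `|S y - x0| < r by lra.
  have xSy : x - S y = e *: z by rewrite /x addrC addKr.
  have := expand _ _ Syr' xr; rewrite SK// xSy normrZ gtr0_norm// (distrC (T _)) => h.
  have h1 : 2 * c * `|y - T x| <= 2 * c * e by rewrite ler_wpM2l ?mulr_ge0// ltW.
  have : e * `|z| <= e * (2 * c) by rewrite (mulrC e (2 * c)) (le_trans h).
  by rewrite ler_pM2l// => h2; rewrite /C in Cz; lra.
rewrite FE -int_rVB; last 2 first.
- exact: k_Cc.
- by apply: CcZ; apply: Cc_mulmx => //; rewrite -scaleN1r unitmxZ ?unitrN1.
rewrite -[leRHS](divfK (lt0r_neq0 V0)); apply: int_rV_bound.
- apply: CcB; first exact: k_Cc.
  by apply: CcZ; apply: Cc_mulmx => //; rewrite -scaleN1r unitmxZ ?unitrN1.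
- by rewrite ltW// !divr_gt0.
- exact: ltW.
- move=> z; have [zC|/farz[-> ->]] := leP `|z| C; last by rewrite subrr normr0 ltW// !divr_gt0.
  pose x := S y + e *: z.
  have ez : `|e *: z| < r / 2.
    rewrite normrZ (gtr0_norm e0) (@le_lt_trans _ _ (e * C))// ?ler_wpM2l// ?(ltW e0)//.
    by rewrite -ltr_pdivlMr.
  have xr : `|x - x0| < r.
    rewrite /x addrAC (le_lt_trans (ler_normD _ _))//; lra.
  have Syr' : `|S y - x0| < r by lra.
  have Hx : `|H x0 - H x| < e2.
    by apply: H2; rewrite distrC (lt_le_trans xr)// !ge_min lexx orbT.
  have Tx : `|T x - T (S y) - (x - S y) *m J0| <= d3 / (2 * C) * `|x - S y|.
    by apply: T3; [apply: (lt_le_trans Syr')|apply: (lt_le_trans xr)]; rewrite !ge_min lexx !orbT.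
  have Px : `|phi (e^-1 *: (y - T x)) - phi (z *m - J0)| < e3.
    apply: phiU; rewrite SK// in Tx.
    have xS : x - S y = e *: z by rewrite /x addrC addKr.
    have -> : e^-1 *: (y - T x) - z *m - J0 = - (e^-1 *: (T x - y - (x - S y) *m J0)).
      rewrite xS -scalemxAl [in RHS]scalerBr scalerA mulVf ?gt_eqF// scale1r.
      by rewrite mulmxN opprK opprB -[y - T x]opprB scalerN addrC.
    rewrite normrN normrZ gtr0_norm ?invr_gt0// ltr_pdivrMl//.
    apply: (le_lt_trans Tx); rewrite xS normrZ (gtr0_norm e0) mulrCA ltr_pM2l//.
    apply: (@le_lt_trans _ _ (d3 / (2 * C) * C)); first by rewrite ler_wpM2l// ltW.
    rewrite [X in X < _](_ : _ = d3 / 2); first by lra.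
    by field; rewrite gt_eqF.
  exact: (prod_close M0 N0 (HM x) (phiN (z *m - J0)) Hx Px).
- by move=> z /farz[-> ->]; rewrite subrr.
Qed.

(** The vanishing is exact: [T] maps the support of [H] into [K], which is further from [y] than the
    mollifier reaches. *)
Let E_cvg_out y0 : ~ K y0 -> exists2 d : R, 0 < d &
  forall y e, `|y - y0| < d -> 0 < e -> e < d -> E e y = 0 /\ F y = 0.
Proof.
move=> nK; have oK : open (~` K) by apply: closed_openC; exact: compact_rV_closed.
have /nbhs_ballP[r /= r0 rP] := open_nbhs_nbhs (conj oK (nK : (~` K) y0)).
exists (r / 2) => [|y e yr e0 er]; first by rewrite divr_gt0.
have yrP y' : `|y' - y0| < r -> ~ K y' by move=> yr'; apply: rP; rewrite -ball_normE/= distrC.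
split; last by apply: FK; apply: yrP; lra.
rewrite /E (_ : (fun x => _) = cst 0) ?int_rV0//; apply/funext => x.
have [Lx|nLx] := pselect (L x); last by rewrite H0 ?mul0r.
rewrite /phie phi_supp ?mulr0// normrZ gtr0_norm ?invr_gt0// ler_pdivlMl// mulr1.
rewrite leNgt; apply/negP => yTx; apply: (@yrP (T x)).
  rewrite (le_lt_trans (ler_distD y _ _))// (distrC (T x)); lra.
by case: Lx => y' Ky' <-; rewrite SK//; exact: KB.
Qed.

Let rho : R := sval (cid2 (compact_rV_bounded cK)) + 1.
Let rhoP y e : rho < `|y| -> 0 < e -> e < 1 -> E e y = 0 /\ F y = 0.
Proof.
rewrite /rho; case: cid2 => r r0 rK /= ry e0 e1.
split; last by apply: FK => /rK; lra.
rewrite /E (_ : (fun x => _) = cst 0) ?int_rV0//; apply/funext => x.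
have [Lx|nLx] := pselect (L x); last by rewrite H0 ?mul0r.
rewrite /phie phi_supp ?mulr0// normrZ gtr0_norm ?invr_gt0// ler_pdivlMl// mulr1.
have Tr : `|T x| <= r by case: Lx => y' Ky' <-; rewrite SK//; [exact: rK|exact: KB].
by have := ler_normD (y - T x) (T x); rewrite subrK => h; lra.
Qed.

Let E_unif (eta : R) : 0 < eta -> exists2 d : R, 0 < d &
  forall e, 0 < e -> e < d -> forall y, `|E e y - F y| <= eta.
Proof.
move=> eta0.
pose P (e : R) (y : 'rV[R]_n) := 0 < e -> `|E e y - F y| <= eta.
have /compact_near_coveringP/(_ R (0 : R)^'+ P) := @closed_ball_rV_compact R n 0 rho.
case=> [y0 _|d /= d0 dP].
  have [d d0 dP] : exists2 d : R, 0 < d & forall y e, `|y - y0| < d -> 0 < e -> e < d ->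
      `|E e y - F y| <= eta.
    have [Ky|nKy] := pselect (K y0); first exact: E_cvg_in.
    have [d d0 dP] := E_cvg_out nKy; exists d => // y e yd e0 ed.
    by have [-> ->] := dP y e yd e0 ed; rewrite subrr normr0 ltW.
  exists (ball y0 d, [set e | e < d]).
    split=> /=; first exact: nbhsx_ballx.
    by apply: nbhs_right_lt.
  move=> [y e] /= [yd ed] e0; apply: dP => //.
  by move: yd; rewrite -ball_normE/= distrC.
exists (Num.min d 1) => [|e e0]; first by rewrite lt_min d0 ltr01.
rewrite lt_min => /andP[ed e1] y; have [yr|ry] := leP `|y| rho.
  by apply: (dP e) => //=; rewrite ?subr0// sub0r normrN gtr0_norm.
by have [-> ->] := rhoP ry e0 e1; rewrite subrr normr0 ltW.
Qed.

Lemma change_of_variables : int_rV H = int_rV F.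
Proof.
have rho0 : 0 < rho by rewrite /rho; case: cid2 => r r0 _ /=; rewrite addr_gt0.
pose V := (2 * rho) ^+ n; have V0 : 0 < V by rewrite exprn_gt0// mulr_gt0.
apply/eqP; rewrite -subr_eq0 -normr_le0; apply/ler_addgt0Pl => eta eta0; rewrite addr0.
have [d d0 dP] := E_unif (divr_gt0 eta0 V0).
pose e := Num.min (d / 2) (1 / 2).
have e0 : 0 < e by rewrite lt_min !divr_gt0.
have ed : e < d by rewrite gt_min; apply/orP; left; lra.
have e1 : e < 1 by rewrite gt_min; apply/orP; right; lra.
rewrite -(E_int e0) -int_rVB//; last exact: E_Cc.
rewrite -[leRHS](divfK (lt0r_neq0 V0)); apply: int_rV_bound.
- by apply: CcB => //; exact: E_Cc.
- by rewrite ltW// divr_gt0.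
- exact: ltW.
- exact: dP.
- by move=> y ry; have [-> ->] := rhoP ry e0 e1; rewrite subrr.
Qed.
End Diffeo.
End ChangeOfVariables.

(** * Calculus of smooth functions *)

Section SmoothCalculus.
Context {R : realType} {n : nat}.
Implicit Types (D : set 'rV[R]_n).

Lemma Ck_on_sub (W : normedModType R) D D' k (f : 'rV[R]_n -> W) :
  D' `<=` D -> Ck_on D k f -> Ck_on D' k f.
Proof.
move=> DD; elim: k f => [|k IH] f; first by move=> cf x /DD; exact: cf.
by move=> [df pf]; split=> [x /DD|i]; [exact: df|exact/IH/pf].
Qed.

Lemma Ck_on_local (W : normedModType R) D k (f : 'rV[R]_n -> W) :
  (forall x, D x -> exists2 U : set 'rV[R]_n, U x & Ck_on U k f) -> Ck_on D k f.
Proof.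
elim: k f => [|k IH] f H; first by move=> x Dx; have [U Ux cf] := H x Dx; exact: cf.
split=> [x Dx|i]; first by have [U Ux [df _]] := H x Dx; exact: df.
by apply: IH => x Dx; have [U Ux [_ pf]] := H x Dx; exists U => //; exact: pf.
Qed.

Lemma Ck_on_comp m D (E : set 'rV[R]_m) k (T : 'rV[R]_n -> 'rV[R]_m) (f : 'rV[R]_m -> R) :
  open D -> (forall x, D x -> E (T x)) ->
  Ck_on D k T -> Ck_on E k f -> Ck_on D k (f \o T).
Proof.
move=> oD DE; elim: k f => [|k IH] f cT cf.
  by move=> x Dx; apply: continuous_comp; [exact: cT|apply: cf; exact: DE].
have [dT pT] := cT; have [df pf] := cf.
have E' x i : D x -> partial i (f \o T) x =
    \sum_j partial j f (T x) * partial i T x 0 j.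
  move=> Dx; have dfT := df _ (DE _ Dx); have dTx := dT _ Dx.
  rewrite {1}/partial deriveE; last exact: differentiable_comp.
  rewrite diff_comp//= -!deriveE// derive_partial//.
  by apply: eq_bigr => j _; rewrite mulrC.
split=> [x Dx|i].
  by apply: differentiable_comp; [exact: dT|apply: df; exact: DE].
apply: (@eq_Ck_on _ _ _ _ _ (fun x => \sum_j partial j f (T x) * partial i T x 0 j)) => //.
  by move=> x Dx; rewrite E'.
apply: Ck_on_sum => // j; apply: Ck_onM => //.
  exact: IH (Ck_on_lt cT) (pf j).
exact: Ck_on_coord (pT i).
Qed.

(** A function of one variable given together with its derivatives: [psi k] is the k-th derivative
    of the initial member on [I]. Statements on compositions can then be proved by induction on the
    order for all members at once. *)
Definition smooth_seq (I : set R) (psi : nat -> R -> R) :=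
  forall k x, I x -> is_derive x (1 : R) (psi k) (psi k.+1 x).

Lemma partial_comp1 (psi : R -> R) a (f : 'rV[R]_n -> R) x i :
  differentiable f x -> is_derive (f x) (1 : R) psi a ->
  differentiable (psi \o f) x /\ partial i (psi \o f) x = a * partial i f x.
Proof.
move=> df [dpsi psiE]; have dp : differentiable psi (f x) by exact/derivable1_diffP.
have dc : differentiable (psi \o f) x by exact: differentiable_comp.
split=> //; rewrite /partial !deriveE// diff_comp//=.
set u := 'd f x _; rewrite -[u in LHS]mulr1 -[u * 1]/(u *: (1 : R)).
by rewrite linearZ/= -[X in u *: X]deriveE// psiE [RHS]mulrC.
Qed.

Lemma Ck_on_comp1 (I : set R) psi D (f : 'rV[R]_n -> R) k j :
  open D -> smooth_seq I psi -> (forall x, D x -> I (f x)) ->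
  Ck_on D k f -> Ck_on D k (psi j \o f).
Proof.
move=> oD sI DI; elim: k j => [|k IH] j cf.
  move=> x Dx; apply: continuous_comp; first exact: cf.
  have [dp _] := sI j _ (DI _ Dx).
  by apply: differentiable_continuous; exact/derivable1_diffP.
have [df pf] := cf; split=> [x Dx|i].
  have [dp _] := sI j _ (DI _ Dx); apply: differentiable_comp; first exact: df.
  exact/derivable1_diffP.
apply: (@eq_Ck_on _ _ _ _ _ (fun x => psi j.+1 (f x) * partial i f x)) => //.
  by move=> x Dx; have [_ ->] := partial_comp1 i (df x Dx) (sI j _ (DI _ Dx)).
exact: (@Ck_onM _ _ _ _ (psi j.+1 \o f) _ oD (IH j.+1 (Ck_on_lt cf)) (pf i)).
Qed.

Lemma Ck_on_prod D k (I : Type) (s : seq I) (f : I -> 'rV[R]_n -> R) : open D ->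
  (forall i, Ck_on D k (f i)) -> Ck_on D k (fun x => \prod_(i <- s) f i x).
Proof.
move=> oD fk; elim: s => [|i s IH].
  by under eq_fun do rewrite big_nil; exact: Ck_on_cst.
by under eq_fun do rewrite big_cons; exact: Ck_onM.
Qed.

Lemma Ck_on_sum_seq D k (I : Type) (s : seq I) (f : I -> 'rV[R]_n -> R) : open D ->
  (forall i, Ck_on D k (f i)) -> Ck_on D k (fun x => \sum_(i <- s) f i x).
Proof.
move=> oD fk; elim: s => [|i s IH].
  by under eq_fun do rewrite big_nil; exact: Ck_on_cst.
by under eq_fun do rewrite big_cons; exact: Ck_onD.
Qed.

Lemma Ck_on_det D k m (M : 'rV[R]_n -> 'M[R]_m) : open D ->
  (forall i j, Ck_on D k (fun x => M x i j)) -> Ck_on D k (fun x => \det (M x)).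
Proof.
move=> oD cM; apply: Ck_on_sum_seq => // s; apply: (@Ck_onM _ _ _ _ (cst _)) => //.
  exact: Ck_on_cst.
exact: Ck_on_prod.
Qed.

Lemma Ck_on_det_jacobian D k (T : 'rV[R]_n -> 'rV[R]_n) : open D ->
  Ck_on D k.+1 T -> Ck_on D k (fun x => \det ('J T x)).
Proof.
move=> oD [dT pT]; apply: Ck_on_det => // i j.
apply: (@eq_Ck_on _ _ _ _ _ (fun x => partial i T x 0 j)) => //.
  by move=> x Dx; rewrite jacobian_partial//; exact: dT.
exact: Ck_on_coord (pT i).
Qed.

Lemma row_jacobian (T : 'rV[R]_n -> 'rV[R]_n) x i : differentiable T x ->
  row i ('J T x) = 'D_(delta_mx 0 i) T x.
Proof. by move=> dT; rewrite rowE deriveEjacobian. Qed.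

Lemma jacobian_comp (T S : 'rV[R]_n -> 'rV[R]_n) x :
  differentiable T x -> differentiable S (T x) ->
  'J (S \o T) x = 'J T x *m 'J S (T x).
Proof.
move=> dT dS; have dST := differentiable_comp dT dS.
apply/row_matrixP => i; rewrite row_mul.
transitivity ('D_(delta_mx 0 i) (S \o T) x); first exact: row_jacobian.
transitivity ('D_(delta_mx 0 i) T x *m 'J S (T x)); last first.
  by congr (_ *m _); apply/esym; exact: row_jacobian.
rewrite -(deriveEjacobian _ dS) (deriveE _ dST) (deriveE _ dT) (deriveE _ dS).
exact: (congr1 (fun k => k (delta_mx 0 i)) (diff_comp dT dS)).
Qed.

Lemma jacobian_near (T S : 'rV[R]_n -> 'rV[R]_n) x :
  (\forall y \near x, T y = S y) -> differentiable T x -> 'J T x = 'J S x.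
Proof.
move=> TS dT; have dS := differentiable_near TS dT.
apply/row_matrixP => i.
transitivity ('D_(delta_mx 0 i) T x); first exact: row_jacobian.
transitivity ('D_(delta_mx 0 i) S x); last by apply/esym; exact: row_jacobian.
exact: near_eq_derive.
Qed.

Lemma jacobian_id (x : 'rV[R]_n) : 'J (@id 'rV[R]_n) x = 1%:M.
Proof. by apply/row_matrixP => i; rewrite row_jacobian// derive_id row1. Qed.
End SmoothCalculus.

(** * The flat function e^(-1/x) and its derivatives *)

Section FlatFunction.
Context {R : realType}.

Lemma smooth_seq_expR : smooth_seq setT (fun _ => @expR R).
Proof. by move=> k x _; exact: is_derive_expR. Qed.

Lemma smooth_seq_inv : smooth_seq [set x : R | x != 0]
  (fun k x => (-1) ^+ k * k`!%:R * x^-1 ^+ k.+1).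
Proof.
move=> k x /= x0.
have H : is_derive x (1 : R) (fun y : R => y^-1) (- x ^- 2).
  by apply: is_derive_eq; [exact: is_deriveV|rewrite [_ *: _]mulr1].
have := is_deriveM (is_derive_cst ((-1) ^+ k * k`!%:R : R) x 1) (is_deriveX k.+1 H).
rewrite [X in is_derive _ _ X _ -> _](_ : _ = fun y => (-1) ^+ k * k`!%:R * y^-1 ^+ k.+1); last first.
  by apply/funext => y; rewrite mulrfctE exprfctE.
move=> H2; apply: (is_derive_eq H2).
rewrite scaler0 addr0 /= factS natrM.
rewrite -[LHS]/((-1) ^+ k * k`!%:R * (k.+1%:R * x^-1 ^+ k * - x ^- 2)) -exprVn.
by move: x^-1 => u; rewrite !exprS; ring.
Qed.

(** Termwise, y^i / i! is at most e^y. *)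
Lemma poly_expR_bound (p : {poly R}) : exists2 C, 0 <= C &
  forall y : R, 0 <= y -> `|p.[y]| * expR (- y) <= C.
Proof.
exists (\sum_(i < size p) `|p`_i| * i`!%:R); first by apply: sumr_ge0 => i _; rewrite mulr_ge0.
move=> y y0; rewrite expRN ler_pdivrMr ?expR_gt0// mulr_suml horner_coef.
apply: (le_trans (ler_norm_sum _ _ _)); apply: ler_sum => i _.
rewrite normrM -mulrA ler_wpM2l// normrX (ger0_norm y0).
case: (i : nat) => [|j]; first by rewrite expr0 mul1r -expR0 ler_expR.
have := expR_ge1Dxn j y0; rewrite -[X in 1 + X]mulr1 => h.
rewrite mulrC -ler_pdivrMr ?ltr0n ?fact_gt0//; apply: le_trans h.
by rewrite mulr1 lerDr.
Qed.

(** The functions p(1/x) e^(-1/x), extended by 0, form a family closed under differentiation: the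
    derivative replaces p by X^2 (p - p'). For p = 1 this is the standard flat function. *)
Definition flat (p : {poly R}) (x : R) : R :=
  if 0 < x then p.[x^-1] * expR (- x^-1) else 0.

Lemma flat_le0 p x : x <= 0 -> flat p x = 0.
Proof. by rewrite /flat leNgt => /negbTE ->. Qed.

Lemma is_derive_quadratic (f : R -> R) C : (forall h, `|f h| <= C * h ^+ 2) ->
  is_derive 0 (1 : R) f 0.
Proof.
move=> fC; have f0 : f 0 = 0.
  by apply/eqP; rewrite -normr_le0; have := fC 0; rewrite expr0n mulr0.
have H : (fun h : R => h^-1 *: ((f \o shift 0) (h *: 1) - f 0)) @ 0^' --> (0 : R).
  apply/cvgrPdist_le => e e0.
  have C1 : 0 < `|C| + 1 by rewrite ltr_wpDl.
  apply/nbhs_ballP; exists (e / (`|C| + 1)) => /=; first by rewrite divr_gt0.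
  move=> h; rewrite /ball/= sub0r normrN => he hN0.
  rewrite sub0r normrN f0 subr0 addr0 [h *: 1]mulr1 normrZ normfV ler_pdivrMl ?normr_gt0//.
  apply: (le_trans (fC h)).
  apply: (@le_trans _ _ ((`|C| + 1) * h ^+ 2)).
    by rewrite ler_wpM2r ?sqr_ge0// (le_trans (ler_norm C))// lerDl.
  rewrite -[h ^+ 2]ger0_norm ?sqr_ge0// normrX expr2 mulrCA ler_wpM2l//.
  by rewrite mulrC -ler_pdivlMr// ltW.
by split; [apply/cvg_ex; exists 0|exact: cvg_lim].
Qed.

Lemma flat_derive p x : is_derive x (1 : R) (flat p) (flat ('X^2 * (p - p^`())) x).
Proof.
case: (ltrgt0P x) => [x0|x0|->].
- have xU : x != 0 by rewrite gt_eqF.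
  have H : is_derive x (1 : R) (fun y : R => y^-1) (- x ^- 2).
    by apply: is_derive_eq; [exact: is_deriveV|rewrite [_ *: _]mulr1].
  have Hp := is_derive1_comp (is_derive_poly p x^-1) H.
  have HN : is_derive x (1 : R) (fun y : R => - y^-1) (- (- x ^- 2)) := is_deriveN H.
  have He := @is_derive1_comp _ _ (fun y : R => - y^-1) _ _ _ (is_derive_expR (- x^-1)) HN.
  have := is_deriveM Hp He.
  rewrite [X in is_derive _ _ X _ -> _](_ : _ = fun y => p.[y^-1] * expR (- y^-1)) => [HF|]; last first.
    by apply/funext => y; rewrite mulrfctE.
  have E : \forall y \near x, p.[y^-1] * expR (- y^-1) = flat p y.
    by apply: filterS (lt_nbhsr x0) => y y0; rewrite /flat y0.
  apply: (near_eq_is_derive E).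
  apply: (is_derive_eq HF); rewrite /flat x0 hornerM hornerXn hornerD hornerN /=.
  rewrite -[LHS]/(p.[x^-1] * (expR (- x^-1) * - (- x ^- 2)) + expR (- x^-1) * (p^`().[x^-1] * - x ^- 2)).
  by rewrite -exprVn; ring.
- rewrite (flat_le0 _ (ltW x0)).
  have E : \forall y \near x, cst 0 y = flat p y.
    by apply: filterS (lt_nbhsl x0) => y y0; rewrite /= flat_le0// ltW.
  by apply: (near_eq_is_derive E); exact: is_derive_cst.
(* At 0 the bound for p X^2 reads |flat p h| <= C h^2, which forces the derivative 0. *)
- rewrite flat_le0//; have [C C0 CP] := poly_expR_bound (p * 'X^2).
  apply: (@is_derive_quadratic _ C) => h; have [h0|h0] := leP h 0.
    by rewrite flat_le0// normr0 mulr_ge0// sqr_ge0.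
  rewrite /flat h0 normrM (ger0_norm (expR_ge0 _)).
  have hi : 0 <= h^-1 by rewrite invr_ge0 ltW.
  have := CP _ hi; rewrite hornerM hornerXn normrM (ger0_norm (exprn_ge0 _ hi)).
  rewrite mulrAC -ler_pdivlMr ?exprn_gt0 ?invr_gt0// => /le_trans; apply.
  by rewrite -exprVn invrK.
Qed.

Lemma smooth_seq_flat p : exists psi, psi 0%N = flat p /\ smooth_seq setT psi.
Proof.
exists (fun k => flat (iter k (fun p => 'X^2 * (p - p^`())) p)); split=> // k x _.
exact: flat_derive.
Qed.
End FlatFunction.

(** * Bumps, partitions of unity and densities *)

Section IntegralPartial.
Context {R : realType}.

(** Translation invariance gives every difference quotient the integral 0, and by uniform continuity
    these quotients approach the partial derivative uniformly on a fixed cube. *)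
Lemma int_rV_partial n (g : 'rV[R]_n -> R) i : Cc g ->
  (forall x, differentiable g x) -> Cc (partial i g) -> int_rV (partial i g) = 0.
Proof.
move=> cg dg cp; have [r r0 rg] := Cc_supp cg; have [s s0 sp] := Cc_supp cp.
(* The half-side r + s + 1 covers the support of the derivative and that of the quotient, as the
   shift is at most 1. *)
pose V := (2 * (r + s + 1)) ^+ n; have V0 : 0 < V by rewrite exprn_gt0// mulr_gt0// !addr_gt0.
apply/eqP; rewrite -normr_le0; apply/ler_addgt0Pl => e e0; rewrite addr0.
have [d d0 dP] := Cc_unif_continuous cp (divr_gt0 e0 V0).
pose h := Num.min (d / 2) 1; have h0 : 0 < h by rewrite lt_min divr_gt0// ltr01.
have hd : h < d by rewrite gt_min; apply/orP; left; lra.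
have h1 : h <= 1 by rewrite ge_min lexx orbT.
pose v : 'rV[R]_n := h *: delta_mx 0 i.
have vN : `|v| <= h.
  apply/rV_norm_leP => [|j]; first exact: ltW.
  rewrite !mxE eqxx/=; case: eqP => _ /=; first by rewrite mulr1 gtr0_norm.
  by rewrite mulr0 normr0 ltW.
pose q (x : 'rV[R]_n) := h^-1 * (g (x + v) - g x).
have cq : Cc q by apply: CcZ; apply: CcB => //; exact: Cc_shift.
have q0 : int_rV q = 0.
  rewrite int_rVZ; last by apply: CcB => //; exact: Cc_shift.
  rewrite int_rVB//; last exact: Cc_shift.
  by rewrite int_rV_shift// subrr mulr0.
rewrite -[int_rV _]subr0 -q0 -int_rVB// -[leRHS](divfK (lt0r_neq0 V0)).
apply: int_rV_bound.
- exact: CcB.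
- by rewrite ltW// divr_gt0.
- by rewrite ltW// !addr_gt0.
- move=> x; have [t /andP[t0 t1] E] := @MVT_rV R n g x (x + v) (fun t _ => dg _).
  have -> : q x = partial i g (x + t *: v).
    rewrite /q E [x + v]addrC addrK (bigD1 i)//= big1 ?addr0 => [|j ji].
      by rewrite !mxE !eqxx/= mulr1 mulKf// gt_eqF.
    by rewrite !mxE eqxx/= (negbTE ji) mulr0 mul0r.
  apply/ltW/dP; rewrite opprD addrA subrr sub0r normrN normrZ (ger0_norm t0).
  apply: le_lt_trans hd; apply: le_trans vN; exact: ler_piMl.
- move=> x rx; rewrite sp; last by lra.
  rewrite /q !rg ?subrr ?mulr0 ?subr0//; first by lra.
  have := ler_normB (x + v) v; rewrite addrK => k; lra.
Qed.
End IntegralPartial.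

Lemma Ck_on_id {R : realType} n (D : set 'rV[R]_n) k : Ck_on D k (@id 'rV[R]_n).
Proof.
case: k => [|k]; first by move=> x _; exact: cvg_id.
split=> [x _|i]; first by have [] := is_diff_id x.
suff -> : partial i (@id 'rV[R]_n) = cst (delta_mx 0 i) by exact: Ck_on_cst.
by apply/funext => x; rewrite /partial derive_id.
Qed.

(** * Smooth functions and bumps on the manifold *)

Section SmoothFunctions.
Context {R : realType} {n : nat} {M : topologicalType}.
Variable S : @smooth_structure R n M.
Notation chart := (@chart R n M).
Implicit Types (c d : chart) (h : M -> R) (p : M).

Lemma chart_bwd_continuous_comp c h x : chart_cod c x -> continuous h ->
  {for x, continuous (h \o chart_bwd c)}.
Proof. by move=> cx ch; apply: continuous_comp; [exact: chart_bwd_cont|exact: ch]. Qed.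

Lemma chart_preimage_open c (U : set M) : open U ->
  open (chart_cod c `&` chart_bwd c @^-1` U).
Proof.
move=> oU; rewrite openE => x [cx Ux]; apply: filterI.
  exact: open_nbhs_nbhs (conj (@chart_cod_open _ _ _ c) cx).
exact: (chart_bwd_cont cx (open_nbhs_nbhs (conj oU Ux))).
Qed.

Lemma chart_image_open c (V : set 'rV[R]_n) : open V ->
  open (chart_dom c `&` chart_fwd c @^-1` V).
Proof.
move=> oV; rewrite openE => p [cp Vp]; apply: filterI.
  exact: open_nbhs_nbhs (conj (@chart_dom_open _ _ _ c) cp).
exact: (chart_fwd_cont cp (open_nbhs_nbhs (conj oV Vp))).
Qed.

Lemma transition_smooth c d : atlas S c -> atlas S d ->
  smooth_on (overlap c d) (transition c d).
Proof. by move=> Sc Sd; have [] := atlas_compatible Sc Sd. Qed.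

Lemma transition_overlap c d x : overlap c d x -> overlap d c (transition c d x).
Proof.
move=> [cx dx]; split; first exact: chart_fwd_cod.
by rewrite /= /transition/= chart_fwdK//; exact: chart_bwd_dom.
Qed.

Lemma transitionK c d x : overlap c d x -> transition d c (transition c d x) = x.
Proof. by move=> [cx dx]; rewrite /transition/= chart_fwdK// chart_bwdK. Qed.

Lemma chart_bwd_transition c d x : overlap c d x ->
  chart_bwd d (transition c d x) = chart_bwd c x.
Proof. by move=> [cx dx]; rewrite /transition/= chart_fwdK. Qed.

Lemma transition_differentiable c d x : atlas S c -> atlas S d -> overlap c d x ->
  differentiable (transition c d) x.
Proof. by move=> Sc Sd ox; have [+ _] := transition_smooth Sc Sd 1%N; apply. Qed.

(** Transition maps carry smoothness from the one chart given at each point to every chart of the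
    atlas. *)
Lemma smooth_real_local h :
  (forall p, exists c (V : set 'rV[R]_n), [/\ atlas S c, chart_dom c p, open V,
     V (chart_fwd c p) & smooth_on V (h \o chart_bwd c)]) -> smooth_real S h.
Proof.
move=> H d Sd k; apply: Ck_on_local => x dx.
have [c [V [Sc cp oV Vp sV]]] := H (chart_bwd d x).
pose T := transition d c.
have ox : overlap d c x by split.
have oU : open (overlap d c `&` T @^-1` V).
  rewrite openE => y [oy Vy]; apply: filterI.
    exact: open_nbhs_nbhs (conj (@overlap_open _ _ _ d c) oy).
  have cT : {for y, continuous T}.
    apply: differentiable_continuous; exact: transition_differentiable.
  exact: (cT _ (open_nbhs_nbhs (conj oV Vy))).
exists (overlap d c `&` T @^-1` V) => //.
apply: (@eq_Ck_on _ _ _ _ _ ((h \o chart_bwd c) \o T)) => //.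
  by move=> y [oy _]; rewrite /= chart_bwd_transition.
apply: (@Ck_on_comp _ _ _ _ V) => //; first by move=> y [].
by apply: Ck_on_sub (transition_smooth Sd Sc k) => y [].
Qed.

Lemma smooth_real_continuous h : smooth_real S h -> continuous h.
Proof.
move=> sh p; have [c Sc cp] := atlas_cover S p.
apply: (@near_eq_continuous _ _ ((h \o chart_bwd c) \o chart_fwd c)).
  by apply: (open_near (@chart_dom_open _ _ _ c) cp) => q cq; rewrite /= chart_fwdK.
apply: continuous_comp; first exact: chart_fwd_cont.
by have := sh c Sc 0%N => /=; apply; exact: chart_fwd_cod.
Qed.

Lemma smooth_real_cst (a : R) : smooth_real S (fun _ => a).
Proof. by move=> c Sc k; exact: Ck_on_cst. Qed.

Lemma smooth_realM h k : smooth_real S h -> smooth_real S k ->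
  smooth_real S (fun p => h p * k p).
Proof.
move=> sh sk c Sc m; apply: (@Ck_onM _ _ _ _ (h \o chart_bwd c) (k \o chart_bwd c)).
- exact: chart_cod_open.
- exact: sh.
- exact: sk.
Qed.

Lemma smooth_realN h : smooth_real S h -> smooth_real S (fun p => - h p).
Proof. by move=> /(smooth_realZ (-1)); under eq_fun do rewrite mulN1r. Qed.

Lemma smooth_realB h k : smooth_real S h -> smooth_real S k ->
  smooth_real S (fun p => h p - k p).
Proof. by move=> sh sk; apply: (smooth_realD sh); exact: smooth_realN. Qed.

Lemma smooth_real_sum (I : Type) (s : seq I) (f : I -> M -> R) :
  (forall i, smooth_real S (f i)) -> smooth_real S (fun p => \sum_(i <- s) f i p).
Proof.
move=> sf c Sc m; apply: (@Ck_on_sum_seq _ _ _ _ _ _ (fun i => f i \o chart_bwd c)).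
  exact: chart_cod_open.
by move=> i; exact: sf.
Qed.

Lemma smooth_real_comp (I : set R) (psi : nat -> R -> R) h j : smooth_seq I psi ->
  (forall p, I (h p)) -> smooth_real S h -> smooth_real S (psi j \o h).
Proof.
move=> sI hI sh c Sc m.
apply: (Ck_on_comp1 (f := h \o chart_bwd c) j (@chart_cod_open _ _ _ c) sI _ (sh c Sc m)).
by move=> x _; exact: hI.
Qed.

Lemma smooth_real_inv h : (forall p, h p != 0) -> smooth_real S h ->
  smooth_real S (fun p => (h p)^-1).
Proof.
move=> h0 sh; have := smooth_real_comp 0 (@smooth_seq_inv R) h0 sh.
by rewrite [X in smooth_real S X -> _](_ : _ = fun p => (h p)^-1)//;
  apply/funext => p; rewrite /= expr0 fact0 expr1 !mul1r.
Qed.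

Hypotheses (M_hausdorff : hausdorff_space M) (M_compact : compact [set: M]).

Lemma closed_compactM (K : set M) : closed K -> compact K.
Proof. by move=> cK; apply: (subclosed_compact cK M_compact). Qed.

Lemma compact_closedM (K : set M) : compact K -> closed K.
Proof. exact: compact_closed. Qed.

(** The norm on row vectors is the maximum norm, so a product of flat functions of the coordinates
    vanishes outside a ball. In a Hausdorff space the compact image of that ball is closed, which
    makes the extension by 0 smooth across the rim of the chart. *)
Lemma chart_bump c p (U : set M) : atlas S c -> chart_dom c p -> open U -> U p ->
  exists chi : M -> R, exists K : set M, [/\ smooth_real S chi, forall q, 0 <= chi q,
    0 < chi p, compact K & K `<=` U `&` chart_dom c /\ forall q, ~ K q -> chi q = 0].
Proof.
move=> Sc cp oU Up; pose x0 := chart_fwd c p.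
have oV := chart_preimage_open (c := c) oU.
have Vx0 : (chart_cod c `&` chart_bwd c @^-1` U) x0.
  by split; [exact: chart_fwd_cod|rewrite /= chart_fwdK].
have /nbhs_ballP[e /= e0 eP] := open_nbhs_nbhs (conj oV Vx0).
pose r := e / 2; have r0 : 0 < r by rewrite divr_gt0.
have rV x : `|x - x0| <= r -> chart_cod c x /\ U (chart_bwd c x).
  move=> xr; apply: eP; rewrite -ball_normE/= distrC (le_lt_trans xr)// /r; lra.
pose f (x : 'rV[R]_n) := \prod_i flat 1 (r ^+ 2 - (x 0 i - x0 0 i) ^+ 2).
have sf : smooth_on setT f.
  move=> k; apply: Ck_on_prod => [|i]; first exact: openT.
  have [psi [psi0 spsi]] := smooth_seq_flat (1 : {poly R}).
  rewrite -psi0.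
  have sc : Ck_on setT k (fun x : 'rV[R]_n => x 0 i - x0 0 i).
    apply: (@Ck_onD _ _ _ _ _ (fun x : 'rV[R]_n => x 0 i) (fun=> - x0 0 i)); first exact: openT.
      apply: (@Ck_on_coord _ _ _ _ _ id); first exact: openT.
      exact: Ck_on_id.
    exact: Ck_on_cst.
  apply: (@Ck_on_comp1 _ _ setT psi setT (fun x : 'rV[R]_n => r ^+ 2 - (x 0 i - x0 0 i) ^+ 2)) => //.
    exact: openT.
  apply: (@Ck_onD _ _ _ _ _ (fun=> r ^+ 2)); [exact: openT|exact: Ck_on_cst|].
  have -> : (fun x : 'rV[R]_n => - (x 0 i - x0 0 i) ^+ 2) =
    ((cst (-1)) \* (fun x : 'rV[R]_n => x 0 i - x0 0 i)) \* (fun x : 'rV[R]_n => x 0 i - x0 0 i).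
    by apply/funext => x; rewrite /= mulN1r mulNr expr2.
  apply: Ck_onM => //; first exact: openT.
  by apply: Ck_onM => //; [exact: openT|exact: Ck_on_cst].
have fpos (y : R) : 0 <= flat 1 y /\ (0 < y -> 0 < flat 1 y).
  rewrite /flat hornerC mul1r; case: ifP => //; split=> // _; exact: expR_gt0.
pose K := chart_bwd c @` [set x | `|x - x0| <= r].
have cK : compact K.
  apply: continuous_compact; last exact: closed_ball_rV_compact.
  apply: continuous_in_subspaceT => x; rewrite inE/= => /rV[cx _]; exact: chart_bwd_cont.
have KU : K `<=` U `&` chart_dom c.
  by move=> _ [x /= /rV[cx Ux] <-]; split=> //; exact: chart_bwd_dom.
have f0 x : ~ `|x - x0| <= r -> f x = 0.
  move=> xr; have [i ir] : exists i, r < `|x 0 i - x0 0 i|.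
    apply: contrapT => /forallNP h; apply: xr; apply/rV_norm_leP; first exact: ltW.
    by move=> i; rewrite !mxE leNgt; apply/negP; exact: h.
  rewrite /f (bigD1 i)//= flat_le0 ?mul0r// subr_le0 -[leRHS]ger0_norm ?sqr_ge0//.
  by rewrite normrX lerXn2r ?nnegrE// ltW.
pose chi q := zero_ext (chart_dom c) (f \o chart_fwd c) q.
have chi0 q : ~ K q -> chi q = 0.
  move=> nK; have [cq|ncq] := pselect (chart_dom c q); last exact: zero_ext_out.
  rewrite /chi zero_ext_in//= f0// => h; apply: nK; exists (chart_fwd c q) => //.
  exact: chart_fwdK.
exists chi, K; split=> //.
- apply: smooth_real_local => q; have [cq|ncq] := pselect (chart_dom c q).
    exists c, (chart_cod c); split=> //; [exact: chart_cod_open|exact: chart_fwd_cod|].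
    move=> k; apply: (@eq_Ck_on _ _ _ _ _ f) => //; first exact: chart_cod_open.
      move=> x cx; rewrite /chi /= zero_ext_in; last exact: chart_bwd_dom.
      by rewrite /= chart_bwdK.
    by apply: Ck_on_sub (sf k).
  have nKq : (~` K) q by move=> /KU[].
  have [d Sd dq] := atlas_cover S q.
  have oK : open (~` K) by apply: closed_openC; exact: compact_closedM.
  exists d, (chart_cod d `&` chart_bwd d @^-1` (~` K)); split=> //.
  + exact: chart_preimage_open.
  + by split; [exact: chart_fwd_cod|rewrite /= chart_fwdK].
  + move=> k; apply: (@eq_Ck_on _ _ _ _ _ (cst 0)); first exact: chart_preimage_open.
      by move=> x [_ nKx]; rewrite /= chi0.
    exact: Ck_on_cst.
- move=> q; rewrite /chi /zero_ext; case: ifP => // _ /=.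
  by apply: prodr_ge0 => i _; have [] := fpos (r ^+ 2 - (chart_fwd c q 0 i - x0 0 i) ^+ 2).
- rewrite /chi zero_ext_in//= /f; apply: prodr_gt0 => i _; apply: (fpos _).2.
  by rewrite subrr expr0n subr0 exprn_gt0.
Qed.
End SmoothFunctions.

Lemma finite_subcover (T : topologicalType) (K : set T) (U : T -> set T) :
  compact K -> (forall p, K p -> nbhs p (U p)) ->
  exists s : seq T, forall q, K q -> exists2 p, p \in s & U p q.
Proof.
move=> /compact_near_coveringP cK KU.
(* Finite sequences are directed by inclusion; a property is eventual along this filter if it holds
   for all sequences containing a given one. *)
pose F : set_system (seq T) := [set B : set (seq T) | exists s0 : seq T,
  forall s : seq T, {subset s0 <= s} -> B s].
have FF : Filter F.
  split; first by exists [::].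
    move=> B C [s sB] [t tC]; exists (s ++ t) => u su; split.
      by apply: sB => x xs; apply: su; rewrite mem_cat xs.
    by apply: tC => x xs; apply: su; rewrite mem_cat xs orbT.
  by move=> B C BC [s sB]; exists s => u /sB/BC.
have [p Kp|s sP] := cK _ F (fun s q => exists2 p, p \in s & U p q) FF.
  exists (U p, [set s : seq T | p \in s]).
    by split=> /=; [exact: KU|exists [:: p] => s; apply; rewrite mem_head].
  by move=> [q s] /= [Uq ps]; exists p.
by exists s; apply: sP.
Qed.

(** * Partitions of unity and the reference density *)

Section Partition.
Context {R : realType} {n : nat} {M : topologicalType}.
Variables (S : @smooth_structure R n M) (O : orientation S).
Hypotheses (M_hausdorff : hausdorff_space M) (M_compact : compact [set: M]).

Lemma partition_of_unity_exists : exists P : partition_of_unity O, True.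
Proof.
have H p : exists t : @chart R n M * (M -> R) * set M,
    [/\ oriented O t.1.1, smooth_real S t.1.2, forall q, 0 <= t.1.2 q, 0 < t.1.2 p &
     closure [set q | t.1.2 q != 0] `<=` chart_dom t.1.1].
  have [c Oc cp] := oriented_cover O p.
  have [chi [K [schi chi0 chip cK [KU chiK]]]] :=
    chart_bump M_hausdorff (oriented_atlas Oc) cp (@openT M) I.
  exists (c, chi, K); split=> //= q.
  have cl : closed K by exact: compact_closed.
  move=> qcl; have : K q.
    rewrite closure_id in cl; rewrite cl; apply: closure_subset qcl => q' /= /eqP.
    by move=> h; apply: contrapT => /chiK.
  by case/KU.
have [t tP] := choice H.
have [s sP] : exists s : seq M, forall q, [set: M] q -> exists2 p, p \in s & 0 < (t p).1.2 q.
  apply: (@finite_subcover _ _ (fun p => [set q | 0 < (t p).1.2 q])) => // p _.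
  have [_ sp _ pp _] := tP p; have cp : (t p).1.2 q @[q --> p] --> (t p).1.2 p.
    by have := smooth_real_continuous sp; apply.
  by move/cvgr_gt: cp; apply.
pose sum q := \sum_(p <- s) (t p).1.2 q.
have sum0 q : 0 < sum q.
  have [p ps pq] := sP q I; rewrite /sum (big_rem p ps)/= ltr_pwDl//.
  by apply: sumr_ge0 => p' _; have [_ _ + _ _] := tP p'; apply.
pose c j := (t (tnth (in_tuple s) j)).1.1.
pose f j q := (t (tnth (in_tuple s) j)).1.2 q * (sum q)^-1.
have f1 j : oriented O (c j) by have [] := tP (tnth (in_tuple s) j).
have f2 j : smooth_real S (f j).
  apply: smooth_realM; first by have [] := tP (tnth (in_tuple s) j).
  apply: smooth_real_inv => [q|]; first by rewrite gt_eqF.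
  by apply: smooth_real_sum => p; have [] := tP p.
have f3 j q : 0 <= f j q.
  apply: mulr_ge0; last by rewrite invr_ge0 ltW.
  by have [_ _ + _ _] := tP (tnth (in_tuple s) j); apply.
have f4 j : closure [set q | f j q != 0] `<=` chart_dom (c j).
  have [_ _ _ _ h] := tP (tnth (in_tuple s) j); apply: subset_trans h.
  by apply: closure_subset => q /=; apply: contra => /eqP h; rewrite /f h mul0r.
have f5 q : \sum_j f j q = 1.
  rewrite -mulr_suml -(big_tuple _ _ (in_tuple s) xpredT (fun p => (t p).1.2 q)).
  by rewrite -[\sum_(i <- _) _]/(sum q) mulfV// gt_eqF.
by exists (PartitionOfUnity f1 f2 f3 f4 f5).
Qed.

Variable P : partition_of_unity O.
Let supp (j : 'I_(pu_size P)) := closure [set q | pu_fun j q != 0].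

Lemma pu_out (j : 'I_(pu_size P)) q : ~ supp j q -> pu_fun j q = 0.
Proof. by move=> nq; apply/eqP/negPn/negP => h; apply: nq; exact: subset_closure. Qed.

Lemma pu_supp_compact (j : 'I_(pu_size P)) : compact (supp j).
Proof. by apply: closed_compactM => //; exact: closed_closure. Qed.

Lemma pu_atlas (j : 'I_(pu_size P)) : atlas S (pu_chart j).
Proof. exact: oriented_atlas (pu_oriented j). Qed.

(* The coefficient in the chart [c] of the positive n-form [\sum_j pu_j dx_j], where
   [dx_j] is the coordinate volume of the j-th chart of the partition of unity. *)
Definition vol (c : @chart R n M) (x : 'rV[R]_n) : R :=
  \sum_(j < pu_size P) zero_ext (overlap c (pu_chart j))
    (fun y => pu_fun j (chart_bwd c y) * \det ('J (transition c (pu_chart j)) y)) x.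

(** At a point outside the j-th chart the j-th summand vanishes in a neighbourhood, because the
    support of [pu_fun j] is closed and lies in that chart. *)
Lemma vol_smooth c : atlas S c -> smooth_on (chart_cod c) (vol c).
Proof.
move=> Sc k; apply: Ck_on_sum; first exact: chart_cod_open.
move=> j; set d := pu_chart j; apply: Ck_on_local => x cx.
have [dx|ndx] := pselect (chart_dom d (chart_bwd c x)).
  exists (overlap c d); first by split.
  apply: (@eq_Ck_on _ _ _ _ _ (fun y => pu_fun j (chart_bwd c y) * \det ('J (transition c d) y))).
  - exact: overlap_open.
  - by move=> y oy; rewrite zero_ext_in.
  - apply: (@Ck_onM _ _ _ _ (pu_fun j \o chart_bwd c)); first exact: overlap_open.
      by apply: Ck_on_sub (pu_smooth j Sc k) => y [].
    apply: Ck_on_det_jacobian; first exact: overlap_open.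
    exact: (transition_smooth Sc (pu_atlas j) k.+1).
have nx : (~` supp j) (chart_bwd c x) by move=> /pu_support.
have oU : open (chart_cod c `&` chart_bwd c @^-1` (~` supp j)).
  by apply: chart_preimage_open; apply: closed_openC; exact: closed_closure.
exists (chart_cod c `&` chart_bwd c @^-1` (~` supp j)) => //.
apply: (@eq_Ck_on _ _ _ _ _ (cst 0)) => //; last exact: Ck_on_cst.
move=> y [cy ny]; rewrite /zero_ext; case: ifP => // _.
by rewrite pu_out ?mul0r.
Qed.

Lemma det_transition c d e x : atlas S c -> atlas S d -> atlas S e ->
  overlap c d x -> overlap c e x ->
  \det ('J (transition c e) x) =
  \det ('J (transition c d) x) * \det ('J (transition d e) (transition c d x)).
Proof.
move=> Sc Sd Se cdx cex.
have dex : overlap d e (transition c d x).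
  case: (transition_overlap cdx) => h1 _; split=> //.
  by rewrite /= chart_bwd_transition//; case: cex.
have dT := transition_differentiable Sc Sd cdx.
have dU := transition_differentiable Sd Se dex.
rewrite -det_mulmx -(jacobian_comp dT dU).
have E : \forall y \near x, transition c e y = (transition d e \o transition c d) y.
  apply: (open_near (overlap_open (c := c) (d := d)) cdx) => y cdy.
  by rewrite /= [in RHS]/transition/= chart_bwd_transition.
have EJ := jacobian_near E (transition_differentiable Sc Se cex).
exact: (congr1 determinant EJ).
Qed.

(** The cocycle identity for the charts c, d, c exhibits the determinant as a factor of 1. *)
Lemma det_transition_neq0 c d x : atlas S c -> atlas S d -> overlap c d x ->
  \det ('J (transition c d) x) != 0.
Proof.
move=> Sc Sd cdx; have ccx : overlap c c x.
  by case: cdx => cx _; split=> //; exact: chart_bwd_dom.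
have := det_transition Sc Sd Sc cdx ccx.
have -> : 'J (transition c c) x = 1%:M.
  transitivity ('J (@id 'rV[R]_n) x); last exact: jacobian_id.
  apply/esym/jacobian_near; last by have [] := is_diff_id x.
  apply: (open_near (@chart_cod_open _ _ _ c) cdx.1) => y cy.
  by rewrite /transition /= chart_bwdK.
have aux (a b : R) : 1 = a * b -> a != 0.
  by move=> /esym/eqP; apply: contraTneq => ->; rewrite mul0r eq_sym oner_neq0.
by rewrite det1; exact: aux.
Qed.

Lemma vol_change c d x : atlas S c -> atlas S d -> overlap c d x ->
  vol c x = \det ('J (transition c d) x) * vol d (transition c d x).
Proof.
move=> Sc Sd cdx; rewrite /vol mulr_sumr; apply: eq_bigr => j _.
set e := pu_chart j; have Se : atlas S e := pu_atlas j.
have [dx|ndx] := pselect (chart_dom e (chart_bwd c x)).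
  have cex : overlap c e x by split=> //; case: cdx.
  have dex : overlap d e (transition c d x).
    by split; [case: (transition_overlap cdx)|rewrite /= chart_bwd_transition].
  rewrite !zero_ext_in// chart_bwd_transition// [RHS]mulrCA; congr (_ * _).
  exact: det_transition.
rewrite !zero_ext_out ?mulr0//; last by case.
by move=> [_]; rewrite /= chart_bwd_transition.
Qed.

Lemma vol_gt0 c x : oriented O c -> chart_cod c x -> 0 < vol c x.
Proof.
move=> Oc cx; set p := chart_bwd c x.
have ge0 (j : 'I_(pu_size P)) : 0 <= zero_ext (overlap c (pu_chart j))
    (fun y => pu_fun j (chart_bwd c y) * \det ('J (transition c (pu_chart j)) y)) x.
  rewrite /zero_ext; case: ifPn => // /set_mem ox; apply: mulr_ge0; first exact: pu_ge0.
  exact/ltW/(oriented_det Oc (pu_oriented j) ox).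
rewrite lt_neqAle sumr_ge0 ?andbT// eq_sym; apply/negP => /eqP h.
have /eqP : \sum_j pu_fun j p = 1 := pu_sum P p.
rewrite big1 => [|j _]; first by rewrite eq_sym oner_eq0.
have [pj|] := pselect (supp j p); last exact: pu_out.
have ox : overlap c (pu_chart j) x by split=> //; exact: pu_support pj.
have := psumr_eq0P (fun j _ => ge0 j) h (i := j) isT; rewrite zero_ext_in// => /eqP.
by rewrite mulf_eq0 => /orP[/eqP//|]; rewrite gt_eqF//; exact: (oriented_det Oc (pu_oriented j) ox).
Qed.

(** A chart of the atlas may reverse the orientation, so only nonvanishing is kept when passing from
    an oriented chart to an arbitrary one. *)
Lemma vol_neq0 c x : atlas S c -> chart_cod c x -> vol c x != 0.
Proof.
move=> Sc cx; have [d Od dx] := oriented_cover O (chart_bwd c x).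
have cdx : overlap c d x by split.
have Sd := oriented_atlas Od; rewrite (vol_change Sc Sd cdx) mulf_neq0//.
  exact: det_transition_neq0.
by rewrite gt_eqF// vol_gt0//; exact: chart_fwd_cod.
Qed.
End Partition.

(** * Integration on the manifold, divergence and Stokes formula *)

Section ManifoldIntegral.
Context {R : realType} {n : nat} {M : topologicalType}.
Variables (S : @smooth_structure R n M) (O : orientation S).
Hypotheses (M_hausdorff : hausdorff_space M) (M_compact : compact [set: M]).
Variable P : partition_of_unity O.
Notation chart := (@chart R n M).
Notation vol := (vol P).
Implicit Types (c d : chart) (f g : M -> R).

Definition chart_int c (k : 'rV[R]_n -> R) : R := int_rV (zero_ext (chart_cod c) k).

Lemma chart_image_compact c (K : set M) : compact K -> K `<=` chart_dom c ->
  compact (chart_fwd c @` K) /\ chart_fwd c @` K `<=` chart_cod c.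
Proof.
move=> cK KD; split; last by move=> _ [p /KD cp <-]; exact: chart_fwd_cod.
apply: continuous_compact => //; apply: continuous_in_subspaceT => p.
by rewrite inE => /KD; exact: chart_fwd_cont.
Qed.

Lemma Cc_chart c f (k : 'rV[R]_n -> R) (K : set M) : continuous f -> compact K ->
  K `<=` chart_dom c -> (forall p, ~ K p -> f p = 0) ->
  (forall x, chart_cod c x -> {for x, continuous k}) ->
  Cc (zero_ext (chart_cod c) (fun x => f (chart_bwd c x) * k x)).
Proof.
move=> cf cK KD fK ck; have [cK' K'c] := chart_image_compact cK KD.
apply: (Cc_zero_ext (@chart_cod_open _ _ _ c) cK' K'c) => x cx.
  by apply: contM_at; [exact: chart_bwd_continuous_comp|exact: ck].
move=> nK; rewrite fK ?mul0r// => Kx; apply: nK; exists (chart_bwd c x) => //.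
exact: chart_bwdK.
Qed.

Lemma vol_continuous c x : atlas S c -> chart_cod c x -> {for x, continuous (vol c)}.
Proof. by move=> Sc cx; have := vol_smooth P Sc 0%N => /=; apply. Qed.

Let change_alg (s u v w a b : R) : u = 0 \/ v = a * w /\ b = s * a ->
  s * (u * v) = u * w * b.
Proof. by case=> [->|[-> ->]]; ring. Qed.

(* The sign [s] is that of the Jacobian determinant on the support of [f]. *)
Lemma chart_int_change c d (s : R) f (K : set M) : atlas S c -> atlas S d ->
  continuous f -> compact K -> K `<=` chart_dom c `&` chart_dom d ->
  (forall p, ~ K p -> f p = 0) ->
  (forall x, overlap c d x -> K (chart_bwd c x) ->
    `|\det ('J (transition c d) x)| = s * \det ('J (transition c d) x)) ->
  s * chart_int c (fun x => f (chart_bwd c x) * vol c x) =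
  chart_int d (fun x => f (chart_bwd d x) * vol d x).
Proof.
move=> Sc Sd cf cK KD fK sE; rewrite /chart_int.
have KDc : K `<=` chart_dom c by move=> p /KD[].
have KDd : K `<=` chart_dom d by move=> p /KD[].
pose F := zero_ext (chart_cod d) (fun x => f (chart_bwd d x) * vol d x).
have cF : Cc F by apply: (Cc_chart cf cK KDd fK) => x; exact: vol_continuous.
have [cK' _] := chart_image_compact cK KDd.
have K'B : chart_fwd d @` K `<=` overlap d c.
  move=> _ [p Kp <-]; split; first by apply: chart_fwd_cod; exact: KDd.
  by rewrite /= chart_fwdK; [exact: KDc|exact: KDd].
have FK' y : ~ (chart_fwd d @` K) y -> F y = 0.
  move=> nK; have [dy|ndy] := pselect (chart_cod d y); last exact: zero_ext_out.
  rewrite /F zero_ext_in// fK ?mul0r// => Ky; apply: nK; exists (chart_bwd d y) => //.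
  exact: chart_bwdK.
have JT x : overlap c d x -> 'J (transition c d) x \in unitmx.
  by move=> ox; rewrite unitmxE unitfE; exact: (det_transition_neq0 Sc Sd ox).
have cS y : overlap d c y -> {for y, continuous (transition d c)}.
  by move=> oy; apply: differentiable_continuous; exact: (transition_differentiable Sd Sc oy).
have := change_of_variables (@overlap_open _ _ _ c d) (@overlap_open _ _ _ d c)
  (@transition_overlap _ _ _ d c)
  (@transitionK _ _ _ c d) (@transitionK _ _ _ d c)
  (transition_smooth Sc Sd 1%N) cS JT cF cK' K'B FK'.
move=> cov; apply: (etrans _ cov); pose k x := f (chart_bwd c x) * vol c x.
transitivity (int_rV (fun x => s * zero_ext (chart_cod c) k x)).
  by apply/esym/int_rVZ; apply: (Cc_chart cf cK KDc fK) => x; exact: vol_continuous.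
congr int_rV; apply/funext => x.
have [ox|nox] := pselect (overlap c d x); last first.
  apply: (etrans _ (esym (zero_ext_out _ nox))).
  have [cx|ncx] := pselect (chart_cod c x); last by rewrite zero_ext_out// mulr0.
  rewrite zero_ext_in// /k fK ?mul0r ?mulr0// => /KDd dx; apply: nox; split=> //.
apply: (etrans _ (esym (zero_ext_in _ ox))).
have [cx dx] := ox.
rewrite zero_ext_in// /F zero_ext_in; last exact: chart_fwd_cod.
rewrite /k chart_bwd_transition//.
apply: (@change_alg s (f (chart_bwd c x)) _ _ (\det ('J (transition c d) x))).
have [Kx|nKx] := pselect (K (chart_bwd c x)); last by left; exact: fK.
by right; split; [exact: (vol_change P Sc Sd ox)|exact: (sE x ox Kx)].
Qed.

Definition vol_int f : R :=
  \sum_(j < pu_size P) chart_int (pu_chart j)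
    (fun x => pu_fun j (chart_bwd (pu_chart j) x) * f (chart_bwd (pu_chart j) x) *
              vol (pu_chart j) x).

Let pf (j : 'I_(pu_size P)) f p := pu_fun j p * f p.
Let supp (j : 'I_(pu_size P)) := closure [set q | pu_fun j q != 0].

Lemma pu_continuous (j : 'I_(pu_size P)) : continuous (pu_fun j).
Proof. by apply: (smooth_real_continuous (S := S)); exact: pu_smooth. Qed.

Let pf_cont j f : continuous f -> continuous (pf j f).
Proof. by move=> cf; apply: contM => //; exact: pu_continuous. Qed.

Let pf_out j f p : ~ supp j p -> pf j f p = 0.
Proof. by move=> np; rewrite /pf pu_out ?mul0r. Qed.

Let supp_compact j : compact (supp j). Proof. exact: pu_supp_compact. Qed.
Let supp_dom j : supp j `<=` chart_dom (pu_chart j). Proof. exact: pu_support. Qed.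

Let term_Cc j f : continuous f -> Cc (zero_ext (chart_cod (pu_chart j))
  (fun x => pf j f (chart_bwd (pu_chart j) x) * vol (pu_chart j) x)).
Proof.
move=> cf; apply: (@Cc_chart (pu_chart j) (pf j f) (vol (pu_chart j)) (supp j)) => //.
- exact: pf_cont.
- by move=> p; exact: pf_out.
by move=> x; apply: vol_continuous; exact: pu_atlas.
Qed.

Lemma vol_intE f : vol_int f = \sum_(j < pu_size P)
  chart_int (pu_chart j) (fun x => pf j f (chart_bwd (pu_chart j) x) * vol (pu_chart j) x).
Proof. by []. Qed.

Lemma vol_intD f g : continuous f -> continuous g ->
  vol_int (fun p => f p + g p) = vol_int f + vol_int g.
Proof.
move=> cf cg; rewrite !vol_intE -big_split/=; apply: eq_bigr => j _.
rewrite /chart_int -int_rVD; [|exact: term_Cc..]; congr int_rV; apply/funext => x.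
rewrite /zero_ext; case: ifP => _; last by rewrite addr0.
by rewrite /pf; ring.
Qed.

Lemma vol_intZ a f : continuous f -> vol_int (fun p => a * f p) = a * vol_int f.
Proof.
move=> cf; rewrite !vol_intE mulr_sumr; apply: eq_bigr => j _.
rewrite /chart_int -int_rVZ; last exact: term_Cc; congr int_rV; apply/funext => x.
rewrite /zero_ext; case: ifP => _; last by rewrite mulr0.
by rewrite /pf; ring.
Qed.

Lemma vol_int_pos f : continuous f -> (forall p, 0 <= f p) ->
  0 <= vol_int f /\ ((exists p, 0 < f p) -> 0 < vol_int f).
Proof.
move=> cf f0.
have t0 j x : 0 <= zero_ext (chart_cod (pu_chart j))
    (fun x => pf j f (chart_bwd (pu_chart j) x) * vol (pu_chart j) x) x.
  rewrite /zero_ext; case: ifPn => // /set_mem cx.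
  rewrite mulr_ge0// ?mulr_ge0 ?pu_ge0// ltW// vol_gt0//; exact: pu_oriented.
have s0 j : 0 <= chart_int (pu_chart j)
    (fun x => pf j f (chart_bwd (pu_chart j) x) * vol (pu_chart j) x).
  by apply: (int_rV_pos _ _).1; [exact: term_Cc|].
split; first by rewrite vol_intE; apply: sumr_ge0.
move=> [p fp]; rewrite vol_intE lt_neqAle sumr_ge0 ?andbT// eq_sym.
apply/negP => /eqP h; have /eqP : \sum_j pu_fun j p = 1 := pu_sum P p.
rewrite big1 => [|j _]; first by rewrite eq_sym oner_eq0.
apply/eqP/negPn/negP => pj.
have dp : chart_dom (pu_chart j) p by apply: supp_dom; exact: subset_closure.
have := psumr_eq0P (fun j _ => s0 j) h (i := j) isT; apply/eqP; rewrite gt_eqF//.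
apply: (int_rV_pos _ _).2; [exact: term_Cc|by []|].
exists (chart_fwd (pu_chart j) p); have cx := chart_fwd_cod dp.
rewrite zero_ext_in// chart_fwdK// mulr_gt0//.
  by rewrite mulr_gt0// lt_neqAle eq_sym pj pu_ge0.
by rewrite vol_gt0//; exact: pu_oriented.
Qed.

Lemma vol_int_bound f (B : R) : continuous f -> (forall p, `|f p| <= B) ->
  `|vol_int f| <= B * vol_int (fun=> 1).
Proof.
move=> cf fB; have c1 : continuous (fun _ : M => 1 : R) by exact: cont_cst.
have h1 : 0 <= vol_int (fun p => B * 1 + f p).
  apply: (vol_int_pos _ _).1; first by apply: contD => //; exact: cont_cst.
  by move=> p; have := fB p; rewrite ler_norml => /andP[h _]; lra.
have h2 : 0 <= vol_int (fun p => B * 1 + (-1) * f p).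
  apply: (vol_int_pos _ _).1.
    by apply: contD; [exact: cont_cst|apply: contM => //; exact: cont_cst].
  by move=> p; have := fB p; rewrite ler_norml => /andP[_ h]; lra.
rewrite vol_intD ?vol_intZ// in h1; last exact: cont_cst.
rewrite vol_intD ?vol_intZ// in h2; [|exact: cont_cst|by apply: contM => //; exact: cont_cst].
by rewrite ler_norml; apply/andP; split; lra.
Qed.

(** Each term of the partition is moved to the chart [c] by [chart_int_change], with sign 1 because
    both charts are oriented; there the terms add up to [f]. *)
Lemma vol_int_local c f (K : set M) : oriented O c -> continuous f -> compact K ->
  K `<=` chart_dom c -> (forall p, ~ K p -> f p = 0) ->
  vol_int f = chart_int c (fun x => f (chart_bwd c x) * vol c x).
Proof.
move=> Oc cf cK KD fK; have Sc := oriented_atlas Oc; rewrite vol_intE.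
transitivity (\sum_(j < pu_size P) chart_int c (fun x => pf j f (chart_bwd c x) * vol c x)).
  apply: eq_bigr => j _; have Sd := pu_atlas j.
  rewrite -(mul1r (chart_int c _)); apply/esym.
  apply: (@chart_int_change c (pu_chart j) 1 (pf j f) (supp j `&` K)) => //.
  - exact: pf_cont.
  - by apply: compact_closedI => //; exact: compact_closedM.
  - by move=> p [/supp_dom ? /KD ?].
  - move=> p np; have [sp|] := pselect (supp j p); last exact: pf_out.
    by rewrite /pf fK ?mulr0// => Kp; apply: np.
  - by move=> x ox _; rewrite mul1r gtr0_norm//; exact: (oriented_det Oc (pu_oriented j) ox).
rewrite /chart_int -int_rV_sum; last first.
  move=> j; apply: (@Cc_chart c (pf j f) (vol c) K) => //; first exact: pf_cont.
    by move=> p np; rewrite /pf fK ?mulr0.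
  by move=> x; exact: vol_continuous.
congr int_rV; apply/funext => x; have [cx|ncx] := pselect (chart_cod c x); last first.
  by rewrite zero_ext_out// big1// => j _; rewrite zero_ext_out.
rewrite zero_ext_in//; under eq_bigr do rewrite zero_ext_in//.
by rewrite -mulr_suml /pf -mulr_suml pu_sum mul1r.
Qed.
End ManifoldIntegral.

(** * The derivative of a function along the field *)

Section LieDerivative.
Context {R : realType} {n : nat} {M : topologicalType}.
Variables (S : @smooth_structure R n M) (X : vector_field S).
Notation chart := (@chart R n M).
Implicit Types (c d : chart) (f g h : M -> R) (p : M).
Notation L := (lie_real X).

Lemma smooth_real_differentiable c h x : smooth_real S h -> atlas S c -> chart_cod c x ->
  differentiable (h \o chart_bwd c) x.
Proof. by move=> sh Sc cx; have [+ _] := sh c Sc 1%N; apply. Qed.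

Let diff_at h p : smooth_real S h ->
  differentiable (h \o chart_bwd (chart_at S p)) (chart_fwd (chart_at S p) p).
Proof.
move=> sh; apply: smooth_real_differentiable => //; first exact: chart_at_atlas.
by apply: chart_fwd_cod; exact: chart_at_dom.
Qed.

Lemma lie_realD f g p : smooth_real S f -> smooth_real S g ->
  L (fun q => f q + g q) p = L f p + L g p.
Proof.
move=> sf sg; rewrite /lie_real.
by rewrite -(@deriveD _ _ _ (f \o _) (g \o _))//; apply: diff_derivable; exact: diff_at.
Qed.

Lemma lie_realM f g p : smooth_real S f -> smooth_real S g ->
  L (fun q => f q * g q) p = f p * L g p + g p * L f p.
Proof.
move=> sf sg; rewrite /lie_real.
rewrite (@deriveM _ _ (f \o _) (g \o _)); [|by apply: diff_derivable; exact: diff_at..].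
by rewrite /= chart_fwdK//; exact: chart_at_dom.
Qed.

Lemma lie_real_cst (a : R) p : L (fun=> a) p = 0.
Proof. by rewrite /lie_real derive_cst. Qed.

Lemma lie_realZ (a : R) f p : smooth_real S f -> L (fun q => a * f q) p = a * L f p.
Proof.
move=> sf; rewrite (@lie_realM (fun=> a))//; last exact: smooth_real_cst.
by rewrite lie_real_cst mulr0 addr0.
Qed.

Lemma lie_realB f g p : smooth_real S f -> smooth_real S g ->
  L (fun q => f q - g q) p = L f p - L g p.
Proof.
move=> sf sg; have -> : (fun q => f q - g q) = fun q => f q + (-1) * g q.
  by apply/funext => q; rewrite mulN1r.
by rewrite lie_realD ?lie_realZ ?mulN1r//; exact: smooth_realZ.
Qed.

Lemma lie_real_sum (I : Type) (s : seq I) (f : I -> M -> R) p :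
  (forall i, smooth_real S (f i)) ->
  L (fun q => \sum_(i <- s) f i q) p = \sum_(i <- s) L (f i) p.
Proof.
move=> sf; elim: s => [|i s IH].
  by under eq_fun do rewrite big_nil; rewrite big_nil lie_real_cst.
under eq_fun do rewrite big_cons.
by rewrite big_cons lie_realD ?IH//; exact: smooth_real_sum.
Qed.

Lemma lie_real_comp (I : set R) (psi : nat -> R -> R) f j p : smooth_seq I psi ->
  (forall q, I (f q)) -> smooth_real S f ->
  L (psi j \o f) p = psi j.+1 (f p) * L f p.
Proof.
move=> sI fI sf; rewrite /lie_real; set c := chart_at S p; set x := chart_fwd c p.
have df : differentiable (f \o chart_bwd c) x by exact: diff_at.
have dI : is_derive ((f \o chart_bwd c) x) (1 : R) (psi j) (psi j.+1 ((f \o chart_bwd c) x)).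
  by apply: sI; exact: fI.
have pE : (f \o chart_bwd c) x = f p by rewrite /= chart_fwdK//; exact: chart_at_dom.
have dc : differentiable (psi j \o (f \o chart_bwd c)) x.
  by apply: differentiable_comp => //; have [dp _] := dI; exact/derivable1_diffP.
transitivity (\sum_i X c x 0 i * partial i (psi j \o (f \o chart_bwd c)) x).
  exact: derive_partial.
rewrite derive_partial// mulr_sumr; apply: eq_bigr => i _.
have [_ ->] := partial_comp1 i df dI.
by rewrite pE mulrCA.
Qed.

Lemma lie_real_near f g p : (\forall q \near p, f q = g q) -> L f p = L g p.
Proof.
move=> fg; rewrite /lie_real; set c := chart_at S p; set x := chart_fwd c p.
have cx : chart_cod c x by apply: chart_fwd_cod; exact: chart_at_dom.
apply: near_eq_derive; have xp : chart_bwd c x = p by apply: chart_fwdK; exact: chart_at_dom.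
have := chart_bwd_cont cx; rewrite /prop_for /continuous_at xp => cb.
exact: (cb _ fg).
Qed.

(** Fermat's theorem on the coordinate line through [p] in the direction of the field. *)
Lemma lie_real_max h p : smooth_real S h -> (forall q, h q <= h p) -> L h p = 0.
Proof.
move=> sh hp; rewrite /lie_real; set c := chart_at S p; set x := chart_fwd c p; set v := X c x.
have cx : chart_cod c x by apply: chart_fwd_cod; exact: chart_at_dom.
have xp : chart_bwd c x = p by apply: chart_fwdK; exact: chart_at_dom.
pose k := h \o chart_bwd c; pose g (t : R) := k (x + t *: v).
have [e e0 eP] : exists2 e : R, 0 < e & forall t : R, `|t| < e -> chart_cod c (x + t *: v).
  have /nbhs_ballP[r /= r0 rP] := open_nbhs_nbhs (conj (@chart_cod_open _ _ _ c) cx).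
  exists (r / (`|v| + 1)); first by rewrite divr_gt0// ltr_wpDl.
  move=> t te; apply: rP; rewrite -ball_normE/= opprD addrA subrr sub0r normrN normrZ.
  have v1 : 0 < `|v| + 1 by rewrite ltr_wpDl.
  apply: (@le_lt_trans _ _ (`|t| * (`|v| + 1))); first by rewrite ler_wpM2l// lerDl.
  by rewrite -ltr_pdivlMr.
have E (t : R) : (fun s : R => s^-1 *: ((g \o shift t) (s *: 1) - g t)) =
    (fun s => s^-1 *: ((k \o shift (x + t *: v)) (s *: v) - k (x + t *: v))).
  apply/funext => s /=; congr (_ *: (k _ - _)).
  by rewrite [s *: 1]mulr1 scalerDl addrCA.
have dg (t : R) : `|t| < e -> derivable g t 1.
  move=> te; rewrite /derivable E; apply: diff_derivable.
  by apply: smooth_real_differentiable => //; [exact: chart_at_atlas|exact: eP].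
have : is_derive 0 (1 : R) g 0.
  apply: (@derive1_at_max R g (- e) e 0).
  - by rewrite ge0_cp// ltW.
  - by move=> t; rewrite in_itv/= -ltr_norml; exact: dg.
  - by rewrite in_itv/= oppr_lt0 e0.
  - by move=> t _; rewrite /g scale0r addr0 /k/= xp; exact: hp.
move=> [_ g0]; rewrite -[RHS]g0 /derive E scale0r addr0; reflexivity.
Qed.

Lemma lie_real_continuous h : smooth_real S h -> continuous (L h).
Proof. by move=> sh; apply: (smooth_real_continuous (S := S)); exact: lie_real_smooth. Qed.
End LieDerivative.

Section ZeroExtPartial.
Context {R : realType} {n : nat}.
Variables (A K : set 'rV[R]_n) (f : 'rV[R]_n -> R).
Hypotheses (oA : open A) (cK : compact K) (KA : K `<=` A) (f0 : forall x, A x -> ~ K x -> f x = 0).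
Hypothesis C1f : Ck_on A 1 f.

Lemma zero_ext_partial i x : differentiable (zero_ext A f) x /\
  partial i (zero_ext A f) x = zero_ext A (partial i f) x.
Proof.
have [df _] := C1f; have [Ax|nAx] := pselect (A x).
  have E : \forall y \near x, f y = zero_ext A f y.
    by apply: (open_near oA Ax) => y Ay; rewrite zero_ext_in.
  split; first by apply: (differentiable_near E); exact: df.
  by rewrite zero_ext_in//; apply/esym/near_eq_derive.
have oK : open (~` K) by apply: closed_openC; exact: compact_rV_closed.
have nKx : (~` K) x by move=> /KA.
have E : \forall y \near x, cst 0 y = zero_ext A f y.
  apply: (open_near oK nKx) => y nKy.
  by have [Ay|nAy] := pselect (A y); [rewrite zero_ext_in// f0|rewrite zero_ext_out].
split; first by apply: (differentiable_near E); exact: differentiable_cst.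
rewrite zero_ext_out//; transitivity (partial i (cst 0 : 'rV[R]_n -> R) x).
  by apply/esym/near_eq_derive.
by rewrite /partial derive_cst.
Qed.

Lemma partial_out i x : A x -> ~ K x -> partial i f x = 0.
Proof.
move=> Ax nKx; have oK : open (A `&` ~` K).
  by apply: openI => //; apply: closed_openC; exact: compact_rV_closed.
transitivity (partial i (cst 0 : 'rV[R]_n -> R) x); last by rewrite /partial derive_cst.
apply: near_eq_derive; apply: (open_near oK (conj Ax nKx)) => y [Ay nKy].
by rewrite f0.
Qed.

Lemma int_zero_ext_partial i : Cc (zero_ext A (partial i f)) /\
  int_rV (zero_ext A (partial i f)) = 0.
Proof.
have [df pf] := C1f.
have cp : Cc (zero_ext A (partial i f)).
  by apply: (Cc_zero_ext oA cK KA) => [x Ax|x Ax nKx]; [exact: pf|exact: partial_out].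
have E : partial i (zero_ext A f) = zero_ext A (partial i f).
  by apply/funext => x; have [_ ->] := zero_ext_partial i x.
split=> //; rewrite -E; apply: int_rV_partial.
- apply: (Cc_zero_ext oA cK KA) => // x Ax.
  by apply: differentiable_continuous; exact: df.
- by move=> x; have [] := zero_ext_partial i x.
- by rewrite E.
Qed.
End ZeroExtPartial.

(** * Divergence and integration by parts *)

Section Divergence.
Context {R : realType} {n : nat} {M : topologicalType}.
Variables (S : @smooth_structure R n M) (O : orientation S).
Hypotheses (M_hausdorff : hausdorff_space M) (M_compact : compact [set: M]).
Variable P : partition_of_unity O.
Variable X : vector_field S.
Notation chart := (@chart R n M).
Notation vol := (vol P).
Notation vol_int := (vol_int P).
Notation L := (lie_real X).
Implicit Types (c d : chart) (f g : M -> R).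

(** The coefficient of the Lie derivative of the reference n-form, in the form given by Cartan's
    formula. *)
Definition lie_vol c x := \sum_i partial i (fun y => X c y 0 i * vol c y) x.

Lemma vf_vol_smooth c i : atlas S c -> smooth_on (chart_cod c) (fun y => X c y 0 i * vol c y).
Proof.
move=> Sc k; apply: (@Ck_onM _ _ _ _ (fun y => X c y 0 i)); first exact: chart_cod_open.
  by apply: Ck_on_coord; [exact: chart_cod_open|exact: vf_smooth].
exact: vol_smooth.
Qed.

Lemma lie_vol_smooth c : atlas S c -> smooth_on (chart_cod c) (lie_vol c).
Proof.
move=> Sc k; apply: Ck_on_sum; first exact: chart_cod_open.
by move=> i; have [_ +] := vf_vol_smooth i Sc k.+1; apply.
Qed.

Lemma lie_vol_continuous c x : atlas S c -> chart_cod c x -> {for x, continuous (lie_vol c)}.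
Proof. by move=> Sc cx; have := lie_vol_smooth Sc 0%N => /=; apply. Qed.

Lemma lie_real_out f (K : set M) p : closed K -> (forall q, ~ K q -> f q = 0) -> ~ K p ->
  L f p = 0.
Proof.
move=> cK fK nKp; rewrite -(lie_real_cst X 0 p); apply: lie_real_near.
by apply: (open_near (closed_openC cK) (nKp : (~` K) p)) => q /fK.
Qed.

(** The Euclidean divergence of the vector function f vol X is the sum of the two integrands, and
    compact support gives it the integral 0. *)
Lemma stokes_chart c f (K : set M) : atlas S c -> smooth_real S f -> compact K ->
  K `<=` chart_dom c -> (forall p, ~ K p -> f p = 0) ->
  chart_int c (fun x => L f (chart_bwd c x) * vol c x) =
  - chart_int c (fun x => f (chart_bwd c x) * lie_vol c x).
Proof.
move=> Sc sf cK KD fK; have [cK' K'c] := chart_image_compact cK KD.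
have oc := @chart_cod_open _ _ _ c.
pose phi i y := f (chart_bwd c y) * (X c y 0 i * vol c y).
have phi0 i x : chart_cod c x -> ~ (chart_fwd c @` K) x -> phi i x = 0.
  move=> cx nK; rewrite /phi fK ?mul0r// => Kx; apply: nK; exists (chart_bwd c x) => //.
  exact: chart_bwdK.
have C1 i : Ck_on (chart_cod c) 1 (phi i).
  by apply: (@Ck_onM _ _ _ _ (f \o chart_bwd c)) => //; [exact: sf|exact: vf_vol_smooth].
have I i := int_zero_ext_partial oc cK' K'c (phi0 i) (C1 i) i.
have cf := smooth_real_continuous sf.
have C2 : Cc (zero_ext (chart_cod c) (fun x => f (chart_bwd c x) * lie_vol c x)).
  by apply: (@Cc_chart _ _ _ c f (lie_vol c) K) => // x; exact: lie_vol_continuous.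
rewrite /chart_int -int_rVN//.
have I0 : \sum_i int_rV (zero_ext (chart_cod c) (partial i (phi i))) = 0.
  by apply: big1 => i _; have [] := I i.
rewrite -[RHS]addr0 -I0.
rewrite -int_rV_sum; last by move=> i; have [] := I i.
rewrite -int_rVD; [|exact: CcN|by apply: Cc_sum => i; have [] := I i].
congr int_rV; apply/funext => x; have [cx|ncx] := pselect (chart_cod c x); last first.
  by rewrite !zero_ext_out// oppr0 add0r big1// => i _; rewrite zero_ext_out.
rewrite !zero_ext_in//; under eq_bigr do rewrite zero_ext_in//.
have dfx : differentiable (f \o chart_bwd c) x by exact: (smooth_real_differentiable sf Sc cx).
have dX i : differentiable (fun y => X c y 0 i * vol c y) x.
  by have [+ _] := vf_vol_smooth i Sc 1%N; apply.
rewrite (lie_real_chart X sf Sc cx) derive_partial// /lie_vol mulr_suml [f _ * _]mulr_sumr.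
rewrite -sumrN -big_split/=; apply: eq_bigr => i _.
have -> : partial i (phi i) x = f (chart_bwd c x) * partial i (fun y => X c y 0 i * vol c y) x +
    (X c x 0 i * vol c x) * partial i (f \o chart_bwd c) x.
  rewrite /partial (@deriveM _ _ (f \o chart_bwd c) (fun y => X c y 0 i * vol c y))//.
    exact: diff_derivable.
  exact: diff_derivable.
by rewrite addrA addNr add0r mulrAC.
Qed.

Let rdiv c p := lie_vol c (chart_fwd c p) / vol c (chart_fwd c p).

Let rdiv_continuous c p : atlas S c -> chart_dom c p -> {for p, continuous (rdiv c)}.
Proof.
move=> Sc cp; have cx := chart_fwd_cod cp.
apply: (@cont_comp_at _ _ _ (chart_fwd c) (fun x => lie_vol c x / vol c x)).
  exact: chart_fwd_cont.
apply: contM_at; first exact: lie_vol_continuous.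
rewrite /prop_for /continuous_at.
have cv : vol c y @[y --> chart_fwd c p] --> vol c (chart_fwd c p) by exact: vol_continuous.
by apply: cvgV cv; exact: vol_neq0.
Qed.

(** Two charts of the atlas may agree in orientation on one part of a disconnected overlap and
    disagree on another, so the sign of the Jacobian determinant is fixed only near [p]. *)
Lemma det_sign c d p : atlas S c -> atlas S d -> chart_dom c p -> chart_dom d p ->
  exists2 s : R, s != 0 & exists V : set M, [/\ open V, V p &
    forall x, overlap c d x -> V (chart_bwd c x) ->
      `|\det ('J (transition c d) x)| = s * \det ('J (transition c d) x)].
Proof.
move=> Sc Sd cp dp; pose x0 := chart_fwd c p.
have ox0 : overlap c d x0.
  by split; [exact: chart_fwd_cod|rewrite /= chart_fwdK].
pose D x := \det ('J (transition c d) x); have D0 : D x0 != 0 := det_transition_neq0 Sc Sd ox0.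
have cD : {for x0, continuous D}.
  exact: (det_jacobian_continuous (@overlap_open _ _ _ c d) (transition_smooth Sc Sd 1%N) ox0).
pose s := Num.sg (D x0); have s1 : `|s| = 1 by rewrite /s normr_sg D0.
have s0 : s != 0 by rewrite -normr_eq0 s1 oner_eq0.
have csD : s * D z @[z --> x0] --> s * D x0 by apply: cvgM cD; exact: cvg_cst.
have sD0 : 0 < s * D x0 by rewrite /s -normrEsg normr_gt0.
exists s => //; pose W := interior [set z | 0 < s * D z].
exists (chart_dom c `&` chart_fwd c @^-1` W); split.
- exact/chart_image_open/open_interior.
- by split=> //; move/cvgr_gt: csD; exact.
- move=> x [cx dx] [_]; rewrite /= (chart_bwdK cx) => /interior_subset sD.
  by rewrite -[LHS]mul1r -s1 -normrM; apply: gtr0_norm; exact: sD.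
Qed.

Let rdiv_alg (a r s v t : R) : t * (a * r * v - a * (s * v)) = a * (t * (r - s) * v).
Proof. by ring. Qed.

Let sign_alg (t s a b e l gc lc : R) : 0 < t * (a - b) -> s * gc = a -> gc = lc ->
  s * e = l -> e = - lc -> l = - b -> False.
Proof.
move=> h h1 h2 h3 h4 h5; suff E : a = b by move: h; rewrite E subrr mulr0 ltxx.
by apply: oppr_inj; rewrite -h5 -h3 h4 mulrN -h1 h2.
Qed.

(* Both sides have the same integral against every bump, by [stokes_chart] and the
   change of variables; this avoids differentiating Jacobian determinants. *)
Let rdiv_eq c d p : atlas S c -> oriented O d -> chart_dom c p -> chart_dom d p ->
  rdiv c p = rdiv d p.
Proof.
move=> Sc Od cp dp; have Sd := oriented_atlas Od.
apply/eqP; apply: contraT => ne; exfalso.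
have [s s0 [V [oV Vp sV]]] := det_sign Sc Sd cp dp.
(* Multiplying the difference by its own value at [p] makes it positive near [p], whichever sign it
   has. *)
pose t := rdiv c p - rdiv d p.
pose u q := t * (rdiv c q - rdiv d q).
have cu : {for p, continuous u}.
  apply: (@contM_at _ _ (fun=> t)); first by apply: cont_cst.
  by apply: contB_at; apply: rdiv_continuous.
have up : 0 < u p by rewrite /u -expr2 exprn_even_gt0//= subr_eq0.
pose U := V `&` interior [set q | [/\ chart_dom c q, chart_dom d q & 0 < u q]].
have oU : open U by apply: openI => //; exact: open_interior.
have Up : U p.
  split=> //; apply: filterS3 (open_nbhs_nbhs (conj (@chart_dom_open _ _ _ c) cp))
    (open_nbhs_nbhs (conj (@chart_dom_open _ _ _ d) dp)) (_ : nbhs p [set q | 0 < u q]) => //.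
  by have cu' : u q @[q --> p] --> u p := cu; move/cvgr_gt: cu'; apply.
have [chi [K [schi chi0 chip cK [KU chiK]]]] := chart_bump M_hausdorff Sc cp oU Up.
have KP q : K q -> [/\ chart_dom c q, chart_dom d q & 0 < u q].
  by move=> /KU[[_ /interior_subset]].
have KV q : K q -> V q by move=> /KU[[]].
have KDc : K `<=` chart_dom c by move=> q /KP[].
have KDd : K `<=` chart_dom d by move=> q /KP[].
have clK : closed K by exact: compact_closedM.
have cchi := smooth_real_continuous schi.
(* Against the reference density in [c], the function [g] integrates like [chi] against [lie_vol c].
   In [d] the corresponding integrals differ strictly, since [chi] lives where [u] is positive. *)
pose g := zero_ext (chart_dom c) (fun q => chi q * rdiv c q).
have cg : continuous g.
  apply: (zero_ext_continuous (@chart_dom_open _ _ _ c) clK _ _ KDc).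
    by move=> q dq; apply: contM_at; [exact: cchi|exact: rdiv_continuous].
  by move=> q _ nKq; rewrite chiK ?mul0r.
have gK q : ~ K q -> g q = 0.
  by move=> nK; rewrite /g /zero_ext; case: ifP => // _; rewrite chiK ?mul0r.
have rv e x : atlas S e -> chart_cod e x -> rdiv e (chart_bwd e x) * vol e x = lie_vol e x.
  by move=> Se ex; rewrite /rdiv (chart_bwdK ex); apply: divfK; exact: vol_neq0.
have E3 : chart_int c (fun x => g (chart_bwd c x) * vol c x) =
    chart_int c (fun x => chi (chart_bwd c x) * lie_vol c x).
  congr int_rV; apply/funext => x; have [dx|ndx] := pselect (chart_cod c x); last first.
    by rewrite !(zero_ext_out _ ndx).
  rewrite !(zero_ext_in _ dx) /g (zero_ext_in _ (chart_bwd_dom dx)) -mulrA.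
  by congr (_ * _); exact: rv.
have c1 : Cc (zero_ext (chart_cod d) (fun x => g (chart_bwd d x) * vol d x)).
  by apply: (@Cc_chart _ _ _ d g (vol d) K) => // x; exact: vol_continuous.
have c2 : Cc (zero_ext (chart_cod d) (fun x => chi (chart_bwd d x) * lie_vol d x)).
  by apply: (@Cc_chart _ _ _ d chi (lie_vol d) K) => // x; exact: lie_vol_continuous.
have kE x : chart_cod d x ->
    t * (zero_ext (chart_cod d) (fun x => g (chart_bwd d x) * vol d x) x -
    zero_ext (chart_cod d) (fun x => chi (chart_bwd d x) * lie_vol d x) x) =
    chi (chart_bwd d x) * (u (chart_bwd d x) * vol d x).
  move=> dx; rewrite !(zero_ext_in _ dx).
  have [Kx|nKx] := pselect (K (chart_bwd d x)); last by rewrite chiK// gK// !mul0r subrr mulr0.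
  rewrite /g (zero_ext_in _ (KDc _ Kx)) -(rv d x Sd dx); exact: rdiv_alg.
have PI : 0 < t * (chart_int d (fun x => g (chart_bwd d x) * vol d x) -
    chart_int d (fun x => chi (chart_bwd d x) * lie_vol d x)).
  rewrite /chart_int -(int_rVB c1 c2) -(int_rVZ t (CcB c1 c2)).
  apply: (int_rV_pos (CcZ t (CcB c1 c2)) _).2.
    move=> x; have [cx|ncx] := pselect (chart_cod d x).
      rewrite kE//; have [Kx|nKx] := pselect (K (chart_bwd d x)); last by rewrite chiK// mul0r.
      have [_ _ u0] := KP _ Kx; exact: (mulr_ge0 (chi0 _) (ltW (mulr_gt0 u0 (vol_gt0 P Od cx)))).
    by rewrite !(zero_ext_out _ ncx) subrr mulr0.
  have dx := chart_fwd_cod dp; exists (chart_fwd d p); rewrite (kE _ dx) (chart_fwdK dp).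
  exact: (mulr_gt0 chip (mulr_gt0 up (vol_gt0 P Od dx))).
have ch f : continuous f -> (forall q, ~ K q -> f q = 0) ->
    s * chart_int c (fun x => f (chart_bwd c x) * vol c x) =
    chart_int d (fun x => f (chart_bwd d x) * vol d x).
  move=> cf fK; apply: (@chart_int_change _ _ _ S O P c d s f K Sc Sd cf cK _ fK).
    by move=> q Kq; split; [exact: KDc|exact: KDd].
  by move=> x ox Kx; apply: sV => //; exact: KV.
have E1 := ch _ (lie_real_continuous (X := X) schi) (fun q => @lie_real_out _ K q clK chiK).
have E2 := ch _ cg gK.
have S1 := stokes_chart Sc schi cK KDc chiK.
have S2 := stokes_chart Sd schi cK KDd chiK.
exact: (sign_alg PI E2 E3 E1 S1 S2).
Qed.

(** An oriented chart is selected because [rdiv_eq] compares a chart of the atlas with an oriented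
    one. *)
Definition divergence (p : M) : R :=
  let c := sval (cid2 (oriented_cover O p)) in
  lie_vol c (chart_fwd c p) / vol c (chart_fwd c p).

Lemma divergenceE c p : atlas S c -> chart_dom c p ->
  divergence p = lie_vol c (chart_fwd c p) / vol c (chart_fwd c p).
Proof.
by move=> Sc cp; rewrite /divergence; case: cid2 => d Od dp /=; apply/esym/rdiv_eq.
Qed.

Lemma divergence_smooth : smooth_real S divergence.
Proof.
apply: smooth_real_local => p; have [c Oc cp] := oriented_cover O p.
have Sc := oriented_atlas Oc; have oc := @chart_cod_open _ _ _ c.
exists c, (chart_cod c); split=> //; first exact: chart_fwd_cod.
move=> k; have H : Ck_on (chart_cod c) k ((lie_vol c : 'rV[R]_n -> R) \* (fun x => (vol c x)^-1)).
  apply: (Ck_onM oc (lie_vol_smooth Sc k)).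
  have v0 x : chart_cod c x -> [set y : R | y != 0] (vol c x) by exact: vol_neq0.
  have := Ck_on_comp1 0 oc (@smooth_seq_inv R) v0 (vol_smooth P Sc k).
  by apply: (eq_Ck_on oc) => x cx; rewrite /= expr0 fact0 expr1 !mul1r.
apply: (eq_Ck_on oc _ H) => x cx /=.
by rewrite (divergenceE Sc (chart_bwd_dom cx)) (chart_bwdK cx).
Qed.

Lemma stokes f : smooth_real S f ->
  vol_int (L f) = - vol_int (fun p => f p * divergence p).
Proof.
move=> sf; pose pf (j : 'I_(pu_size P)) p := pu_fun j p * f p.
have spf j : smooth_real S (pf j) by apply: smooth_realM => //; exact: pu_smooth.
have cpf j := smooth_real_continuous (spf j).
have cdiv := smooth_real_continuous divergence_smooth.
have fE q : f q = \sum_j pf j q by rewrite -mulr_suml pu_sum mul1r.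
have -> : L f = fun p => \sum_j L (pf j) p.
  by apply/funext => p; rewrite -lie_real_sum//; congr lie_real; apply/funext.
have vsum (F : 'I_(pu_size P) -> M -> R) : (forall j, continuous (F j)) ->
    vol_int (fun p => \sum_j F j p) = \sum_j vol_int (F j).
  move=> cF; have H (s : seq 'I_(pu_size P)) : continuous (fun p => \sum_(j <- s) F j p) /\
      vol_int (fun p => \sum_(j <- s) F j p) = \sum_(j <- s) vol_int (F j).
    elim: s => [|j s [IH1 IH2]].
      under eq_fun do rewrite big_nil; rewrite big_nil; split; first exact: cont_cst.
      have := @vol_intZ _ _ _ S O M_compact P 0 (fun=> 0) (@cont_cst _ _ 0).
      by rewrite mul0r [RHS]mul0r.
    under eq_fun do rewrite big_cons; rewrite big_cons -IH2; split; first exact: contD.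
    exact: vol_intD.
  by have [] := H (index_enum _).
rewrite vsum; last by move=> j; exact: lie_real_continuous.
have -> : (fun p => f p * divergence p) = fun p => \sum_j (pf j p * divergence p).
  by apply/funext => p; rewrite -mulr_suml -fE.
rewrite vsum; last by move=> j; exact: contM.
rewrite -sumrN; apply: eq_bigr => j _.
pose c := pu_chart j; pose K := closure [set q | pu_fun j q != 0].
have Oc := pu_oriented j; have Sc := pu_atlas j.
have cK : compact K by exact: pu_supp_compact.
have clK : closed K by exact: closed_closure.
have KD : K `<=` chart_dom c by exact: pu_support.
have pK q : ~ K q -> pf j q = 0 by move=> nK; rewrite /pf pu_out ?mul0r.
rewrite (@vol_int_local _ _ _ S O M_hausdorff M_compact P c (L (pf j)) K)//; last 2 first.
- exact: lie_real_continuous.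
- by move=> q nK; exact: (lie_real_out clK pK).
rewrite (@vol_int_local _ _ _ S O M_hausdorff M_compact P c (fun p => pf j p * divergence p) K)//; last 2 first.
- exact: contM.
- by move=> q nK; rewrite pK ?mul0r.
rewrite (stokes_chart Sc (spf j) cK KD pK); congr (- _).
congr int_rV; apply/funext => x; have [cx|ncx] := pselect (chart_cod c x); last first.
  by rewrite !zero_ext_out.
rewrite !zero_ext_in// (divergenceE Sc); last exact: chart_bwd_dom.
by rewrite chart_bwdK// -mulrA divfK// vol_neq0.
Qed.
End Divergence.

(** * Smooth n-forms as densities *)

Section ComplexParts.
Local Open Scope complex_scope.
Context {R : realType}.
Implicit Types z w : R[i].

Lemma complex_ReD z w : complex.Re (z + w) = complex.Re z + complex.Re w.
Proof. by case: z w => [a b] [c d]. Qed.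

Lemma complex_ImD z w : complex.Im (z + w) = complex.Im z + complex.Im w.
Proof. by case: z w => [a b] [c d]. Qed.

Lemma complex_ReN z : complex.Re (- z) = - complex.Re z. Proof. by case: z. Qed.

Lemma complex_ImN z : complex.Im (- z) = - complex.Im z. Proof. by case: z. Qed.

Lemma complex_ReM z w : complex.Re (z * w) =
  complex.Re z * complex.Re w - complex.Im z * complex.Im w.
Proof. by case: z w => [a b] [c d]. Qed.

Lemma complex_ImM z w : complex.Im (z * w) =
  complex.Re z * complex.Im w + complex.Im z * complex.Re w.
Proof. by case: z w => [a b] [c d]. Qed.

Lemma complex_ext z w : complex.Re z = complex.Re w -> complex.Im z = complex.Im w -> z = w.
Proof. by case: z w => [a b] [c d] /= -> ->. Qed.

Lemma sum_complex (I : Type) (s : seq I) (a b : I -> R) :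
  \sum_(i <- s) (a i +i* b i) = (\sum_(i <- s) a i) +i* (\sum_(i <- s) b i).
Proof.
by elim: s => [|i s IH]; rewrite ?big_nil// !big_cons IH; apply: complex_ext; rewrite /= ?complex_ReD ?complex_ImD.
Qed.

Lemma norm_complex_le z : `|z| <= (`|complex.Re z| + `|complex.Im z|)%:C.
Proof.
case: z => a b; rewrite normc_def /=; rewrite lecR -[leRHS]ger0_norm ?addr_ge0// -sqrtr_sqr.
rewrite ler_sqrt ?sqr_ge0// sqrrD !real_normK ?num_real//.
by rewrite lerD2r lerDl mulrn_wge0// mulr_ge0.
Qed.
End ComplexParts.

Section Densities.
Local Open Scope complex_scope.
Context {R : realType} {n : nat} {M : topologicalType}.
Variables (S : @smooth_structure R n M) (O : orientation S).
Hypotheses (M_hausdorff : hausdorff_space M) (M_compact : compact [set: M]).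
Notation chart := (@chart R n M).
Implicit Types (c d : chart) (f g h : M -> R[i]).

Lemma Cinf_eq (f g : Cinf S) : (forall p, f p = g p) -> f = g.
Proof. by move=> fg; apply: val_inj; apply/funext. Qed.

Lemma smooth_complex_mem f : smooth_complex S f -> (f : M -> R[i]^o) \in smooth_pred S.
Proof. by move=> sf; apply/asboolP. Qed.

Section Fixed.
Variable P : partition_of_unity O.
Notation vol := (vol P).
Notation vol_int := (vol_int P).

Definition cvol_int f : R[i] :=
  vol_int (@complex.Re R \o f) +i* vol_int (@complex.Im R \o f).

Let vol_form_coef (h : M -> R[i]) c x := h (chart_bwd c x) * (vol c x)%:C.

Lemma vol_form_smooth h c : smooth_complex S h -> atlas S c ->
  smooth_on (chart_cod c) (@complex.Re R \o vol_form_coef h c) /\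
  smooth_on (chart_cod c) (@complex.Im R \o vol_form_coef h c).
Proof.
move=> [sr si] Sc; have oc := @chart_cod_open _ _ _ c.
split=> k.
  apply: (eq_Ck_on oc _ (Ck_onM oc (sr c Sc k) (vol_smooth P Sc k))) => x _.
  by rewrite /= /vol_form_coef complex_ReM /= mulr0 subr0.
apply: (eq_Ck_on oc _ (Ck_onM oc (si c Sc k) (vol_smooth P Sc k))) => x _.
by rewrite /= /vol_form_coef complex_ImM /= mulr0 add0r.
Qed.

Let change_alg (z : R[i]) (a b c : R) : a = b * c -> z * a%:C = b%:C * (z * c%:C).
Proof. by move=> ->; rewrite rmorphM/= mulrCA. Qed.

Lemma vol_form_change h c d x : atlas S c -> atlas S d -> overlap c d x ->
  vol_form_coef h c x =
  (\det ('J (transition c d) x))%:C * vol_form_coef h d (transition c d x).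
Proof.
move=> Sc Sd ox; rewrite /vol_form_coef (chart_bwd_transition ox).
by apply: change_alg; exact: vol_change.
Qed.

Definition vol_form (h : Cinf S) : nform S :=
  NForm (fun c Sc => vol_form_smooth (cinf_smooth h) Sc)
        (@vol_form_change (h : M -> R[i])).

Let ratio_alg (a b : R) (z v : R[i]) : a != 0 -> b != 0 -> v * b%:C = z ->
  (a%:C * z) / (a * b)%:C = v.
Proof.
move=> a0 b0 <-; rewrite rmorphM/= [v * _]mulrC mulrA mulrC mulKf//.
by rewrite mulf_neq0// (inj_eq (@complexI R)).
Qed.

(** The coefficients of [w] and of the reference form change by the same Jacobian determinant, so
    their quotient is a function on the manifold. *)
Lemma nform_density (w : nform S) : exists h : Cinf S, forall c x, atlas S c ->
  chart_cod c x -> w c x = h (chart_bwd c x) * (vol c x)%:C.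
Proof.
pose h0 p := let d := chart_at S p in w d (chart_fwd d p) / (vol d (chart_fwd d p))%:C.
have v0 c x : atlas S c -> chart_cod c x -> (vol c x)%:C != 0.
  by move=> Sc cx; rewrite (inj_eq (@complexI R)); exact: vol_neq0.
have hE c x : atlas S c -> chart_cod c x -> h0 (chart_bwd c x) = w c x / (vol c x)%:C.
  move=> Sc cx; rewrite /h0; set d := chart_at S _.
  have Sd : atlas S d := chart_at_atlas S _.
  have dx : chart_dom d (chart_bwd c x) := chart_at_dom S _.
  have ox : overlap c d x by split.
  have ox' := (transition_overlap ox).1.
  rewrite (nf_change w Sc Sd ox) (vol_change P Sc Sd ox); apply: esym.
  apply: (ratio_alg (det_transition_neq0 Sc Sd ox) (vol_neq0 P Sd ox')).
  by rewrite divfK//; exact: v0.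
have rV a : (a%:C)^-1 = a^-1%:C :> R[i] by rewrite fmorphV.
have vi c k : atlas S c -> Ck_on (chart_cod c) k (fun x => (vol c x)^-1).
  move=> Sc; have u0 x : chart_cod c x -> [set y : R | y != 0] (vol c x) by exact: vol_neq0.
  have := Ck_on_comp1 0 (@chart_cod_open _ _ _ c) (@smooth_seq_inv R) u0 (vol_smooth P Sc k).
  apply: (eq_Ck_on (@chart_cod_open _ _ _ c)) => x cx.
  by rewrite /= expr0 fact0 expr1 !mul1r.
have sh : smooth_complex S h0.
  split=> c Sc k; have [wr wi] := nf_smooth w Sc; have oc := @chart_cod_open _ _ _ c.
    apply: (eq_Ck_on oc _ (Ck_onM oc (wr k) (vi c k Sc))) => x cx.
    by rewrite /= hE// rV complex_ReM /= mulr0 subr0.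
  apply: (eq_Ck_on oc _ (Ck_onM oc (wi k) (vi c k Sc))) => x cx.
  by rewrite /= hE// rV complex_ImM /= mulr0 add0r.
exists (MkCinf (smooth_complex_mem sh)) => c x Sc cx.
by rewrite /= hE// divfK//; exact: v0.
Qed.

Lemma int_partition_density (h : Cinf S) f (w : chart -> 'rV[R]_n -> R[i]) :
  (forall c x, atlas S c -> chart_cod c x -> w c x = h (chart_bwd c x) * (vol c x)%:C) ->
  int_partition P (fun c x => f (chart_bwd c x) * w c x) = cvol_int (fun p => f p * h p).
Proof.
move=> wE; rewrite /int_partition /cvol_int sum_complex !vol_intE; congr (_ +i* _).
all: apply: eq_bigr => j _; congr int_rV; apply/funext => x.
all: have [cx|ncx] := pselect (chart_cod (pu_chart j) x).
2,4: by rewrite /= (zero_ext_out _ ncx) memNset.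
all: rewrite /= (zero_ext_in _ cx) mem_set// wE//; last exact: pu_atlas.
all: rewrite [f _ * (_ * _)]mulrA; set z := (f _ * h _).
  by rewrite complex_ReM complex_ReM complex_ImM /= !mulr0 !mul0r !subr0 mulrA.
by rewrite complex_ImM complex_ReM complex_ImM /= !mulr0 !mul0r addr0 add0r mulrA.
Qed.
End Fixed.

(** The partition returned is the one selected inside [int_nform], so that no comparison of two
    partitions arises. *)
Lemma smooth_distP : exists P : partition_of_unity O, forall U : Cinf S -> R[i]^o,
  smooth_dist O U <-> exists h : Cinf S, U = fun u : Cinf S => cvol_int P (fun p => u p * h p).
Proof.
have ex := partition_of_unity_exists O M_hausdorff M_compact.
have [P PE] : exists P : partition_of_unity O, forall w, int_nform O w = int_partition P w.
  rewrite /int_nform; case: pselect => [e|/(_ ex)//]; by exists (sval (cid e)).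
exists P => U; split.
  move=> [w _ <-]; have [h hw] := nform_density P w; exists h.
  by apply/funext => f; rewrite /nform_dist PE; exact: int_partition_density.
move=> [h ->]; exists (vol_form P h) => //.
by apply/funext => f; rewrite /nform_dist PE; exact: int_partition_density.
Qed.
End Densities.

(** * The Hahn-Banach theorem *)

Section HahnBanach.
Context {R : realType} {V : lmodType R}.
Implicit Types (p q : V -> R) (u v : V) (W : set (V * R)).

(** Homogeneity is asked as an inequality; applying it to the inverse factor gives the equality. *)
Definition sublinear p := [/\ p 0 = 0, forall u v, p (u + v) <= p u + p v &
  forall a u, 0 < a -> p (a *: u) <= a * p u].

(** A pair (x, r) in [W] prescribes the bound r <= L x on the functional to be found. *)
Definition cone W := [/\ W (0, 0),
  forall x y, W x -> W y -> W (x.1 + y.1, x.2 + y.2) &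
  forall a x, 0 < a -> W x -> W (a *: x.1, a * x.2)].

Lemma sublinear_ge p v : sublinear p -> - p (- v) <= p v.
Proof.
by move=> [p0 pD _]; have := pD v (- v); rewrite subrr p0 => h; lra.
Qed.

(* The infimal convolution of [p] with the functional carried by the cone [W]. *)
Lemma sublinear_cone p W : sublinear p -> cone W -> (forall x, W x -> x.2 <= p x.1) ->
  exists q, [/\ sublinear q, forall v, q v <= p v & forall x, W x -> q (- x.1) <= - x.2].
Proof.
move=> [p0 pD pZ] [W0 WD WZ] Wp.
pose E v := [set p (v + x.1) - x.2 | x in W]; pose q v := inf (E v).
have E0 v : E v !=set0 by exists (p (v + 0) - 0), (0, 0).
have Elb v : lbound (E v) (- p (- v)).
  move=> _ [x Wx <-]; have := pD (v + x.1) (- v); rewrite addrAC subrr add0r => h.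
  by have := Wp x Wx; lra.
have qle v x : W x -> q v <= p (v + x.1) - x.2.
  by move=> Wx; apply: ge_inf; [exists (- p (- v))|exists x].
have qge v (b : R) : (forall x, W x -> b <= p (v + x.1) - x.2) -> b <= q v.
  by move=> h; apply: lb_le_inf => // _ [x Wx <-]; exact: h.
have qp v : q v <= p v by have := qle v (0, 0) W0; rewrite /= addr0 subr0.
exists q; split=> //; last first.
  by move=> x Wx; have := qle (- x.1) x Wx; rewrite addNr p0 sub0r.
split.
- apply/eqP; rewrite eq_le -{1}p0 qp/=.
  by apply: lb_le_inf => //; have := Elb 0; rewrite oppr0 p0 oppr0.
- move=> u v; rewrite -lerBlDr; apply: (qge _ _) => x Wx; rewrite lerBlDr -lerBlDl.
  apply: (qge _ _) => y Wy; have := qle (u + v) _ (WD _ _ Wx Wy) => /=; rewrite addrACA.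
  by have := pD (u + x.1) (v + y.1); lra.
- move=> a u a0; rewrite mulrC -ler_pdivrMr//; apply: (qge _ _) => x Wx.
  rewrite ler_pdivrMr//; apply: le_trans (qle _ _ (WZ a x a0 Wx)) _ => /=.
  by rewrite -scalerDr; have := pZ a (u + x.1) a0; lra.
Qed.

(** Zorn's lemma for the reversed order. A chain is bounded by its pointwise infimum, which is
    finite because every sublinear s below p satisfies s v >= - p (- v). *)
Lemma sublinear_minimal p : sublinear p -> exists q, [/\ sublinear q, forall v, q v <= p v &
  forall q', sublinear q' -> (forall v, q' v <= q v) -> q' = q].
Proof.
move=> sp; pose T := {q : V -> R | sublinear q /\ forall v, q v <= p v}.
have [||||[q [sq qp]] qmin] := @Zorn T (fun s t => `[< forall v, sval t v <= sval s v >]).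
- by move=> t; apply/asboolP.
- by move=> r s t /asboolP rs /asboolP st; apply/asboolP => v; exact: le_trans (st v) (rs v).
- move=> [s ps] [t pt] /asboolP/= st /asboolP/= ts; apply: eq_exist => //=.
  by apply/funext => v; apply/eqP; rewrite eq_le st ts.
- move=> A tA; have [[a Aa]|nA] := pselect (exists a, A a); last first.
    by exists (exist _ p (conj sp (fun=> lexx _))) => s As; case: nA; exists s.
  pose E v := [set sval s v | s in A]; pose q v := inf (E v).
  have E0 v : E v !=set0 by exists (sval a v), a.
  have qle v s : A s -> q v <= sval s v.
    move=> As; apply: ge_inf; last by exists s.
    exists (- p (- v)) => _ [[r [sr rp]] Ar <-] /=.
    by apply: le_trans (sublinear_ge v sr); rewrite lerN2.
  have qge v (b : R) : (forall s, A s -> b <= sval s v) -> b <= q v.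
    by move=> h; apply: lb_le_inf => // _ [s As <-]; exact: h.
  have sq : sublinear q.
    split.
    - apply/eqP; rewrite eq_le; apply/andP; split.
        by have := qle 0 a Aa; case: (svalP a) => [[-> _ _] _].
      by apply: (qge _ _) => s As; case: (svalP s) => [[-> _ _] _].
    - move=> u v; rewrite -lerBlDr; apply: (qge _ _) => s As; rewrite lerBlDr -lerBlDl.
      apply: (qge _ _) => t At; rewrite lerBlDl.
      have [/asboolP st|/asboolP ts] := tA _ _ As At.
        apply: le_trans (qle _ _ At) _; case: (svalP t) => [[_ + _] _].
        by move=> /(_ u v)/le_trans; apply; rewrite lerD2r.
      apply: le_trans (qle _ _ As) _; case: (svalP s) => [[_ + _] _].
      by move=> /(_ u v)/le_trans; apply; rewrite lerD2l.
    - move=> b u b0; rewrite mulrC -ler_pdivrMr//; apply: (qge _ _) => s As.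
      rewrite ler_pdivrMr//; apply: le_trans (qle _ _ As) _.
      by case: (svalP s) => [[_ _ +] _] => /(_ b u b0); rewrite mulrC.
  have qp v : q v <= p v.
    by apply: le_trans (qle v a Aa) _; case: (svalP a).
  by exists (exist _ q (conj sq qp)) => s As; apply/asboolP => v /=; exact: qle.
exists q; split=> // q' sq' q'q.
have q'p v : q' v <= p v by exact: le_trans (q'q v) (qp v).
have := qmin (exist _ q' (conj sq' q'p)); rewrite asboolE/= => /(_ q'q).
by move=> /(congr1 sval).
Qed.

(** A minimal sublinear functional is linear: lowering it along the ray of any [w] by
    [sublinear_cone] changes nothing, which gives q (- w) = - q w and then additivity. The cone is
    absorbed beforehand, and its bounds persist below the functional so obtained. *)
Theorem hahn_banach p W : sublinear p -> cone W -> (forall x, W x -> x.2 <= p x.1) ->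
  exists L : {linear V -> R^o}, (forall v, L v <= p v) /\ forall x, W x -> x.2 <= L x.1.
Proof.
move=> sp cW Wp; have [p1 [sp1 p1p Wp1]] := sublinear_cone sp cW Wp.
have [q [sq qp qmin]] := sublinear_minimal sp1.
have [q0 qD qZ] := sq.
have qN w : q (- w) = - q w.
  apply/eqP; rewrite eq_le; apply/andP; split; last first.
    by have := sublinear_ge w sq; rewrite lerNl.
  pose W1 := [set x | exists2 t : R, 0 <= t & x = (t *: w, t * q w)].
  have qZ0 t : 0 <= t -> t * q w <= q (t *: w).
    rewrite le_eqVlt => /predU1P[<-|t0]; first by rewrite mul0r scale0r q0.
    have := qZ t^-1 (t *: w); rewrite invr_gt0 => /(_ t0).
    by rewrite scalerA mulVf ?gt_eqF// scale1r mulrC ler_pdivlMr// mulrC.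
  have [||q1 [sq1 q1q W1q]] := @sublinear_cone q W1 sq.
  - split.
    + by exists 0 => //; rewrite scale0r mul0r.
    + move=> _ _ [s s0 ->] [t t0 ->]; exists (s + t); first exact: addr_ge0.
      by rewrite scalerDl mulrDl.
    + move=> a _ a0 [t t0 ->]; exists (a * t); first by rewrite mulr_ge0// ltW.
      by rewrite scalerA mulrA.
  - by move=> _ [t t0 ->]; exact: qZ0.
  rewrite -{1}(qmin q1 sq1 q1q); apply: (W1q (w, q w)).
  by exists 1 => //; rewrite scale1r mul1r.
have qA u v : q (u + v) = q u + q v.
  apply/eqP; rewrite eq_le qD/=; have := qD (- u) (- v).
  by rewrite -opprD !qN; lra.
have qM a u : 0 < a -> q (a *: u) = a * q u.
  move=> a0; apply/eqP; rewrite eq_le qZ//=; have := qZ a^-1 (a *: u).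
  rewrite invr_gt0 => /(_ a0).
  by rewrite scalerA mulVf ?gt_eqF// scale1r mulrC ler_pdivlMr// mulrC.
have qL : linear (q : V -> R^o).
  move=> a u v; rewrite qA; congr (_ + _); have [a0|a0|->] := ltgtP a 0.
  - by rewrite -[a]opprK scaleNr qN qM ?oppr_gt0// scaleNr.
  - by rewrite qM.
  - by rewrite !scale0r q0.
pose L := GRing.isLinear.Build _ _ _ _ (q : V -> R^o) qL.
exists (HB.pack_for {linear V -> R^o} (q : V -> R^o) L); split=> [v|x Wx] /=.
  exact: le_trans (qp v) (p1p v).
by have := Wp1 x Wx; have := qp (- x.1); rewrite qN; lra.
Qed.
End HahnBanach.

(** * Distributions and real functionals *)

Section IterPartial.
Context {R : realType} {n : nat}.
Implicit Types (D : set 'rV[R]_n) (f g : 'rV[R]_n -> R) (s : seq 'I_n).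

Lemma smooth_on_partial D f i : smooth_on D f -> smooth_on D (partial i f).
Proof. by move=> sf k; have [_ +] := sf k.+1; apply. Qed.

Lemma smooth_on_iter_partial D f s : smooth_on D f -> smooth_on D (iter_partial s f).
Proof. by move=> sf; elim: s => //= i s; exact: smooth_on_partial. Qed.

Lemma smooth_on_derivable D f x v : smooth_on D f -> D x -> derivable f x v.
Proof. by move=> sf Dx; apply: diff_derivable; have [+ _] := sf 1%N; apply. Qed.

Lemma smooth_on_continuous D f x : smooth_on D f -> D x -> {for x, continuous f}.
Proof. by move=> sf Dx; have := sf 0%N => /=; apply. Qed.

Lemma iter_partialD D f g s x : open D -> smooth_on D f -> smooth_on D g -> D x ->
  iter_partial s (fun y => f y + g y) x = iter_partial s f x + iter_partial s g x.
Proof.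
move=> oD sf sg; elim: s x => //= i s IH x Dx; rewrite /partial -/(iter_partial s _).
rewrite (@near_eq_derive _ _ _ _ (iter_partial s f \+ iter_partial s g)); last first.
  exact: (open_near oD Dx).
by rewrite deriveD//; apply: (@smooth_on_derivable D) => //; exact: smooth_on_iter_partial.
Qed.

Lemma iter_partialZ D (a : R) f s x : open D -> smooth_on D f -> D x ->
  iter_partial s (fun y => a * f y) x = a * iter_partial s f x.
Proof.
move=> oD sf; elim: s x => //= i s IH x Dx; rewrite /partial -/(iter_partial s _).
rewrite (@near_eq_derive _ _ _ _ (a \*: (iter_partial s f : 'rV[R]_n -> R^o))); last first.
  exact: (open_near oD Dx).
by rewrite deriveZ//; apply: (@smooth_on_derivable D) => //; exact: smooth_on_iter_partial.
Qed.

Lemma eq_iter_partial D f g s x : open D -> (forall y, D y -> f y = g y) -> D x ->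
  iter_partial s f x = iter_partial s g x.
Proof.
move=> oD fg; elim: s x => [|i s IH] x Dx /=; first exact: fg.
by apply: near_eq_derive; exact: (open_near oD Dx).
Qed.
End IterPartial.

(** * Real smooth functions and complexified functionals *)

Section RealSmoothFunctions.
Local Open Scope complex_scope.
Context {R : realType} {n : nat} {M : topologicalType}.
Variable S : @smooth_structure R n M.
Notation chart := (@chart R n M).

Definition rsmooth_pred : {pred M -> R^o} := [pred f | `[< smooth_real S f >]].

Lemma rsmooth_submod_closed : submod_closed rsmooth_pred.
Proof.
split; first by apply/asboolP; exact: smooth_real_cst.
move=> a f g /asboolP sf /asboolP sg; apply/asboolP.
by apply: (smooth_realD _ sg); exact: smooth_realZ.
Qed.

HB.instance Definition _ :=
  GRing.isSubmodClosed.Build _ _ rsmooth_pred rsmooth_submod_closed.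

(** The real vector space on which Hahn-Banach operates. It is given no topology of its own:
    continuity of functionals is expressed by [rdist]. *)
Record Rinf := MkRinf { rinf_fun :> M -> R^o; _ : rinf_fun \in rsmooth_pred }.

HB.instance Definition _ := [isSub for rinf_fun].
HB.instance Definition _ := [Choice of Rinf by <:].
HB.instance Definition _ := [SubChoice_isSubLmodule of Rinf by <:].

Lemma rinf_smooth (f : Rinf) : smooth_real S f.
Proof. by apply/asboolP; exact: (valP f). Qed.

Lemma rsmooth_mem (f : M -> R) : smooth_real S f -> (f : M -> R^o) \in rsmooth_pred.
Proof. by move=> sf; apply/asboolP. Qed.

Definition to_rinf (f : M -> R) (sf : smooth_real S f) : Rinf := MkRinf (rsmooth_mem sf).

Lemma rinf_eq (f g : Rinf) : (forall p, f p = g p) -> f = g.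
Proof. by move=> fg; apply: val_inj; apply/funext. Qed.

Lemma rinfZE (a : R) (f : Rinf) p : (a *: f) p = a * f p. Proof. by []. Qed.
Lemma rinfDE (f g : Rinf) p : (f + g) p = f p + g p. Proof. by []. Qed.
Lemma rinfNE (f : Rinf) p : (- f) p = - f p. Proof. by []. Qed.

Definition lie_rinf (X : vector_field S) (f : Rinf) : Rinf :=
  to_rinf (lie_real_smooth X (rinf_smooth f)).

Lemma lie_rinf_linear X (a : R) (f g : Rinf) :
  lie_rinf X (a *: f + g) = a *: lie_rinf X f + lie_rinf X g.
Proof.
apply: rinf_eq => p /=; have sf := rinf_smooth f; have sg := rinf_smooth g.
by rewrite (@lie_realD _ _ _ _ _ (fun q => a * f q) g p (smooth_realZ a sf) sg) lie_realZ.
Qed.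

Definition cre (f : Cinf S) : Rinf := to_rinf (cinf_smooth f).1.
Definition cim (f : Cinf S) : Rinf := to_rinf (cinf_smooth f).2.

Lemma complex_of_smooth (f g : Rinf) : smooth_complex S (fun p => f p +i* g p).
Proof. by split; exact: rinf_smooth. Qed.

Definition to_cinf (f g : Rinf) : Cinf S := MkCinf (smooth_complex_mem (complex_of_smooth f g)).

Lemma cre_linear (a b : R) (f g : Cinf S) :
  cre ((a +i* b) *: f + g) = a *: cre f - b *: cim f + cre g.
Proof. apply: rinf_eq => p; transitivity (complex.Re ((a +i* b) * f p + g p)) => //.
by rewrite complex_ReD complex_ReM. Qed.

Lemma cim_linear (a b : R) (f g : Cinf S) :
  cim ((a +i* b) *: f + g) = a *: cim f + b *: cre f + cim g.
Proof. apply: rinf_eq => p; transitivity (complex.Im ((a +i* b) * f p + g p)) => //.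
by rewrite complex_ImD complex_ImM. Qed.

Definition rsmall (F : set (chart * set 'rV[R]_n * seq 'I_n)) (e : R) (f : M -> R) :=
  forall t x, F t -> t.1.2 x -> `|iter_partial t.2 (f \o chart_bwd t.1.1) x| < e.

(* Continuity for the topology of [Cinf], restricted to real functions. *)
Definition rdist (L : Rinf -> R) := exists F e,
  [/\ finite_set F, F `<=` cinf_index S, 0 < e & forall f : Rinf, rsmall F e f -> `|L f| <= 1].

Section Complexify.
Variable L : {linear Rinf -> R^o}.

Definition complexify (f : Cinf S) : R[i]^o := L (cre f) +i* L (cim f).

Lemma complexify_linear : linear complexify.
Proof.
move=> [a b] f g; rewrite /complexify cre_linear cim_linear.
have LZ (c : R) h : L (c *: h) = c * L h by rewrite linearZ.
rewrite !raddfD raddfN /= !LZ.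
by apply: complex_ext; rewrite /= ?complex_ReD ?complex_ImD ?complex_ReM ?complex_ImM.
Qed.

HB.instance Definition _ := GRing.isLinear.Build _ _ _ _ complexify complexify_linear.

Lemma complexify_to_cinf (f : Rinf) : complexify (to_cinf f 0) = (L f)%:C.
Proof.
apply: complex_ext => /=; first by congr (L _); exact: rinf_eq.
by rewrite -(linear0 L); congr (L _); exact: rinf_eq.
Qed.

Lemma complexify_continuous : rdist L -> continuous complexify.
Proof.
move=> [F [e [Ff FI e0 FL]]] f; have FF : Filter (cinf_nbhs f) by apply: cinf_nbhs_filter.
apply/cvgrPdist_lt => -[r r'].
(* A positive element of R[i] has imaginary part 0. The factor 1/4 leaves at most r / 2 for the real
   and imaginary parts together. *)
rewrite ltcE/= => /andP[/eqP -> r0]; exists F, (e * (r / 4)); split=> //.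
  by rewrite mulr_gt0// divr_gt0.
have small (u v : Rinf) : (forall t x, F t -> t.1.2 x ->
    `|iter_partial t.2 (u \o chart_bwd t.1.1) x - iter_partial t.2 (v \o chart_bwd t.1.1) x|
      < e * (r / 4)) -> `|L u - L v| <= r / 4.
  move=> uv; suff : `|L ((4 / r) *: (u - v))| <= 1.
    rewrite linearZ linearB/= [_ *: _]/(_ * _) normrM ger0_norm; last by rewrite divr_ge0// ltW.
    by rewrite mulrC -ler_pdivlMr ?divr_gt0// mul1r invf_div.
  apply: FL => t x Ft Kx; have [St _ KD] := FI t Ft.
  have oc := @chart_cod_open _ _ _ t.1.1; have cx := KD _ Kx.
  have su := rinf_smooth u St; have sv := rinf_smooth v St.
  have sNv : smooth_on (chart_cod t.1.1) (fun y => (-1) * (v \o chart_bwd t.1.1) y).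
    exact: (smooth_realZ (-1) (rinf_smooth v) St).
  have suv : smooth_on (chart_cod t.1.1) (fun y => (u \o chart_bwd t.1.1) y +
      (-1) * (v \o chart_bwd t.1.1) y).
    by move=> k; apply: Ck_onD.
  rewrite (@eq_iter_partial _ _ (chart_cod t.1.1) _ (fun y => (4 / r) *
    ((u \o chart_bwd t.1.1) y + (-1) * (v \o chart_bwd t.1.1) y)))//; last first.
    by move=> y _; rewrite mulN1r.
  rewrite (iter_partialZ _ _ oc)// (iter_partialD _ oc)// (iter_partialZ _ _ oc)// mulN1r.
  rewrite normrM ger0_norm; last by rewrite divr_ge0// ltW.
  by rewrite mulrC -ltr_pdivlMr ?divr_gt0// invf_div; exact: uv.
move=> g fg /=.
have -> : complexify f - complexify g =
    (L (cre f) - L (cre g)) +i* (L (cim f) - L (cim g)).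
  by apply: complex_ext.
apply: le_lt_trans (norm_complex_le _) _; rewrite ltcR /=.
have h1 : `|L (cre f) - L (cre g)| <= r / 4 by apply: small => t x Ft Kx; have [] := fg t Ft x Kx.
have h2 : `|L (cim f) - L (cim g)| <= r / 4 by apply: small => t x Ft Kx; have [] := fg t Ft x Kx.
by lra.
Qed.
End Complexify.
End RealSmoothFunctions.

(** * Chart balls and finite families of seminorms *)

Section ChartBalls.
Context {R : realType} {n : nat} {M : topologicalType}.
Variable S : @smooth_structure R n M.
Notation cat := (chart_at S).

Lemma cball_exists p : exists r : R, 0 < r /\
  forall x, `|x - chart_fwd (cat p) p| <= r -> chart_cod (cat p) x.
Proof.
have cx : chart_cod (cat p) (chart_fwd (cat p) p) by apply: chart_fwd_cod; exact: chart_at_dom.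
have := open_nbhs_nbhs (conj (@chart_cod_open _ _ _ (cat p)) cx).
move=> /nbhs_ballP[r /= r0 rP]; exists (r / 2); split=> [|x xr]; first exact: divr_gt0.
apply: rP; rewrite -ball_normE /= distrC; apply: le_lt_trans xr _.
by rewrite ltr_pdivrMr// ltr_pMr// ltr1n.
Qed.

Definition crad p : R := sval (cid (cball_exists p)).
Definition cball p : set 'rV[R]_n := [set x | `|x - chart_fwd (cat p) p| <= crad p].
(** The open ball pulled back to the manifold: these sets serve for coverings, while seminorms are
    taken on the closed balls [cball p]. *)
Definition copen p : set M :=
  chart_dom (cat p) `&` chart_fwd (cat p) @^-1` [set x | `|x - chart_fwd (cat p) p| < crad p].

Lemma crad_gt0 p : 0 < crad p. Proof. by rewrite /crad; case: cid => r []. Qed.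

Lemma cball_sub p : cball p `<=` chart_cod (cat p).
Proof. by rewrite /cball /crad; case: cid => r [/= _ h] x /h. Qed.

Lemma cball_compact p : compact (cball p). Proof. exact: closed_ball_rV_compact. Qed.

Lemma oball_open p : open [set x : 'rV[R]_n | `|x - chart_fwd (cat p) p| < crad p].
Proof.
rewrite (_ : [set _ | _] = ball (chart_fwd (cat p) p) (crad p)); first exact: ball_open.
by rewrite -ball_normE; apply/seteqP; split=> x /=; rewrite distrC.
Qed.

Lemma copen_open p : open (copen p).
Proof. by apply: chart_image_open; exact: oball_open. Qed.

Lemma copen_self p : copen p p.
Proof. by split; [exact: chart_at_dom|rewrite /= subrr normr0 crad_gt0]. Qed.

Lemma copen_cball p q : copen p q -> cball p (chart_fwd (cat p) q).
Proof. by move=> [_ /ltW]. Qed.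

(** When the sets [copen p], for [p] in [s], cover the manifold, these indices define a C^k norm. *)
Definition ball_index (s : seq M) (k : nat) : set (@chart R n M * set 'rV[R]_n * seq 'I_n) :=
  [set t | exists p l, [/\ p \in s, (size l <= k)%N & t = (cat p, cball p, l)]].

Lemma ball_index_cinf s k : ball_index s k `<=` cinf_index S.
Proof.
move=> _ [p [l [_ _ ->]]]; split=> /=; first exact: chart_at_atlas.
  exact: cball_compact.
exact: cball_sub.
Qed.

Lemma finite_ball_index s k : finite_set (ball_index s k).
Proof.
have fl : finite_set [set l : seq 'I_n | (size l <= k)%N].
  elim: k => [|k IH].
    by apply: (sub_finite_set _ (finite_set1 [::])) => -[|//].
  have -> : [set l : seq 'I_n | (size l <= k.+1)%N] = [::] |`
      [set i :: l | i in [set: 'I_n] & l in [set l | (size l <= k)%N]].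
    apply/seteqP; split=> [[|i l] /= h|l [->//|[i _ [l' /= h <-]]]]; first by left.
      by right; exists i => //; exists l.
    by [].
  rewrite finite_setU; split=> //; apply: finite_image2 => //; exact: finite_finset.
have := finite_image2 (fun p l => (cat p, cball p, l)) (finite_seq s) fl.
apply: sub_finite_set => _ [p [l [ps lk ->]]] /=.
by exists p => //; exists l.
Qed.

Hypothesis M_compact : compact [set: M].

Lemma copen_cover : exists s : seq M, forall q, exists2 p, p \in s & copen p q.
Proof.
have [s sP] := finite_subcover M_compact
  (fun p _ => open_nbhs_nbhs (conj (@copen_open p) (copen_self p))).
by exists s => q; exact: sP.
Qed.

(** By compactness, finitely many seminorms of order 0 on chart balls dominate the supremum norm. *)
Lemma sup_rdist (L : Rinf S -> R) (C : R) :
  (forall (f : Rinf S) B, (forall p, `|f p| <= B) -> `|L f| <= C * B) -> rdist L.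
Proof.
move=> LC; have [s sP] := copen_cover.
have e0 : 0 < (`|C| + 1)^-1 by rewrite invr_gt0 ltr_wpDl.
exists (ball_index s 0), (`|C| + 1)^-1; split=> //.
- exact: finite_ball_index.
- exact: ball_index_cinf.
move=> f fe; apply: le_trans (LC f (`|C| + 1)^-1 _) _ => [p|].
  have [q qs pq] := sP p; have [cp _] := pq.
  have := fe (cat q, cball q, [::]) (chart_fwd (cat q) p).
  rewrite /= chart_fwdK// => h; apply/ltW/h; last exact: copen_cball.
  by exists q, [::].
rewrite ler_pdivrMr ?ltr_wpDl// mul1r; have := ler_norm C; lra.
Qed.
End ChartBalls.

(** * Reduction of the three conditions to real functionals *)

Section RealReduction.
Local Open Scope complex_scope.
Context {R : realType} {n : nat} {M : topologicalType}.
Variables (S : @smooth_structure R n M) (O : orientation S) (X : vector_field S).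
Hypotheses (M_hausdorff : hausdorff_space M) (M_compact : compact [set: M]).
Variable P : partition_of_unity O.
Hypothesis smooth_distE : forall U : Cinf S -> R[i]^o,
  smooth_dist O U <-> exists h : Cinf S, U = fun u : Cinf S => cvol_int P (fun p => u p * h p).
Notation vol_int := (vol_int P).

Lemma vol_int0 : vol_int (fun=> 0) = 0.
Proof.
by have := @vol_intZ _ _ _ S O M_compact P 0 (fun=> 0) (@cont_cst _ _ 0); rewrite mul0r [RHS]mul0r.
Qed.

(** The real counterpart of membership in [smooth_dist]. *)
Definition vrep (L : Rinf S -> R) := exists2 h : M -> R, smooth_real S h &
  forall f : Rinf S, L f = vol_int (fun p => f p * h p).

Lemma smooth_dist_vrep (L : {linear Rinf S -> R^o}) :
  smooth_dist O (complexify L) -> vrep L.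
Proof.
move=> /smooth_distE[h Lh]; exists (@complex.Re R \o h) => [|f].
  exact: (cinf_smooth h).1.
have := congr1 (fun U : Cinf S -> R[i]^o => complex.Re (U (to_cinf f 0))) Lh.
rewrite complexify_to_cinf /= => ->; congr vol_int; apply/funext => p /=.
by rewrite complex_ReM /= mul0r subr0.
Qed.

(** The equation for [L] says that its Lie derivative is the smooth form k vol; the minus sign is
    that of [lie_dist]. The field being real, the complexification satisfies the same equation. *)
Lemma GH_real (L : {linear Rinf S -> R^o}) k : globally_hypoelliptic O X -> rdist L ->
  smooth_real S k -> (forall f, L (lie_rinf X f) = - vol_int (fun p => f p * k p)) -> vrep L.
Proof.
move=> GH dL sk Lk; apply: smooth_dist_vrep; apply: GH.
  exact: complexify_continuous.
apply/smooth_distE; exists (to_cinf (to_rinf sk) 0); apply/funext => f.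
have E g h : smooth_real S g -> (forall p, h p = g p * k p) ->
    - (- vol_int (fun p => g p * k p)) = vol_int h.
  by move=> _ hE; rewrite opprK; congr vol_int; apply/funext.
rewrite /lie_dist /= /complexify.
have -> : cre (lie X f) = lie_rinf X (cre f) by exact: rinf_eq.
have -> : cim (lie X f) = lie_rinf X (cim f) by exact: rinf_eq.
rewrite !Lk; apply: complex_ext => /=; rewrite ?complex_ReN ?complex_ImN /=; apply: E.
- exact: (cinf_smooth f).1.
- by move=> p; rewrite /= complex_ReM /= mulr0 subr0.
- exact: (cinf_smooth f).2.
- by move=> p; rewrite /= complex_ImM /= mulr0 add0r.
Qed.

Lemma GH_invariant (L : {linear Rinf S -> R^o}) : globally_hypoelliptic O X -> rdist L ->
  (forall f, L (lie_rinf X f) = 0) -> vrep L.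
Proof.
move=> GH dL L0; apply: (@GH_real L (fun=> 0) GH dL) => [|f]; first exact: smooth_real_cst.
rewrite L0 -[LHS]oppr0 -[in LHS]vol_int0; congr (- vol_int _); apply/funext => p.
by rewrite mulr0.
Qed.

Lemma invariant_vrep (L : {linear Rinf S -> R^o}) :
  (forall U, invariant_dist X U -> smooth_dist O U) -> rdist L ->
  (forall f, L (lie_rinf X f) = 0) -> vrep L.
Proof.
move=> INV dL L0; apply: smooth_dist_vrep; apply: INV; split.
  exact: complexify_continuous.
move=> f; rewrite /lie_dist /= /complexify.
have -> : cre (lie X f) = lie_rinf X (cre f) by exact: rinf_eq.
have -> : cim (lie X f) = lie_rinf X (cim f) by exact: rinf_eq.
by rewrite !L0; apply: complex_ext; rewrite /= oppr0.
Qed.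

Definition real_cohomology_free := forall f, smooth_real S f ->
  exists (a : R) u, smooth_real S u /\ forall p, lie_real X u p = f p - a.

Lemma real_cohomology_freeP : cohomology_free X <-> real_cohomology_free.
Proof.
split=> [CF f sf|CF f].
  have [a [u uP]] := CF (to_cinf (to_rinf sf) 0).
  exists (complex.Re a), (cre u); split; first exact: rinf_smooth.
  by move=> p; have := congr1 (@complex.Re R) (uP p); rewrite complex_ReD complex_ReN.
have [a [u [su uP]]] := CF _ (cinf_smooth f).1.
have [b [v [sv vP]]] := CF _ (cinf_smooth f).2.
exists (a +i* b), (to_cinf (to_rinf su) (to_rinf sv)) => p.
by apply: complex_ext => /=; rewrite ?complex_ReD ?complex_ReN ?complex_ImD ?complex_ImN; [exact: uP|exact: vP].
Qed.
End RealReduction.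

(** * Invariant densities *)

Section InvariantDensities.
Context {R : realType} {n : nat} {M : topologicalType}.
Variables (S : @smooth_structure R n M) (O : orientation S) (X : vector_field S).
Hypotheses (M_hausdorff : hausdorff_space M) (M_compact : compact [set: M]).
Variable P : partition_of_unity O.
Notation vol_int := (vol_int P).
Notation L := (lie_real X).
Notation smooth := (smooth_real S).
Implicit Types (f g h : M -> R) (p q : M).

Lemma continuous_attains_max f (K : set M) : continuous f -> closed K -> K !=set0 ->
  exists2 p, K p & forall q, K q -> f q <= f p.
Proof.
move=> cf cK K0; have cK' : compact K by exact: closed_compactM.
have [p Kp pP] := compact_EVT_max K0 cK' (continuous_subspaceT cf).
by exists p => [|q Kq]; [rewrite inE in Kp|apply: pP; rewrite inE].
Qed.

Lemma continuous_attains_min f (K : set M) : continuous f -> closed K -> K !=set0 ->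
  exists2 p, K p & forall q, K q -> f p <= f q.
Proof.
move=> cf cK K0; have cNf : continuous (fun q => - f q) by move=> q; apply: cvgN; exact: cf.
by have [p Kp pP] := continuous_attains_max cNf cK K0; exists p => // q /pP; rewrite lerN2.
Qed.

Lemma continuous_bounded f : continuous f -> exists B, forall p, `|f p| <= B.
Proof.
move=> cf; have [[p0 _]|M0] := pselect (exists p : M, True); last first.
  by exists 0 => p; case: M0; exists p.
have cn : continuous (fun q => `|f q|) by exact: cont_norm.
have [p _ pP] := continuous_attains_max cn closedT (ex_intro _ p0 I).
by exists `|f p| => q; exact: pP.
Qed.

Lemma positive_open f : continuous f -> open [set p | 0 < f p].
Proof.
move=> cf; rewrite (_ : [set _ | _] = f @^-1` [set r | 0 < r])//.
by apply: open_comp; [move=> p _; exact: cf|exact: open_gt].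
Qed.

Lemma zeros_closed f : continuous f -> closed [set p | f p = 0].
Proof.
move=> cf; rewrite (_ : [set _ | _] = f @^-1` [set 0])//.
by apply: closed_comp; [move=> p _; exact: cf|exact: closed_eq].
Qed.

Lemma bump_neg h (V : set M) p : continuous h -> open V -> V p -> h p < 0 ->
  exists chi, [/\ smooth chi, forall q, 0 <= chi q, forall q, ~ V q -> chi q = 0 &
    vol_int (fun q => chi q * h q) < 0].
Proof.
move=> ch oV Vp hp; have [c Sc cp] := atlas_cover S p.
pose U := V `&` [set q | 0 < - h q].
have cNh : continuous (fun q => - h q) by move=> q; apply: cvgN; exact: ch.
have oU : open U by apply: openI => //; exact: positive_open.
have Up : U p by split=> //=; rewrite oppr_gt0.
have [chi [K [schi chi0 chip cK [KU chiK]]]] := chart_bump M_hausdorff Sc cp oU Up.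
have out q : ~ U q -> chi q = 0 by move=> nU; apply: chiK => /KU[].
exists chi; split=> // [q nV|]; first by apply: out => -[].
have cchi := smooth_real_continuous schi.
have [|_ +] := @vol_int_pos _ _ _ S O M_compact P (fun q => chi q * - h q) (contM cchi cNh).
  move=> q; have [[_ hq]|nU] := pselect (U q); last by rewrite out// mul0r.
  by apply: mulr_ge0 => //; exact: ltW.
have -> : vol_int (fun q => chi q * - h q) = - vol_int (fun q => chi q * h q).
  rewrite -mulN1r -vol_intZ//; last exact: contM.
  by congr vol_int; apply/funext => q; rewrite mulrN mulN1r.
rewrite oppr_gt0; apply; exists p; apply: mulr_gt0 => //; by rewrite oppr_gt0.
Qed.

(** The fundamental lemma of the calculus of variations: a bump placed where [h] has a strict sign
    gives a nonzero integral. *)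
Lemma vol_int_eq0 h : continuous h -> (forall f, smooth f -> vol_int (fun p => f p * h p) = 0) ->
  forall p, h p = 0.
Proof.
move=> ch h0 p; case: (ltgtP (h p) 0) => // hp.
  have [chi [schi _ _]] := bump_neg ch openT I hp; by rewrite h0// ltxx.
have cNh : continuous (fun q => - h q) by move=> q; apply: cvgN; exact: ch.
have hp' : - h p < 0 by rewrite oppr_lt0.
have [chi [schi _ _]] := bump_neg cNh openT I hp'.
have -> : (fun q => chi q * - h q) = fun q => (-1 * chi q) * h q.
  by apply/funext => q; rewrite mulrN mulN1r mulNr.
by rewrite (h0 (fun q => -1 * chi q)) ?ltxx//; exact: smooth_realZ.
Qed.

(* Minus the transpose of [lie_real X] with respect to [vol_int]. *)
Definition adj h p := L h p + h p * divergence P X p.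

Lemma adj_smooth h : smooth h -> smooth (adj h).
Proof.
move=> sh; apply: smooth_realD; first exact: lie_real_smooth.
by apply: smooth_realM => //; exact: divergence_smooth.
Qed.

Lemma vol_int_by_parts f h : smooth f -> smooth h ->
  vol_int (fun p => L f p * h p) = - vol_int (fun p => f p * adj h p).
Proof.
move=> sf sh; have sfh := smooth_realM sf sh.
have := stokes M_hausdorff M_compact P X sfh.
have -> : L (fun p => f p * h p) = fun p => f p * L h p + L f p * h p.
  by apply/funext => p; rewrite lie_realM// [h p * _]mulrC.
have cf := smooth_real_continuous sf; have ch := smooth_real_continuous sh.
have clf := smooth_real_continuous (lie_real_smooth X sf).
have clh := smooth_real_continuous (lie_real_smooth X sh).
have cd := smooth_real_continuous (divergence_smooth M_hausdorff P X).
rewrite vol_intD//; [|exact: contM|exact: contM] => E.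
have -> : (fun p => f p * adj h p) = fun p => f p * L h p + f p * h p * divergence P X p.
  by apply/funext => p; rewrite /adj mulrDr mulrA.
rewrite vol_intD//; [|exact: contM|by apply: contM => //; exact: contM].
by move: E; lra.
Qed.

Definition invariant_density h :=
  smooth h /\ forall f, smooth f -> vol_int (fun p => L f p * h p) = 0.

Lemma invariant_densityP h : smooth h -> invariant_density h <-> forall p, adj h p = 0.
Proof.
move=> sh; split=> [[_ hI]|h0].
  apply: vol_int_eq0; first exact: (smooth_real_continuous (adj_smooth sh)).
  by move=> f sf; have := hI f sf; rewrite vol_int_by_parts// => /eqP; rewrite oppr_eq0 => /eqP.
split=> // f sf; rewrite vol_int_by_parts// (_ : (fun p => _) = fun=> 0) ?vol_int0 ?oppr0//.
by apply/funext => p; rewrite h0 mulr0.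
Qed.

(** The cone is a subspace, each vector X g + t v carrying [t] as its bound. Both signs are
    available in a subspace, so the lower bounds become equalities. *)
Lemma coboundary_separation (s : Rinf S -> R) (v : Rinf S) : sublinear s ->
  (forall (g : Rinf S) (t : R), t <= s (lie_rinf X g + t *: v)) ->
  exists T : {linear Rinf S -> R^o},
    [/\ forall f : Rinf S, T f <= s f, forall g : Rinf S, T (lie_rinf X g) = 0 & T v = 1].
Proof.
move=> ss sv.
pose W := [set x : Rinf S * R | exists (g : Rinf S) (t : R), x = (lie_rinf X g + t *: v, t)].
have lin a (g g' : Rinf S) : lie_rinf X (a *: g + g') = a *: lie_rinf X g + lie_rinf X g'.
  exact: lie_rinf_linear.
have lin0 : lie_rinf X 0 = 0.
  by have := lin (-1) 0 0; rewrite scaler0 addr0 => ->; rewrite scaleN1r addNr.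
have [||T [Ts TW]] := @hahn_banach _ _ s W ss.
- split.
  + by exists 0, 0; rewrite lin0 scale0r addr0.
  + move=> _ _ [g [t ->]] [g' [t' ->]]; exists (g + g'), (t + t') => /=.
    by rewrite -[g in RHS]scale1r lin scale1r scalerDl addrACA.
  + move=> a _ a0 [g [t ->]]; exists (a *: g), (a * t) => /=.
    by rewrite -[a *: g in RHS]addr0 lin lin0 addr0 scalerDr scalerA.
- by move=> _ [g [t ->]]; exact: sv.
exists T; split=> // [g|].
  have ge0 (f : Rinf S) : 0 <= T (lie_rinf X f).
    by have := TW (lie_rinf X f + 0 *: v, 0) (ex_intro _ f (ex_intro _ 0 erefl));
      rewrite /= scale0r addr0.
  apply/eqP; rewrite eq_le ge0 andbT.
  have := ge0 (- g); have := lin (-1) g 0; rewrite addr0 lin0 addr0 !scaleN1r => ->.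
  by rewrite linearN oppr_ge0.
have h t : t <= T (t *: v).
  by have := TW (lie_rinf X 0 + t *: v, t) (ex_intro _ 0 (ex_intro _ t erefl));
    rewrite /= lin0 add0r.
apply/eqP; rewrite eq_le; have := h 1; rewrite scale1r => ->.
by have := h (-1); rewrite scaleN1r linearN lerN2 => ->.
Qed.

Hypothesis invariant_smooth : forall T : {linear Rinf S -> R^o}, rdist T ->
  (forall f : Rinf S, T (lie_rinf X f) = 0) -> vrep P T.

(* Hahn-Banach against [sup_Z]: the condition on [g] says that no derivative [X g]
   is bounded above by a negative constant on [Z]. *)
Lemma invariant_density_on (Z : set M) : Z !=set0 -> closed Z ->
  (forall g, smooth g -> exists2 z, Z z & 0 <= L g z) ->
  exists h, [/\ invariant_density h, forall p, 0 <= h p, forall p, ~ Z p -> h p = 0 &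
    vol_int h = 1].
Proof.
move=> Z0 cZ ZP; pose one := @to_rinf _ _ _ S (fun=> 1) (smooth_real_cst 1).
pose s (f : Rinf S) : R := sup [set f z | z in Z].
have bnd (f : Rinf S) := continuous_bounded (smooth_real_continuous (rinf_smooth f)).
have ub (f : Rinf S) : has_ubound [set f z | z in Z].
  have [B fB] := bnd f; exists B => _ [z _ <-]; exact: le_trans (ler_norm _) (fB z).
have le_s (f : Rinf S) z : Z z -> f z <= s f by move=> Zz; apply: ub_le_sup => //; exists z.
have s_le (f : Rinf S) B : (forall z, Z z -> f z <= B) -> s f <= B.
  move=> fB; apply: ge_sup; first by have [z Zz] := Z0; exists (f z), z.
  by move=> _ [z Zz <-]; exact: fB.
have ss : sublinear s.
  split.
  - apply/eqP; rewrite eq_le; apply/andP; split; first by apply: s_le.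
    by have [z Zz] := Z0; exact: (le_s 0 z Zz).
  - by move=> f g; apply: s_le => z Zz; rewrite rinfDE lerD// le_s.
  - by move=> a f a0; apply: s_le => z Zz; rewrite rinfZE ler_pM2l// le_s.
(* At a point of [Z] where X g >= 0 the function X g + t is at least t, so the supremum dominates
   t. *)
have [|T [Ts TX T1]] := @coboundary_separation s one ss.
  move=> g t /=; have [z Zz z0] := ZP g (rinf_smooth g).
  apply: le_trans (le_s _ z Zz); rewrite rinfDE rinfZE /= mulr1.
  by rewrite lerDr.
(* [T] lies between the infimum and the supremum over [Z]: it is positive and blind to functions
   vanishing on [Z]. *)
have Tle (f : Rinf S) B : (forall z, Z z -> f z <= B) -> T f <= B.
  by move=> fB; apply: le_trans (Ts f) (s_le _ _ fB).
have Tge (f : Rinf S) B : (forall z, Z z -> B <= f z) -> B <= T f.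
  move=> fB; rewrite -lerN2 -linearN; apply: Tle => z Zz.
  by rewrite rinfNE lerN2 fB.
have [|h sh Th] := invariant_smooth _ TX.
  apply: (@sup_rdist _ _ _ S M_compact _ 1) => f B fB; rewrite mul1r ler_norml.
  by apply/andP; split; [apply: Tge|apply: Tle] => z _; have := fB z; rewrite ler_norml => /andP[].
have ch := smooth_real_continuous sh.
have Tchi f (sf : smooth f) : vol_int (fun p => f p * h p) = T (to_rinf sf) by rewrite Th.
have h0 p : 0 <= h p.
  rewrite leNgt; apply/negP => hp.
  have [chi [schi chi0 _]] := bump_neg ch openT I hp.
  by rewrite (Tchi _ schi) ltNge Tge.
exists h; split=> //.
- split=> // f sf; have := TX (to_rinf sf); rewrite Th => <-.
  by [].
- move=> p nZ; apply/eqP; rewrite eq_le h0 andbT -oppr_ge0 leNgt; apply/negP => hp.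
  have cNh : continuous (fun q => - h q) by move=> q; apply: cvgN; exact: ch.
  have [chi [schi chi0 chiZ]] := bump_neg cNh (closed_openC cZ) nZ hp.
  have -> : (fun q => chi q * - h q) = fun q => (-1 * chi q) * h q.
    by apply/funext => q; rewrite mulrN mulN1r mulNr.
  have sN : smooth (fun q => -1 * chi q) by exact: smooth_realZ.
  rewrite (Tchi _ sN) ltNge Tge// => z Zz.
  by rewrite /= chiZ ?mulr0// => /(_ Zz).
- have := Th one; rewrite T1 => ->; congr vol_int; apply/funext => p.
  by rewrite /= mul1r.
Qed.

Lemma positive_invariant_density : (exists p : M, True) ->
  exists h, [/\ invariant_density h, forall p, 0 <= h p & vol_int h = 1].
Proof.
move=> [p0 _]; have [||g sg|h [hI h0 _ h1]] := @invariant_density_on setT.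
- by exists p0.
- exact: closedT.
- have [p _ pP] := continuous_attains_max (smooth_real_continuous sg) closedT (ex_intro _ p0 I).
  by exists p => //; rewrite lie_real_max// => q; exact: pP.
- by exists h.
Qed.

Hypothesis M_connected : connected [set: M].

Let LG_alg (a e d w l : R) : l + a * d = 0 -> a * (e * w) + e * l = a * e * (w - d).
Proof. by move=> /eqP; rewrite addr_eq0 => /eqP ->; ring. Qed.

Let uniq_alg (a b c d l l' : R) : l + b * d = 0 -> l' + c * d = 0 ->
  l' - a * l + (c - a * b) * d = 0.
Proof. by move=> /eqP; rewrite addr_eq0 => /eqP -> /eqP; rewrite addr_eq0 => /eqP ->; ring. Qed.

(* The flow is transversal to a level set of [f e^(lambda g)] when [X g < 0] on the
   boundary of [{f > 0}], and testing against a function of [f e^(lambda g)] shows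
   that this level set is empty. *)
Lemma support_boundary f g : invariant_density f -> (forall p, 0 <= f p) ->
  (exists p, 0 < f p) -> smooth g ->
  (forall p, f p = 0 -> closure [set q | 0 < f q] p -> L g p < 0) -> forall p, 0 < f p.
Proof.
move=> fI f0 [p1 fp1] sg gB; have sf := fI.1.
have cf := smooth_real_continuous sf; have cLg := lie_real_continuous (X := X) sg.
have sdiv := divergence_smooth M_hausdorff P X.
pose div := divergence P X; pose A := [set q | 0 < f q]; pose B := [set q | f q = 0] `&` closure A.
have cB : closed B by apply: closedI; [exact: zeros_closed|exact: closed_closure].
have [c c0 cP] : exists2 c : R, 0 < c & forall p, B p -> L g p < - c.
  have [B0|B0] := pselect (B !=set0); last by exists 1 => // p Bp; case: B0; exists p.
  have [p [fp Ap] pP] := continuous_attains_max cLg cB B0.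
  have h := gB p fp Ap; exists (- L g p / 2); first by lra.
  by move=> q /pP; lra.
have [D divD] := continuous_bounded (smooth_real_continuous sdiv).
have D0 : 0 <= D by apply: le_trans (normr_ge0 _) (divD p1).
(* With this exponent lam X g - div is at most -1 wherever X g < - c. *)
pose lam := (D + 1) / c; pose E q := expR (lam * g q).
have sE : smooth E.
  have := @smooth_real_comp _ _ _ S setT (fun=> expR) (fun q => lam * g q) 0%N
    (@smooth_seq_expR R) (fun=> I) (smooth_realZ lam sg).
  by [].
pose G q := f q * E q.
have sG : smooth G by exact: smooth_realM.
have E0 q : 0 < E q by exact: expR_gt0.
have LE q : L E q = E q * (lam * L g q).
  have := @lie_real_comp _ _ _ S X setT (fun=> expR) (fun q => lam * g q) 0%N q
    (@smooth_seq_expR R) (fun=> I) (smooth_realZ lam sg).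
  by rewrite lie_realZ.
have LG q : L G q = G q * (lam * L g q - div q).
  rewrite lie_realM// LE; have := (invariant_densityP sf).1 fI q; rewrite /adj /G -/div.
  exact: LG_alg.
have LG_lt q : 0 < f q -> L g q < - c -> L G q < 0.
  move=> fq gq; rewrite LG; have Gq : 0 < G q by rewrite mulr_gt0.
  rewrite pmulr_rlt0//; have := divD q; rewrite ler_norml -/div => /andP[d1 _].
  have : lam * L g q <= lam * - c.
    apply: ler_wpM2l; last exact: ltW.
    by apply: divr_ge0; [exact: addr_ge0|exact: ltW].
  have -> : lam * - c = - (D + 1) by rewrite mulrN divfK// gt_eqF.
  by lra.
(* [Q] is the part of the closure of {f > 0} where X g < - c fails. It avoids the zeros of [f], so
   [G] has a positive minimum [m] on it; where 0 < G < m, the function [G] decreases strictly along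
   the field. *)
pose Q := closure A `&` ~` [set q | 0 < - c - L g q].
have cLg' : continuous (fun q => - c - L g q) by apply: contB => //; exact: cont_cst.
have cQ : closed Q.
  by apply: closedI; [exact: closed_closure|apply: open_closedC; exact: positive_open].
have [m m0 mP] : exists2 m : R, 0 < m & forall q, 0 < f q -> G q < m -> L g q < - c.
  have notQ q : 0 < f q -> ~ Q q -> L g q < - c.
    move=> fq nQ; rewrite -subr_gt0; apply: contrapT => h; apply: nQ.
    by split=> //; exact: subset_closure.
  have [Q0|Q0] := pselect (Q !=set0); last first.
    by exists 1 => // q fq _; apply: notQ => // Qq; apply: Q0; exists q.
  have [p [Ap Np] pP] := continuous_attains_min (smooth_real_continuous sG) cQ Q0.
  exists (G p).
    rewrite mulr_gt0// lt_neqAle f0 andbT eq_sym; apply/negP => /eqP fp.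
    by apply: Np; rewrite /= subr_gt0; exact: cP.
  by move=> q fq Gq; apply: notQ => // /pP; rewrite leNgt Gq.
(* The test function is the flat function of m - G. Its derivative along the field is nonnegative on
   {f > 0} and positive where moreover G < m; as its integral against [f] is 0 by invariance, there
   is no such point. *)
pose psi k : R -> R := flat (iter k (fun r : {poly R} => 'X^2 * (r - r^`())) 1).
have psiS : smooth_seq setT psi by move=> k x _; exact: flat_derive.
pose h q := m - G q.
have sh : smooth h by apply: smooth_realB => //; exact: smooth_real_cst.
have Lh q : L h q = - L G q.
  by rewrite lie_realB ?lie_real_cst ?sub0r//; exact: smooth_real_cst.
have spsi := smooth_real_comp 0 psiS (fun=> I) sh.
have psi1 s : 0 < s -> 0 < psi 1%N s.
  move=> s0; rewrite /psi/= derivC subr0 mulr1 /flat s0 hornerXn.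
  by rewrite mulr_gt0 ?expR_gt0// exprn_gt0// invr_gt0.
have psi0 s : s <= 0 -> psi 1%N s = 0 by exact: flat_le0.
have intE q : L (psi 0%N \o h) q * f q = psi 1%N (h q) * (- L G q) * f q.
  by rewrite (lie_real_comp X 0 q psiS (fun=> I) sh) Lh.
have int_ge0 q : 0 <= L (psi 0%N \o h) q * f q /\
    (0 < f q -> G q < m -> 0 < L (psi 0%N \o h) q * f q).
  rewrite intE; have [fq|fq] := leP (f q) 0.
    have -> : f q = 0 by apply/eqP; rewrite eq_le fq f0.
    by rewrite mulr0 ltxx.
  have [Gq|Gq] := leP m (G q).
    by rewrite psi0 ?subr_le0// !mul0r.
  have h0 : 0 < psi 1%N (h q) * - L G q * f q.
    rewrite mulr_gt0// mulr_gt0//; first by apply: psi1; rewrite subr_gt0.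
    by rewrite oppr_gt0 LG_lt//; exact: mP.
  by split=> //; exact: ltW.
have cint : continuous (fun q => L (psi 0%N \o h) q * f q).
  by apply: contM => //; exact: lie_real_continuous.
have [_ ipos] := vol_int_pos M_compact P cint (fun q => (int_ge0 q).1).
have Gm q : 0 < f q -> m <= G q.
  move=> fq; rewrite leNgt; apply/negP => Gq.
  have : 0 < vol_int (fun q => L (psi 0%N \o h) q * f q).
    by apply: ipos; exists q; exact: (int_ge0 q).2.
  by rewrite fI.2// ltxx.
(* The open set {f > 0} is thus also closed, being {G >= m}. *)
have AE : A = [set q | m <= G q].
  apply/seteqP; split=> q /=; first exact: Gm.
  move=> mG; have : 0 < G q by exact: lt_le_trans mG.
  by rewrite pmulr_lgt0.
suff AT : A = setT by move=> p; have : setT p by []; rewrite -AT.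
apply: M_connected.
- by exists p1.
- by exists A; [exact: positive_open|rewrite setTI].
- exists A; rewrite ?setTI// AE -(setCK [set q | _]); apply: open_closedC.
  rewrite (_ : ~` _ = [set q | 0 < h q]); last first.
    by apply/seteqP; split=> q /=; rewrite subr_gt0 ltNge => /negP.
  by apply: positive_open; exact: smooth_real_continuous sh.
Qed.

Lemma invariant_density_gt0 f : invariant_density f -> (forall p, 0 <= f p) ->
  (exists p, 0 < f p) -> forall p, 0 < f p.
Proof.
move=> fI f0 fp; have cf := smooth_real_continuous fI.1.
have [[g [sg gB]]|nG] := pselect (exists g, smooth g /\
  forall p, f p = 0 -> closure [set q | 0 < f q] p -> L g p < 0).
  exact: support_boundary gB.
pose B := [set q | f q = 0] `&` closure [set q | 0 < f q].
have BP g : smooth g -> exists2 z, B z & 0 <= L g z.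
  move=> sg; apply: contrapT => nz; apply: nG; exists g; split=> // p fp0 Ap.
  by rewrite ltNge; apply/negP => gp; apply: nz; exists p.
have [||//|h [hI h0 hB h1]] := @invariant_density_on B.
- by have [z Bz _] := BP _ (smooth_real_cst 0); exists z.
- by apply: closedI; [exact: zeros_closed|exact: closed_closure].
have ch := smooth_real_continuous hI.1.
have [q hq] : exists q, 0 < h q.
  apply: contrapT => nh; have : vol_int h = 0.
    rewrite -(vol_int0 M_compact P); congr vol_int; apply/funext => q; apply/eqP.
    by rewrite eq_le h0 andbT leNgt; apply/negP => hq; apply: nh; exists q.
  by rewrite h1 => /eqP; rewrite oner_eq0.
have pB q' : 0 < h q' -> B q'.
  by move=> hq'; apply: contrapT => nB; move: hq'; rewrite hB ?ltxx.
have [fq Aq] := pB q hq.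
(* The open set {h > 0} contains a point of the closure of {f > 0}, hence meets {f > 0}; but it lies
   in [B], where [f] vanishes. *)
have [q' [Aq' hq']] := Aq _ (open_nbhs_nbhs (conj (positive_open ch) hq)).
by have [fq'] := pB q' hq'; move: Aq'; rewrite /= fq' ltxx.
Qed.

Lemma invariant_density_unique h f : invariant_density h -> (forall p, 0 < h p) ->
  invariant_density f -> exists a : R, forall p, f p = a * h p.
Proof.
move=> hI h0 fI; have [[p0 _]|M0] := pselect (exists p : M, True); last first.
  by exists 0 => p; case: M0; exists p.
have [sh _] := hI; have [sf _] := fI.
have hn0 p : h p != 0 by rewrite gt_eqF.
have cfh : continuous (fun p => f p * (h p)^-1).
  apply: contM; first exact: smooth_real_continuous sf.
  exact: (smooth_real_continuous (smooth_real_inv hn0 sh)).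
have [p _ pP] := continuous_attains_min cfh closedT (ex_intro _ p0 I).
pose a := f p / h p; exists a => q; pose k r := f r - a * h r.
have sk : smooth k by apply: smooth_realB => //; exact: smooth_realZ.
have kI : invariant_density k.
  apply/invariant_densityP => // r; rewrite /adj /k lie_realB//; last exact: smooth_realZ.
  rewrite lie_realZ//.
  exact: (uniq_alg _ ((invariant_densityP sh).1 hI r) ((invariant_densityP sf).1 fI r)).
have k0 r : 0 <= k r by rewrite subr_ge0 -ler_pdivlMr//; exact: pP.
have [[r kr]|nk] := pselect (exists r, 0 < k r).
  have := invariant_density_gt0 kI k0 (ex_intro _ r kr) p.
  by rewrite /k /a divfK// subrr ltxx.
apply/eqP; rewrite -subr_eq0 eq_le k0 andbT leNgt; apply/negP => kq.
by apply: nk; exists q.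
Qed.
End InvariantDensities.

(** * Cohomology-free vector fields *)

Lemma finite_uniform (R : realType) (T : Type) (F : set T) (Q : T -> R -> Prop) :
  finite_set F -> (forall t a b, a <= b -> Q t a -> Q t b) ->
  (forall t, F t -> exists B, Q t B) -> exists B, 0 <= B /\ forall t, F t -> Q t B.
Proof.
move=> /finite_setP[n /card_set_bijP[f [fF fi _]]] Qm FQ.
have H N : exists B, 0 <= B /\ forall t, F t -> (f t < N)%N -> Q t B.
  elim: N => [|N [B [B0 BP]]]; first by exists 0.
  have [[t0 [Ft0 ft0]]|nt] := pselect (exists t, F t /\ f t = N); last first.
    exists B; split=> // t Ft; rewrite ltnS leq_eqVlt => /predU1P[ft|]; last exact: BP.
    by case: nt; exists t.
  have [B1 B1P] := FQ t0 Ft0; exists (Num.max B B1); split=> [|t Ft].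
    by rewrite le_max B0.
  rewrite ltnS leq_eqVlt => /predU1P[ft|ft].
    have -> : t = t0 by apply: fi; rewrite ?inE// ft ft0.
    by apply: (Qm _ B1) => //; rewrite le_max lexx orbT.
  by apply: (Qm _ B); [rewrite le_max lexx|exact: BP].
have [B [B0 BP]] := H n; exists B; split=> // t Ft; apply: BP => //.
exact: fF.
Qed.

(** * Seminorms of a finite index set *)

Section Seminorm.
Context {R : realType} {n : nat} {M : topologicalType}.
Variable S : @smooth_structure R n M.
Variable F : set (@chart R n M * set 'rV[R]_n * seq 'I_n).
Hypotheses (finF : finite_set F) (FI : F `<=` cinf_index S).

(** The value 0 is adjoined so that the supremum is taken over a nonempty set even if [F] or its
    compact sets are empty. *)
Let vals (f : M -> R) : set R := [set r | r = 0 \/ exists t x, [/\ F t, t.1.2 x &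
  r = `|iter_partial t.2 (f \o chart_bwd t.1.1) x|]].

Definition seminorm (f : M -> R) : R := sup (vals f).

Lemma seminorm_ub f : smooth_real S f -> has_ubound (vals f).
Proof.
move=> sf; have [|t Ft|B [B0 BP]] := @finite_uniform R _ F (fun t B => forall x, t.1.2 x ->
  `|iter_partial t.2 (f \o chart_bwd t.1.1) x| <= B) finF.
- by move=> t a b ab h x /h /le_trans; apply.
- have [St cK KD] := FI Ft.
  have cf x : t.1.2 x -> {for x, continuous (iter_partial t.2 (f \o chart_bwd t.1.1))}.
    move=> /KD cx; apply: (smooth_on_continuous _ cx); apply: smooth_on_iter_partial.
    exact: sf.
  have [K0|K0] := pselect (t.1.2 !=set0); last by exists 0 => x Kx; case: K0; exists x.
  have cw : {within t.1.2, continuous (fun x => `|iter_partial t.2 (f \o chart_bwd t.1.1) x|)}.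
    apply: continuous_in_subspaceT => x; rewrite inE => Kx.
    exact: (cvg_norm (cf x Kx)).
  have [x _ xP] := compact_EVT_max K0 cK cw.
  by eexists => y Ky; apply: xP; rewrite inE.
- by exists B => _ [->//|[t [x [Ft Kx ->]]]]; exact: BP.
Qed.

Lemma seminorm_ge f t x : smooth_real S f -> F t -> t.1.2 x ->
  `|iter_partial t.2 (f \o chart_bwd t.1.1) x| <= seminorm f.
Proof. by move=> sf Ft Kx; apply: ub_le_sup; [exact: seminorm_ub|right; exists t, x]. Qed.

Lemma seminorm_ge0 f : smooth_real S f -> 0 <= seminorm f.
Proof. by move=> sf; apply: ub_le_sup; [exact: seminorm_ub|left]. Qed.

Lemma seminorm_le f B : 0 <= B -> (forall t x, F t -> t.1.2 x ->
  `|iter_partial t.2 (f \o chart_bwd t.1.1) x| <= B) -> seminorm f <= B.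
Proof.
move=> B0 fB; apply: ge_sup; first by exists 0; left.
by move=> _ [->//|[t [x [Ft Kx ->]]]]; exact: fB.
Qed.

Lemma seminormD f g : smooth_real S f -> smooth_real S g ->
  seminorm (fun p => f p + g p) <= seminorm f + seminorm g.
Proof.
move=> sf sg; apply: seminorm_le => [|t x Ft Kx]; first by rewrite addr_ge0 ?seminorm_ge0.
have [St cK KD] := FI Ft; have oc := @chart_cod_open _ _ _ t.1.1.
rewrite (iter_partialD t.2 oc (sf _ St) (sg _ St) (KD _ Kx)).
by apply: le_trans (ler_normD _ _) (lerD _ _); exact: seminorm_ge.
Qed.

Lemma seminormZ (a : R) f : smooth_real S f ->
  seminorm (fun p => a * f p) <= `|a| * seminorm f.
Proof.
move=> sf; apply: seminorm_le => [|t x Ft Kx]; first by rewrite mulr_ge0 ?seminorm_ge0.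
have [St cK KD] := FI Ft; have oc := @chart_cod_open _ _ _ t.1.1.
rewrite (iter_partialZ a t.2 oc (sf _ St) (KD _ Kx)) normrM.
by apply: ler_wpM2l => //; exact: seminorm_ge.
Qed.

Lemma seminorm_sublinear C : 0 <= C -> sublinear (fun f : Rinf S => C * seminorm f).
Proof.
move=> C0; split.
- have := seminormZ (0 : R) (rinf_smooth (0 : Rinf S)).
  rewrite normr0 mul0r (_ : (fun p => _) = (0 : Rinf S)); last by apply/funext => p; rewrite mul0r.
  have := seminorm_ge0 (rinf_smooth (0 : Rinf S)) => h1 h2.
  have -> : seminorm (0 : Rinf S) = 0 by apply/eqP; rewrite eq_le h1 h2.
  by rewrite mulr0.
- move=> f g; rewrite -mulrDr ler_wpM2l//.
  by apply: seminormD; exact: rinf_smooth.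
- move=> a f a0; rewrite mulrCA ler_wpM2l// -[a in leRHS]gtr0_norm//.
  by apply: seminormZ; exact: rinf_smooth.
Qed.

Lemma seminorm_rdist (L : {linear Rinf S -> R^o}) C : 0 <= C ->
  (forall f, L f <= C * seminorm f) -> rdist L.
Proof.
move=> C0 LC; have C1 : 0 < C + 1 by exact: ltr_wpDl.
exists F, (C + 1)^-1; split=> // [|f fe]; first by rewrite invr_gt0.
have H (g : Rinf S) : rsmall F (C + 1)^-1 g -> L g <= 1.
  move=> ge; apply: le_trans (LC g) _; apply: le_trans (_ : C * (C + 1)^-1 <= 1).
    apply: ler_wpM2l => //; apply: seminorm_le => [|t x Ft Kx].
      by rewrite invr_ge0 ltW.
    exact/ltW/ge.
  by rewrite ler_pdivrMr// mul1r lerDl.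
rewrite ler_norml H// andbT lerNl -linearN; apply: H => t x Ft Kx.
have [St cK KD] := FI Ft; have oc := @chart_cod_open _ _ _ t.1.1.
rewrite (@eq_iter_partial _ _ _ _ (fun y => -1 * (f \o chart_bwd t.1.1) y) _ _ oc _ (KD _ Kx)).
  rewrite (iter_partialZ _ _ oc _ (KD _ Kx)); last exact: (rinf_smooth f St).
  by rewrite mulN1r normrN; exact: fe.
by move=> y _; rewrite mulN1r.
Qed.
End Seminorm.

(** * Consequences of cohomology-freeness *)

Section CohomologyFree.
Local Open Scope complex_scope.
Context {R : realType} {n : nat} {M : topologicalType}.
Variables (S : @smooth_structure R n M) (O : orientation S) (X : vector_field S).
Hypotheses (M_hausdorff : hausdorff_space M) (M_compact : compact [set: M]).
Variable P : partition_of_unity O.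
Notation vol_int := (vol_int P).
Notation L := (lie_real X).
Notation smooth := (smooth_real S).
Notation invariant_density := (invariant_density X P).
Notation cint := (smooth_real_continuous (S := S)).
Implicit Types p q : M.

Lemma vol_intB (f g : M -> R) : continuous f -> continuous g ->
  vol_int (fun p => f p - g p) = vol_int f - vol_int g.
Proof.
move=> cf cg; rewrite -mulN1r -vol_intZ// -vol_intD//; last first.
  by apply: contM => //; exact: cont_cst.
by congr vol_int; apply/funext => p; rewrite mulN1r.
Qed.

Lemma vol_int_gt0 (f : M -> R) : (exists p : M, True) -> continuous f ->
  (forall p, 0 < f p) -> 0 < vol_int f.
Proof.
move=> [p _] cf f0; have [_] := vol_int_pos M_compact P cf (fun q => ltW (f0 q)).
by apply; exists p.
Qed.

Variable h : M -> R.
Hypotheses (hI : invariant_density h) (h_gt0 : forall p, 0 < h p).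
Hypothesis M_nonempty : exists p : M, True.

Let sh : smooth h := hI.1.
Let hn0 p : h p != 0. Proof. by rewrite gt_eqF. Qed.

Let vol_int_h_gt0 : 0 < vol_int h.
Proof. by apply: vol_int_gt0 => //; exact: cint. Qed.

(** With respect to an invariant density the field is a skew-symmetric operator. *)
Lemma vol_int_parts f g : smooth f -> smooth g ->
  vol_int (fun p => L f p * (g p * h p)) = - vol_int (fun p => f p * (L g p * h p)).
Proof.
move=> sf sg; have := hI.2 _ (smooth_realM sf sg).
have -> : (fun p => L (fun q => f q * g q) p * h p) =
    fun p => L f p * (g p * h p) + f p * (L g p * h p).
  by apply/funext => p; rewrite lie_realM//; ring.
have c1 := cint sf; have c2 := cint sg; have c3 := cint sh.
have c4 := cint (lie_real_smooth X sf); have c5 := cint (lie_real_smooth X sg).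
rewrite vol_intD//; [|exact: contM c4 (contM c2 c3)|exact: contM c1 (contM c5 c3)].
by move=> /eqP; rewrite addr_eq0 => /eqP.
Qed.

Lemma vol_int_coboundary f u (a : R) : smooth f -> smooth u -> (forall p, L u p = f p - a) ->
  vol_int (fun p => f p * h p) = a * vol_int h.
Proof.
move=> sf su E; have := hI.2 _ su.
have -> : (fun p => L u p * h p) = fun p => f p * h p - a * h p.
  by apply/funext => p; rewrite E mulrBl.
have ch := cint sh; have cf := cint sf.
rewrite vol_intB; [|exact: contM|by apply: contM => //; exact: cont_cst].
by rewrite vol_intZ// => /eqP; rewrite subr_eq0 => /eqP.
Qed.

(** The form h vol is preserved: the coefficient of its Lie derivative is vol (X h + h div X), that
    is, vol times [adj]. *)
Lemma density_volume_preserving : volume_preserving X.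
Proof.
pose w := vol_form P (to_cinf (to_rinf sh) 0).
have wE c y : w c y = (h (chart_bwd c y) +i* 0) * (vol P c y)%:C by [].
exists w => [c x Sc cx|c x Sc cx].
  rewrite wE; split; first by rewrite complex_ImM /= mulr0 mul0r addr0.
  rewrite mulf_neq0// (inj_eq (@complexI R)); first exact: hn0.
  exact: vol_neq0.
have oc := @chart_cod_open _ _ _ c.
pose V i y := X c y 0 i * vol P c y.
have ReE i : @complex.Re R \o (fun y => (X c y 0 i)%:C * w c y) =
    fun y => (h \o chart_bwd c) y * V i y.
  apply/funext => y; transitivity (complex.Re ((X c y 0 i)%:C *
    ((h (chart_bwd c y) +i* 0) * (vol P c y)%:C))) => //.
  by rewrite !complex_ReM !complex_ImM /= /V; ring.
have ImE i : @complex.Im R \o (fun y => (X c y 0 i)%:C * w c y) = cst 0.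
  apply/funext => y; transitivity (complex.Im ((X c y 0 i)%:C *
    ((h (chart_bwd c y) +i* 0) * (vol P c y)%:C))) => //.
  by rewrite complex_ImM complex_ReM complex_ImM /=; ring.
rewrite /lie_nform /cpartial sum_complex; apply: complex_ext => /=; last first.
  by apply: big1 => i _; rewrite ImE /partial derive_cst.
have dh : differentiable (h \o chart_bwd c) x by exact: smooth_real_differentiable sh Sc cx.
have dV i : differentiable (V i) x by have [+ _] := vf_vol_smooth P X i Sc 1%N; apply.
transitivity (\sum_i (h (chart_bwd c x) * partial i (V i) x +
    vol P c x * (X c x 0 i * partial i (h \o chart_bwd c) x))).
  apply: eq_bigr => i _; rewrite ReE /partial.
  rewrite (@deriveM _ _ (h \o chart_bwd c) (V i)); [|exact: diff_derivable..].
  by congr (_ + _); rewrite mulrA [vol P c x * _]mulrC.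
rewrite big_split/= -!mulr_sumr -derive_partial// -(lie_real_chart X sh Sc cx).
have := (invariant_densityP X M_hausdorff M_compact P sh).1 hI (chart_bwd c x).
rewrite /adj (divergenceE M_hausdorff P X Sc (chart_bwd_dom cx)) (chart_bwdK cx) => E.
have v0 : vol P c x != 0 by exact: vol_neq0.
have : vol P c x * (L h (chart_bwd c x) + h (chart_bwd c x) * (lie_vol P X c x / vol P c x)) = 0.
  by rewrite E mulr0.
rewrite mulrDr addrC mulrCA [_ / _]mulrC mulVKf//.
Qed.

Hypothesis CF : real_cohomology_free X.

Lemma coboundaryP f : smooth f -> vol_int (fun p => f p * h p) = 0 ->
  exists2 u, smooth u & forall p, L u p = f p.
Proof.
move=> sf f0; have [a [u [su uE]]] := CF sf.
have := vol_int_coboundary sf su uE; rewrite f0 => /esym/eqP.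
rewrite mulf_eq0 (gt_eqF vol_int_h_gt0) orbF => /eqP a0.
by exists u => // p; rewrite uE a0 subr0.
Qed.

(* With [k / h] a coboundary [X v], the functional [A - vol_int (_ * v * h)] kills
   [X]-derivatives, hence is a multiple of [vol_int (_ * h)]. *)
Lemma CF_vrep (A : Rinf S -> R) k : smooth k ->
  (forall (a : R) (f g : Rinf S), A (a *: f + g) = a * A f + A g) ->
  (forall f : Rinf S, A (lie_rinf X f) = - vol_int (fun p => f p * k p)) -> vrep P A.
Proof.
move=> sk Alin Ak; pose one := @to_rinf _ _ _ S (fun=> 1) (smooth_real_cst 1).
have A0 : A 0 = 0 by have := Alin (-1) 0 0; rewrite scaler0 addr0 mulN1r addNr.
have skh : smooth (fun p => k p / h p) by exact: smooth_realM sk (smooth_real_inv hn0 sh).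
have [|v sv vE] := coboundaryP skh.
  have := Ak one; have -> : lie_rinf X one = 0 by apply: rinf_eq => p; rewrite /= lie_real_cst.
  rewrite A0 => /esym/eqP; rewrite oppr_eq0 => /eqP E; rewrite -[RHS]E; congr vol_int.
  by apply/funext => p; rewrite divfK// mul1r.
pose B (f : Rinf S) := A f - vol_int (fun p => f p * (v p * h p)).
have c2 := cint sv; have c3 := cint sh; have c23 := contM c2 c3.
have BX f : B (lie_rinf X f) = 0.
  rewrite /B Ak /= vol_int_parts//; last exact: rinf_smooth.
  rewrite (_ : (fun p => f p * (L v p * h p)) = fun p => f p * k p) ?subrr//.
  by apply/funext => p; rewrite vE divfK.
have Blin (a : R) f g : B (a *: f + g) = a * B f + B g.
  have cf := cint (rinf_smooth f); have cg := cint (rinf_smooth g).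
  rewrite /B Alin.
  have -> : (fun p => (a *: f + g) p * (v p * h p)) =
      fun p => a * (f p * (v p * h p)) + g p * (v p * h p).
    by apply/funext => p; rewrite rinfDE rinfZE mulrDl -[a * _ * _]mulrA.
  have c1 := contM cf c23; have c4 := contM cg c23.
  rewrite (vol_intD M_compact P (contM (@cont_cst _ _ a) c1) c4) (vol_intZ M_compact P a c1).
  by ring.
(* Writing f = a + X u gives B f = a B(1) and vol_int (f h) = a vol_int h, so [B] is [b] times
   integration against [h]. *)
pose b := B one / vol_int h.
exists (fun p => (v p + b) * h p) => [|f].
  by apply: smooth_realM => //; apply: smooth_realD => //; exact: smooth_real_cst.
have sf := rinf_smooth f; have cf := cint sf.
have [a [u [su uE]]] := CF sf.
have Bf : B f = a * B one.
  rewrite -[RHS]addr0 -(BX (to_rinf su)) -Blin; congr B; apply: rinf_eq => p.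
  by rewrite rinfDE rinfZE /= uE mulr1 addrC subrK.
have fh := vol_int_coboundary sf su uE.
have -> : (fun p => f p * ((v p + b) * h p)) =
    fun p => f p * (v p * h p) + b * (f p * h p) by apply/funext => p; ring.
have cfh := contM cf c3.
rewrite (vol_intD M_compact P (contM cf c23) (contM (@cont_cst _ _ b) cfh)).
rewrite (vol_intZ M_compact P b cfh).
rewrite fh mulrCA [b * _]mulfVK ?(gt_eqF vol_int_h_gt0)// -Bf /B.
by rewrite addrC subrK.
Qed.

Hypothesis smooth_distE : forall U : Cinf S -> R[i]^o,
  smooth_dist O U <-> exists h : Cinf S, U = fun u : Cinf S => cvol_int P (fun p => u p * h p).

(** The real and imaginary parts of [U] on real functions are real functionals to which [CF_vrep]
    applies; complex linearity reassembles [U]. *)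
Lemma CF_smooth_dist (U : {linear Cinf S -> R[i]^o}) (k : Cinf S) :
  (forall f : Cinf S, - U (lie X f) = cvol_int P (fun p => f p * k p)) -> smooth_dist O U.
Proof.
move=> Uk; pose A (f : Rinf S) := complex.Re (U (to_cinf f 0)).
pose B (f : Rinf S) := complex.Im (U (to_cinf f 0)).
have toL (a : R) (f g : Rinf S) : to_cinf (a *: f + g) 0 = a%:C *: to_cinf f 0 + to_cinf g 0.
  by apply: Cinf_eq => p; apply: complex_ext => /=; rewrite ?mul0r ?mulr0 ?subr0 ?addr0.
have UL (a : R) f g : U (to_cinf (a *: f + g) 0) = a%:C * U (to_cinf f 0) + U (to_cinf g 0).
  by rewrite toL linearP.
have toX f : to_cinf (lie_rinf X f) 0 = lie X (to_cinf f 0).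
  by apply: Cinf_eq => p; apply: complex_ext => //=; rewrite lie_real_cst.
have UX f : U (to_cinf (lie_rinf X f) 0) = - cvol_int P (fun p => to_cinf f 0 p * k p).
  by rewrite -Uk opprK toX.
have [|a f g|f|w1 sw1 Aw] := @CF_vrep A (@complex.Re R \o k).
- exact: (cinf_smooth k).1.
- by rewrite /A UL complex_ReD complex_ReM /= mul0r subr0.
- rewrite /A UX complex_ReN /=; congr (- vol_int _); apply/funext => p.
  by rewrite /= complex_ReM /= mul0r subr0.
have [|a f g|f|w2 sw2 Bw] := @CF_vrep B (@complex.Im R \o k).
- exact: (cinf_smooth k).2.
- by rewrite /B UL complex_ImD complex_ImM /= mul0r addr0.
- rewrite /B UX complex_ImN /=; congr (- vol_int _); apply/funext => p.
  by rewrite /= complex_ImM /= mul0r addr0.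
apply/smooth_distE; exists (to_cinf (to_rinf sw1) (to_rinf sw2)); apply/funext => f.
have -> : U f = U (to_cinf (cre f) 0) + 'i%C * U (to_cinf (cim f) 0).
  rewrite -[_ * U _]/('i%C *: U _) -linearZ -raddfD; congr (U _).
  apply: Cinf_eq => p; apply: complex_ext => /=.
    have E (a b : R) : a = a + (0 * b - 1 * 0) by ring.
    exact: E.
  have E (b : R) : b = 0 + (0 * 0 + 1 * b) by ring.
  exact: E.
have c1 := cint sw1; have c2 := cint sw2.
have c3 := cint (cinf_smooth f).1; have c4 := cint (cinf_smooth f).2.
apply: complex_ext; rewrite ?complex_ReD ?complex_ImD ?complex_ReM ?complex_ImM /=.
  rewrite !mul0r sub0r mul1r -/(A _) -/(B _) Aw Bw -vol_intB; [|exact: contM..].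
  by congr vol_int; apply/funext => p; rewrite /= complex_ReM.
rewrite !mul0r add0r mul1r -/(A _) -/(B _) Aw Bw.
rewrite -(vol_intD M_compact P (contM c3 c2) (contM c4 c1)).
by congr vol_int; apply/funext => p; rewrite /= complex_ImM.
Qed.

(** Integration against [h] is continuous for uniform convergence, so it vanishes on the closure of
    the range; by [coboundaryP], functions on which it vanishes are in the range. *)
Lemma CF_stable : stable X.
Proof.
move=> g gcl; have [s sP] := copen_cover S M_compact.
have c3 := cint sh; have [H hH] := continuous_bounded M_compact c3.
have V1 : 0 <= vol_int (fun=> 1).
  by apply: (@vol_int_pos _ _ _ S O M_compact P (fun=> 1) _ _).1; first exact: cont_cst.
have H0 : 0 <= H by have [p _] := M_nonempty; apply: le_trans (normr_ge0 _) (hH p).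
have zero k : smooth k -> (forall e : R, 0 < e -> exists2 u, smooth u & forall p, `|k p - L u p| < e) ->
    vol_int (fun p => k p * h p) = 0.
  move=> sk kP; apply/eqP; apply: contraT; rewrite -normr_gt0; set v := `|_| => v0; exfalso.
  have HV : 0 < H * vol_int (fun=> 1) + 1 by rewrite ltr_wpDl// mulr_ge0.
  have [u su uP] := kP (v / (H * vol_int (fun=> 1) + 1)) (divr_gt0 v0 HV).
  have ck := cint sk; have clu := cint (lie_real_smooth X su).
  have E : vol_int (fun p => k p * h p) = vol_int (fun p => (k p - L u p) * h p).
    rewrite -[LHS]subr0 -[X in _ - X](hI.2 _ su) -vol_intB; [|exact: contM..].
    by congr vol_int; apply/funext => p; rewrite mulrBl.
  have cku := contM (contB ck clu) c3.
  have := @vol_int_bound _ _ _ S O M_compact P _ (v / (H * vol_int (fun=> 1) + 1) * H) cku.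
  rewrite -E -/v => vle.
  have : v <= v / (H * vol_int (fun=> 1) + 1) * H * vol_int (fun=> 1).
    apply: vle => p; rewrite normrM; apply: ler_pM => //; exact: ltW.
  rewrite -mulrA mulrAC ler_pdivlMr// ler_pM2l// => h1.
  by move: h1; rewrite gerDl ler10.
have small (e : R) : 0 < e -> exists f : Cinf S, forall p,
    `|complex.Re (g p) - L (cre f) p| < e /\ `|complex.Im (g p) - L (cim f) p| < e.
  move=> e0; have [|_ [[f _ <-] fB]] := gcl (cinf_ball (ball_index S s 0) e g).
    exists (ball_index S s 0), e; split=> //; first exact: finite_ball_index.
    exact: ball_index_cinf.
  exists f => p; have [q qs pq] := sP p; have [cp _] := pq.
  have [||] := fB (chart_at S q, cball S q, [::]) _ (chart_fwd (chart_at S q) p).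
  - by exists q, [::].
  - exact: copen_cball.
  - by rewrite /= chart_fwdK.
have [g1 g2] := cinf_smooth g.
have [|u su uE] := coboundaryP g1.
  apply: zero => // e /small[f fP]; exists (cre f); first exact: rinf_smooth.
  by move=> p; have [] := fP p.
have [|v sv vE] := coboundaryP g2.
  apply: zero => // e /small[f fP]; exists (cim f); first exact: rinf_smooth.
  by move=> p; have [] := fP p.
exists (to_cinf (to_rinf su) (to_rinf sv)) => //; apply: Cinf_eq => p.
by apply: complex_ext; [exact: uE|exact: vE].
Qed.
End CohomologyFree.

(** * Positive densities, and closed range implies cohomology-freeness *)

Section CohomologyFreeDensity.
Context {R : realType} {n : nat} {M : topologicalType}.
Variables (S : @smooth_structure R n M) (O : orientation S) (X : vector_field S).
Hypotheses (M_hausdorff : hausdorff_space M) (M_compact : compact [set: M]).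
Variable P : partition_of_unity O.
Notation L := (lie_real X).

Lemma CF_density : (exists p : M, True) -> real_cohomology_free X ->
  exists2 h, invariant_density X P h & forall p, 0 < h p.
Proof.
move=> M0 CF; have sdiv := divergence_smooth M_hausdorff P X.
have [a [u [su uE]]] := CF _ sdiv; pose h p := expR (-1 * u p).
have sh : smooth_real S h.
  exact: (@smooth_real_comp _ _ _ S setT (fun=> expR) (fun q => -1 * u q) 0%N
    (@smooth_seq_expR R) (fun=> I) (smooth_realZ (-1) su)).
have h0 p : 0 < h p by exact: expR_gt0.
have Lh p : L h p = h p * (-1 * L u p).
  have := @lie_real_comp _ _ _ S X setT (fun=> expR) (fun q => -1 * u q) 0%N p
    (@smooth_seq_expR R) (fun=> I) (smooth_realZ (-1) su).
  by rewrite lie_realZ.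
have ah p : adj X P h p = a * h p by rewrite /adj Lh uE; ring.
have ch := smooth_real_continuous sh.
exists h => //; apply/(invariant_densityP X M_hausdorff M_compact P sh) => p; rewrite ah.
(* Integrating adj h = a h against 1 gives a vol_int h = 0, and the mass is positive. *)
suff -> : a = 0 by rewrite mul0r.
have := vol_int_by_parts X M_hausdorff M_compact P (smooth_real_cst 1) sh.
have -> : (fun p => L (fun=> 1) p * h p) = fun=> 0.
  by apply/funext => q; rewrite lie_real_cst mul0r.
have -> : (fun p => 1 * adj X P h p) = fun p => a * h p.
  by apply/funext => q; rewrite ah mul1r.
rewrite vol_intZ// vol_int0// => /esym/eqP; rewrite oppr_eq0 mulf_eq0 => /orP[/eqP//|].
by rewrite gt_eqF// vol_int_gt0.
Qed.

Hypothesis M_connected : connected [set: M].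
Hypothesis invariant_smooth : forall T : {linear Rinf S -> R^o}, rdist T ->
  (forall f : Rinf S, T (lie_rinf X f) = 0) -> vrep P T.

Lemma invariant_density_exists : (exists p : M, True) ->
  exists2 h, invariant_density X P h & forall p, 0 < h p.
Proof.
move=> M0.
have [h [hI h0 h1]] := positive_invariant_density M_hausdorff M_compact invariant_smooth M0.
exists h => //; apply: (invariant_density_gt0 M_hausdorff M_compact invariant_smooth M_connected hI h0).
apply: contrapT => nh; have : vol_int P h = 0.
  rewrite -(vol_int0 M_compact P); congr vol_int; apply/funext => q; apply/eqP.
  by rewrite eq_le h0 andbT leNgt; apply/negP => hq; apply: nh; exists q.
by rewrite h1 => /eqP; rewrite oner_eq0.
Qed.

(** If f - a were outside the closed range, some seminorm ball of radius e around it would avoid the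
    range. The seminorm divided by e then dominates t on X k + t (f - a), so there is an invariant
    [T] with value 1 at f - a; but [T] is a multiple of integration against [h], which kills f -
    a. *)
Lemma stable_CF : (exists p : M, True) -> stable X -> real_cohomology_free X.
Proof.
move=> M0 stX f sf.
have [h hI h0] := invariant_density_exists M0.
have sh := hI.1; have ch := smooth_real_continuous sh.
have V0 := vol_int_gt0 M_compact P M0 ch h0.
have cf := smooth_real_continuous sf.
pose a := vol_int P (fun p => f p * h p) / vol_int P h; exists a.
pose f0 p := f p - a.
have sf0 : smooth_real S f0 by apply: smooth_realB => //; exact: smooth_real_cst.
have f0h : vol_int P (fun p => f0 p * h p) = 0.
  have -> : (fun p => f0 p * h p) = fun p => f p * h p - a * h p.
    by apply/funext => p; rewrite mulrBl.
  have cfh := contM cf ch; rewrite (vol_intB M_compact P cfh (contM (@cont_cst _ _ a) ch)).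
  by rewrite (vol_intZ M_compact P a ch) divfK ?subrr// gt_eqF.
apply: contrapT => nu; pose g := to_cinf (to_rinf sf0) 0.
have ng : ~ range (lie X) g.
  move=> [U _ Ug]; apply: nu; exists (cre U); split; first exact: rinf_smooth.
  by move=> p; have := congr1 (fun G : Cinf S => complex.Re (G p)) Ug.
have [F [e [finF FI e0 Fe]]] : nbhs g (~` range (lie X)).
  exact: (open_nbhs_nbhs (conj (closed_openC stX) ng)).
have ei : 0 <= e^-1 by rewrite invr_ge0 ltW.
have ss := seminorm_sublinear finF FI ei.
have [|T [Ts TX T1]] := @coboundary_separation _ _ _ S X _ (to_rinf sf0) ss.
  move=> k t; set v := lie_rinf X k + t *: to_rinf sf0.
  have sv := rinf_smooth v; have s0 := seminorm_ge0 finF FI sv.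
  have [t0|t0] := leP t 0; first by apply: le_trans t0 _; rewrite mulr_ge0.
  rewrite leNgt; apply/negP; rewrite mulrC ltr_pdivrMr// => small.
  (* If the seminorm of X k + t f0 were below t e, then X (- k / t) would lie in the ball around
     f0. *)
  pose u := - t^-1 *: k; apply: (Fe (lie X (to_cinf u 0))); last by exists (to_cinf u 0).
  move=> [[c K] s] Ft x Kx; have [/= Sc cK KD] := FI _ Ft; have cx := KD _ Kx.
  have oc := @chart_cod_open _ _ _ c.
  have im0 : (@complex.Im R \o (lie X (to_cinf u 0) : M -> R[i])) \o chart_bwd c =
      (@complex.Im R \o (g : M -> R[i])) \o chart_bwd c.
    by apply/funext => y; exact: lie_real_cst.
  split; last by rewrite im0 subrr normr0.
  have su := lie_real_smooth X (rinf_smooth u).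
  have E : forall y, chart_cod c y -> (v \o chart_bwd c) y =
      t * (f0 \o chart_bwd c) y + - t * (L u \o chart_bwd c) y.
    move=> y _; set p := chart_bwd c y.
    have Lu : L u p = - t^-1 * L k p := lie_realZ X (- t^-1) p (rinf_smooth k).
    rewrite -[LHS]/(L k p + t * f0 p) -[RHS]/(t * f0 p + - t * L u p) Lu.
    by rewrite mulrA mulrNN divff ?mul1r ?gt_eqF// addrC.
  have h1 := seminorm_ge finF FI sv Ft Kx.
  have := le_lt_trans h1 small.
  rewrite /= (eq_iter_partial s oc E cx) (@iter_partialD _ _ (chart_cod c)
    (fun y => t * (f0 \o chart_bwd c) y) (fun y => - t * (L u \o chart_bwd c) y))//.
  - rewrite (iter_partialZ _ _ oc (sf0 c Sc) cx) (iter_partialZ _ _ oc (su c Sc) cx).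
    by rewrite mulNr -mulrBr normrM (gtr0_norm t0) ltr_pM2l.
  - exact: (smooth_realZ t sf0 Sc).
  - exact: (smooth_realZ (- t) su Sc).
have [k sk Tk] := invariant_smooth (seminorm_rdist finF FI ei Ts) TX.
have kI : invariant_density X P k.
  by split=> // u su; have := TX (to_rinf su); rewrite Tk.
have [b kb] := invariant_density_unique M_hausdorff M_compact invariant_smooth M_connected hI h0 kI.
have := Tk (to_rinf sf0); rewrite T1 (_ : (fun p => _) = fun p => b * (f0 p * h p)); last first.
  by apply/funext => p; rewrite kb mulrCA.
have cf0 := smooth_real_continuous sf0.
rewrite vol_intZ//; last exact: contM.
by rewrite f0h mulr0 => /eqP; rewrite oner_eq0.
Qed.
End CohomologyFreeDensity.

(** * The estimate for hypoelliptic vector fields *)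

Section GeometricSeries.
Context {R : realType}.
Notation half := (2^-1 : R).

Lemma half_exp_gt0 i : 0 < half ^+ i. Proof. by rewrite exprn_gt0. Qed.

Lemma half_expS i : half ^+ i = 2 * half ^+ i.+1.
Proof. by rewrite exprS mulrA divff ?mul1r// pnatr_eq0. Qed.

Lemma half_exp_small (B e : R) : 0 < e -> exists N, forall i, (N <= i)%N -> B * half ^+ i < e.
Proof.
move=> e0; have B1 : 0 < `|B| + 1 by rewrite ltr_wpDl.
have [N NP] : exists N, half ^+ N < e / (`|B| + 1).
  have : half ^+ i @[i --> \oo] --> (0 : R) by apply: cvg_expr; rewrite ger0_norm ?invf_lt1// ltr1n.
  move=> /cvgrPdist_lt/(_ (e / (`|B| + 1)))[|N _ NP]; first exact: divr_gt0.
  by exists N; have := NP N (leqnn N); rewrite sub0r normrN gtr0_norm// half_exp_gt0.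
exists N => i Ni; have h0 := half_exp_gt0 i.
have hi : half ^+ i <= half ^+ N by rewrite ler_wiXn2l// invf_le1// ler1n.
rewrite ltr_pdivlMr// in NP; apply: le_lt_trans NP; rewrite mulrC.
apply: le_trans (_ : half ^+ i * (`|B| + 1) <= _); last by rewrite ler_pM2r.
by rewrite ler_pM2l//; apply: le_trans (ler_norm B) _; rewrite lerDl.
Qed.

(** The bound keeps the term subtracted at [m]: it telescopes, and the induction closes. *)
Lemma geometric_tail (b : nat -> R) (B : R) N m : (forall i, `|b i| <= B * half ^+ i) ->
  (N <= m)%N -> `|\sum_(i < m) b i - \sum_(i < N) b i| <= B * 2 * half ^+ N - B * 2 * half ^+ m.
Proof.
move=> bB; elim: m => [|m IH].
  by rewrite leqn0 => /eqP ->; rewrite !subrr normr0.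
rewrite leq_eqVlt => /predU1P[->|]; first by rewrite !subrr normr0.
rewrite ltnS => /IH h; rewrite big_ord_recr/= addrAC.
apply: le_trans (ler_normD _ _) _; have := bB m; rewrite (half_expS m).
by move: h; rewrite (half_expS m); lra.
Qed.

(** Every partial sum minus its tail bound lies below every partial sum plus its tail bound. The
    supremum of the former is the limit, with the error estimate built in. *)
Lemma geometric_limit (b : nat -> R) (B : R) : (forall i, `|b i| <= B * half ^+ i) ->
  exists l, forall N, `|l - \sum_(i < N) b i| <= B * 2 * half ^+ N.
Proof.
move=> bB; pose S N := \sum_(i < N) b i.
have B0 : 0 <= B by have := le_trans (normr_ge0 _) (bB 0%N); rewrite expr0 mulr1.
have t0 N : 0 <= B * 2 * half ^+ N by rewrite !mulr_ge0// ltW// half_exp_gt0.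
have H N m : S N - B * 2 * half ^+ N <= S m + B * 2 * half ^+ m.
  have [Nm|/ltnW mN] := leqP N m.
    have := geometric_tail bB Nm; rewrite ler_norml -/(S m) -/(S N) => /andP[h _].
    by have := t0 m; have := t0 N; lra.
  have := geometric_tail bB mN; rewrite ler_norml -/(S m) -/(S N) => /andP[_ h].
  by have := t0 m; have := t0 N; lra.
pose E := [set S N - B * 2 * half ^+ N | N in [set: nat]].
exists (sup E) => N; rewrite ler_norml -/(S N); apply/andP; split.
  have : S N - B * 2 * half ^+ N <= sup E.
    by apply: ub_le_sup; [exists (S 0%N + B * 2 * half ^+ 0) => _ [m _ <-]; exact: H|exists N].
  by lra.
have : sup E <= S N + B * 2 * half ^+ N.
  by apply: ge_sup; [exists (S 0%N - B * 2 * half ^+ 0), 0%N|move=> _ [m _ <-]; exact: H].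
by lra.
Qed.
End GeometricSeries.

(** * The gliding hump *)

Section GlidingHump.
Context {R : realType} {T J : Type}.
Variables (phi : nat -> T -> R) (x y : J -> T) (rho : J -> R).
Hypotheses (rho0 : forall j, 0 < rho j) (phi1 : forall k p, `|phi k p| <= 1).
Hypothesis phi_lip : forall k, exists C, forall j, `|phi k (x j) - phi k (y j)| <= C * rho j.
Hypothesis phi_unbounded : forall C, exists k j, C * rho j < `|phi k (x j) - phi k (y j)|.
Notation half := (2^-1 : R).

(** Coefficients and indices are chosen in turn. At stage i, [r i] is the coefficient and [A i] a
    Lipschitz constant of the sum so far; [k i] and the pair [j i] are taken so that the new term
    varies by more than (i + A i + 2) rho there. Earlier terms undo at most A i rho of it. The next
    coefficient is at most rho / 4, so later terms undo at most rho. The variation left exceeds i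
    rho. *)
Lemma gliding_hump : exists (a : nat -> R) (k : nat -> nat),
  [/\ forall i, 0 <= a i <= half ^+ i, forall i, (i <= k i)%N &
   forall u : T -> R, (forall p N, `|u p - \sum_(i < N) a i * phi (k i) p| <= 2 * half ^+ N) ->
     forall C, exists j, C * rho j < `|u (x j) - u (y j)|].
Proof.
have [lam lamP] := choice phi_lip.
have lam0 k : 0 <= `|lam k| by [].
(* The finitely many [phi k] with k < N have a common constant; adding it to [|C|] forces the index
   to be at least [N]. *)
have unb (C : R) N : exists t : nat * J, (N <= t.1)%N /\
    C * rho t.2 < `|phi t.1 (x t.2) - phi t.1 (y t.2)|.
  have [k [j kj]] := phi_unbounded (`|C| + \sum_(k < N) `|lam k|).
  have sge0 : 0 <= \sum_(k < N) `|lam k| by apply: sumr_ge0.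
  exists (k, j) => /=; split.
    rewrite leqNgt; apply/negP => kN; move: kj; rewrite ltNge; apply/negP/negPn.
    apply: le_trans (lamP k j) _; rewrite ler_pM2r//.
    apply: le_trans (ler_norm _) _.
    rewrite (bigD1 (Ordinal kN))//= addrCA lerDl addr_ge0//.
    by apply: sumr_ge0.
  apply: le_lt_trans kj; rewrite ler_pM2r//.
  by apply: le_trans (ler_norm _) _; rewrite lerDl.
have [f fP] := choice (fun z : nat * R * R =>
  unb ((z.1.1%:R + z.2 + 2) / z.1.2) z.1.1).
(* Halving keeps the coefficients below a geometric sequence; the second bound protects the hump
   just made. *)
pose next (i : nat) (z : R * R) : R * R := let t := f (i, z.1, z.2) in
  (Num.min (z.1 / 2) (rho t.2 / 4), z.2 + z.1 * `|lam t.1|).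
pose st := fix st i := if i is i'.+1 then next i' (st i') else (1, 0) : R * R.
pose r i := (st i).1; pose A i := (st i).2; pose k i := (f (i, r i, A i)).1.
pose j i := (f (i, r i, A i)).2.
have rS i : r i.+1 = Num.min (r i / 2) (rho (j i) / 4) by [].
have AS i : A i.+1 = A i + r i * `|lam (k i)| by [].
have r0 i : 0 < r i.
  by elim: i => [|i IH]; rewrite ?rS ?lt_min ?divr_gt0//; rewrite /r /= ltr01.
have r_half i m : r (i + m)%N <= r i * half ^+ m.
  elim: m => [|m IH]; first by rewrite addn0 expr0 mulr1.
  rewrite addnS rS exprSr mulrA; apply: le_trans (_ : r (i + m)%N / 2 <= _).
    by rewrite ge_min lexx.
  by rewrite ler_pM2r// invr_gt0.
exists r, k; split.
- by move=> i; rewrite ltW//=; have := r_half 0%N i; rewrite add0n /r /= mul1r.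
- by move=> i; have [] := fP (i, r i, A i).
move=> u uP C; pose s N p := \sum_(i < N) r i * phi (k i) p.
have tail i p : `|u p - s i p| <= 2 * r i.
  apply/ler_addgt0Pr => e e0; have [N NP] := half_exp_small (2 : R) e0.
  pose m := (i + N)%N.
  have h1 : `|u p - s m p| <= e.
    by apply: le_trans (uP p m) (ltW (NP _ _)); exact: leq_addl.
  have H l : `|s (i + l)%N p - s i p| <= r i * 2 - r i * 2 * half ^+ l.
    elim: l => [|l IH]; first by rewrite addn0 subrr normr0 expr0 mulr1 subrr.
    rewrite addnS /s big_ord_recr/= addrAC; apply: le_trans (ler_normD _ _) _.
    have hl := r_half i l; have hphi : `|r (i + l)%N * phi (k (i + l)%N) p| <= r i * half ^+ l.
      rewrite normrM (gtr0_norm (r0 _)); apply: le_trans hl.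
      by rewrite -[leRHS]mulr1 ler_pM2l.
    by move: IH; rewrite -/(s _ p) -/(s _ p) (half_expS l); move: hphi; rewrite (half_expS l); lra.
  have := H N; rewrite -/m => h2; have := ler_distD (s m p) (u p) (s i p).
  have : 0 <= r i * 2 * half ^+ N by rewrite !mulr_ge0// ltW// half_exp_gt0.
  by lra.
have sA i j' : `|s i (x j') - s i (y j')| <= A i * rho j'.
  elim: i => [|i IH]; first by rewrite /s !big_ord0 subrr normr0 /A /= mul0r.
  rewrite /s !big_ord_recr/= -/(s i _) -/(s i _) AS mulrDl.
  rewrite opprD addrACA -mulrBr; apply: le_trans (ler_normD _ _) (lerD IH _).
  rewrite normrM (gtr0_norm (r0 _)) -mulrA ler_pM2l//.
  apply: le_trans (lamP _ _) _; rewrite ler_pM2r//; exact: ler_norm.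
have [i Ci] : exists i : nat, C <= i%:R.
  by exists (Num.truncn `|C|).+1; apply: le_trans (ler_norm C) (ltW (truncnS_gt _)).
exists (j i); have [_] := fP (i, r i, A i); rewrite /= -/(k i) -/(j i).
rewrite mulrAC ltr_pdivrMr// [X in _ < X -> _]mulrC.
move=> big; have := tail i.+1 (x (j i)); have := tail i.+1 (y (j i)); have := sA i (j i).
rewrite /s !big_ord_recr/= -/(s i _) -/(s i _).
have : r i.+1 <= rho (j i) / 4 by rewrite rS ge_min lexx orbT.
have : C * rho (j i) <= i%:R * rho (j i) by rewrite ler_pM2r.
have := rho0 (j i).
move: big; set a := phi _ _; set b := phi _ _; set ux := u (x _); set uy := u (y _).
set sx := s _ _; set sy := s _ _.
move=> big h1 h2 h3 h4 h5 h6.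
have E : r i * `|a - b| = `|r i * a - r i * b| by rewrite -mulrBr normrM gtr0_norm.
move: big; rewrite E => big.
have : `|r i * a - r i * b| <= `|ux - uy| + `|sx - sy| + `|ux - (sx + r i * a)| + `|uy - (sy + r i * b)|.
  have -> : r i * a - r i * b = (ux - uy) - (sx - sy) - (ux - (sx + r i * a)) + (uy - (sy + r i * b)).
    by ring.
  apply: le_trans (ler_normD _ _) _; rewrite lerD2r.
  apply: le_trans (ler_normB _ _) _; rewrite lerD2r; exact: ler_normB.
by lra.
Qed.
End GlidingHump.

(** * Termwise differentiation of geometrically convergent series *)

Section SmoothSeries.
Context {R : realType} {n : nat}.
Implicit Types (D : set 'rV[R]_n) (w : nat -> 'rV[R]_n -> R).
Notation half := (2^-1 : R).

Lemma sum_differentiable w N x : (forall i, differentiable (w i) x) ->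
  differentiable (fun y => \sum_(i < N) w i y) x /\
  forall j, partial j (fun y => \sum_(i < N) w i y) x = \sum_(i < N) partial j (w i) x.
Proof.
move=> dw; elim: N => [|N [IH1 IH2]].
  rewrite (_ : (fun y => \sum_(i < 0) w i y) = cst 0); last by apply/funext => y; rewrite big_ord0.
  by split=> [|j]; [exact: differentiable_cst|rewrite big_ord0 /partial derive_cst].
rewrite (_ : (fun y => \sum_(i < N.+1) w i y) = (fun y => \sum_(i < N) w i y) \+ w N); last first.
  by apply/funext => y; rewrite /= big_ord_recr.
split=> [|j]; first exact: differentiableD.
rewrite /partial deriveD; [|exact: diff_derivable..].
by rewrite big_ord_recr /= -IH2.
Qed.

Lemma linear_approx_differentiable (f : 'rV[R]_n -> R) (g : 'I_n -> R) x :
  (forall e, 0 < e -> \forall v \near (0 : 'rV[R]_n),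
    `|f (v + x) - f x - \sum_j v 0 j * g j| <= e * `|v|) ->
  differentiable f x /\ forall j, partial j f x = g j.
Proof.
move=> fg; pose l (v : 'rV[R]_n) : R^o := \sum_j v 0 j * g j.
have ll : linear l.
  move=> a u v; rewrite /l scaler_sumr -big_split/=; apply: eq_bigr => j _.
  by rewrite !mxE mulrDl -mulrA.
pose L := HB.pack_for {linear 'rV[R]_n -> R^o} l (GRing.isLinear.Build _ _ _ _ l ll).
have cL : continuous L.
  have c j : continuous (fun v : 'rV[R]_n => v 0 j * g j).
    apply: (@contM _ _ (fun v : 'rV[R]_n => v 0 j) (fun=> g j)); last exact: cont_cst.
    by move=> v; exact: coord_continuous.
  have H (s : seq 'I_n) : continuous (fun v : 'rV[R]_n => \sum_(j <- s) v 0 j * g j).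
    elim: s => [|j s IH]; first by under eq_fun do rewrite big_nil; exact: cont_cst.
    by under eq_fun do rewrite big_cons; exact: contD.
  exact: H.
have fE : f \o shift x = cst (f x) + L +o_ (0 : 'rV[R]_n) id.
  apply/eqaddoP => e e0; apply: filterS (fg e e0) => v.
  by rewrite /= !fctE /= opprD addrA.
have dE : 'd f x = L :> ('rV[R]_n -> R) := diff_unique cL fE.
have df : differentiable f x.
  by apply/diff_locallyP; rewrite dE.
split=> // j; rewrite /partial deriveE// dE /= /l (bigD1 j)//= big1 => [|i ij].
  by rewrite mxE !eqxx mul1r addr0.
by rewrite mxE (negbTE ij) andbF mul0r.
Qed.

(** The remainder f - F N is a limit of finite sums with geometrically small derivatives, so by the
    mean value inequality it has a small Lipschitz constant; the rest is the differentiability of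
    one fixed partial sum [F N]. *)
Lemma series_differentiable D w (f : 'rV[R]_n -> R) (g : 'I_n -> 'rV[R]_n -> R) (A B : R) :
  open D -> (forall i x, D x -> differentiable (w i) x) ->
  (forall i j x, D x -> `|partial j (w i) x| <= B * half ^+ i) ->
  (forall x N, D x -> `|f x - \sum_(i < N) w i x| <= A * half ^+ N) ->
  (forall j x N, D x -> `|g j x - \sum_(i < N) partial j (w i) x| <= B * 2 * half ^+ N) ->
  forall x, D x -> differentiable f x /\ forall j, partial j f x = g j x.
Proof.
move=> oD dw wB fA gB x Dx; apply: linear_approx_differentiable => e e0.
have [r r0 rD] : exists2 r : R, 0 < r & forall y, `|y - x| <= r -> D y.
  have /nbhs_ballP[r /= r0 rP] := open_nbhs_nbhs (conj oD Dx).
  exists (r / 2) => [|y yr]; first exact: divr_gt0.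
  apply: rP; rewrite -ball_normE /= distrC; apply: le_lt_trans yr _.
  by rewrite ltr_pdivrMr// ltr_pMr// ltr1n.
have e4 : 0 < e / 4 by exact: divr_gt0.
have [N NP] := half_exp_small (n%:R * (B * 2)) e4.
(* [t] bounds both the Lipschitz constant of the remainder and the error in the differential. With
   the error of [F N] this uses three quarters of [e]. *)
have hN := ltW (NP N (leqnn N)); set t := _ * half ^+ N in hN.
pose F m y := \sum_(i < m) w i y.
have dF m y : D y -> differentiable (F m) y /\
    forall j, partial j (F m) y = \sum_(i < m) partial j (w i) y.
  by move=> Dy; apply: sum_differentiable => i; exact: dw.
have [dFx pFx] := dF N x Dx.
have [_ /eqaddoP/(_ _ e4) FE] := (diff_locallyP x (F N)).1 dFx.
near=> v.
have vr : `|v| <= r.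
  near: v; apply: filterS (_ : nbhs (0 : 'rV[R]_n) (ball 0 r)); last exact: nbhsx_ballx.
  by move=> v; rewrite -ball_normE /= sub0r normrN => /ltW.
have Dv : D (v + x) by apply: rD; rewrite addrK.
have h1 : `|F N (v + x) - F N x - \sum_j v 0 j * partial j (F N) x| <= e / 4 * `|v|.
  have : `|(F N \o shift x - (cst (F N x) + 'd (F N) x)) v| <= e / 4 * `|v| by near: v.
  rewrite !fctE /= opprD addrA -deriveE// derive_partial//.
have h2 : `|\sum_j v 0 j * partial j (F N) x - \sum_j v 0 j * g j x| <= t * `|v|.
  rewrite -sumrB; apply: le_trans (ler_norm_sum _ _ _) _.
  apply: le_trans (_ : \sum_(j < n) (B * 2 * half ^+ N * `|v|) <= _).
    apply: ler_sum => j _; rewrite -mulrBr normrM mulrC; apply: ler_pM => //.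
      by rewrite distrC pFx; exact: gB.
    exact: rV_coord_le.
  rewrite sumr_const card_ord -[_ *+ n]mulr_natl le_eqVlt; apply/orP; left; apply/eqP; rewrite /t.
  by ring.
have h3 : `|(f (v + x) - F N (v + x)) - (f x - F N x)| <= t * `|v|.
  apply/ler_addgt0Pr => d d0; have d2 : 0 < d / 2 by exact: divr_gt0.
  have [m mP] := half_exp_small A d2.
  pose q := maxn m N; have Nq : (N <= q)%N by exact: leq_maxr.
  have hq := ltW (mP q (leq_maxl _ _)).
  have k1 := fA (v + x) q Dv; have k2 := fA x q Dx.
  have k3 : `|(F q (v + x) - F N (v + x)) - (F q x - F N x)| <= t * `|v|.
    have := @MVT_rV_le _ n (fun y => F q y - F N y) x x (v + x) r (B * 2 * half ^+ N).
    rewrite addrK subrr normr0 /t !mulrA; apply => //; last exact: ltW.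
      move=> z /rD Dz; apply: differentiableB; first exact: (dF q z Dz).1.
      exact: (dF N z Dz).1.
    move=> z i /rD Dz.
    have -> : partial i (fun y => F q y - F N y) z = partial i (F q) z - partial i (F N) z.
      rewrite /partial deriveB//; apply: diff_derivable; first exact: (dF q z Dz).1.
      exact: (dF N z Dz).1.
    rewrite (dF q z Dz).2 (dF N z Dz).2.
    have := geometric_tail (b := fun l => partial i (w l) z) (fun l => wB l i z Dz) Nq.
    have : 0 <= B * 2 * half ^+ q.
      have := le_trans (normr_ge0 _) (wB q i z Dz); lra.
    lra.
  have -> : f (v + x) - F N (v + x) - (f x - F N x) =
      (f (v + x) - F q (v + x)) - (f x - F q x) +
      ((F q (v + x) - F N (v + x)) - (F q x - F N x)) by ring.
  apply: le_trans (ler_normD _ _) _; have := ler_normB (f (v + x) - F q (v + x)) (f x - F q x).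
  by rewrite -/(F q _) -/(F q x) in k1 k2; lra.
have -> : f (v + x) - f x - \sum_j v 0 j * g j x =
    ((f (v + x) - F N (v + x)) - (f x - F N x)) +
    (F N (v + x) - F N x - \sum_j v 0 j * partial j (F N) x) +
    (\sum_j v 0 j * partial j (F N) x - \sum_j v 0 j * g j x) by ring.
apply: le_trans (ler_normD _ _) _; apply: le_trans (lerD (ler_normD _ _) (lexx _)) _.
have : t * `|v| <= e / 4 * `|v| by exact: ler_wpM2r.
have : 0 <= e * `|v| by rewrite mulr_ge0// ltW.
by lra.
Unshelve. all: by end_near. Qed.

(** The sums [G] of all termwise derivatives are introduced at once, indexed by words in the
    coordinates. Each is differentiable with the sums for the longer words as partial derivatives,
    and class k follows by induction for all words together. *)
Lemma smooth_series D w : open D -> (forall i, smooth_on D (w i)) ->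
  (forall s, exists B, forall i x, D x -> `|iter_partial s (w i) x| <= B * half ^+ i) ->
  forall f (A : R), (forall x N, D x -> `|f x - \sum_(i < N) w i x| <= A * half ^+ N) ->
  smooth_on D f.
Proof.
move=> oD sw /choice[B wB] f A fA.
have ex (z : seq 'I_n * 'rV[R]_n) : exists l, D z.2 -> forall N,
    `|l - \sum_(i < N) iter_partial z.1 (w i) z.2| <= B z.1 * 2 * half ^+ N.
  have [Dz|nD] := pselect (D z.2); last by exists 0.
  have [l lP] := geometric_limit (b := fun i => iter_partial z.1 (w i) z.2)
    (fun i => wB z.1 i z.2 Dz).
  by exists l.
have [G GP] := choice ex.
have dG s x : D x -> differentiable (fun y => G (s, y)) x /\
    forall j, partial j (fun y => G (s, y)) x = G (j :: s, x).
  have [B1 B1P] : exists B1, forall j, B (j :: s) <= B1.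
    exists (\sum_j `|B (j :: s)|) => j; apply: le_trans (ler_norm _) _.
    by rewrite (bigD1 j)//= lerDl; apply: sumr_ge0.
  apply: (@series_differentiable D (fun i => iter_partial s (w i)) _
    (fun j y => G (j :: s, y)) (B s * 2) B1) => //.
  - move=> i y Dy; have := smooth_on_iter_partial s (sw i) 1%N.
    by move=> [+ _]; apply.
  - move=> i j y Dy; apply: le_trans (wB (j :: s) i y Dy) _.
    by rewrite ler_pM2r// half_exp_gt0.
  - by move=> y N Dy; exact: (GP (s, y)).
  - move=> j y N Dy; apply: le_trans (GP (j :: s, y) Dy N) _.
    rewrite /= ler_pM2r ?half_exp_gt0// ler_pM2r//; exact: B1P.
have cG k s : Ck_on D k (fun y => G (s, y)).
  elim: k s => [|k IH] s.
    by move=> x Dx; apply: differentiable_continuous; exact: (dG s x Dx).1.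
  split=> [x Dx|j]; first exact: (dG s x Dx).1.
  by apply: (eq_Ck_on oD _ (IH (j :: s))) => x Dx; rewrite (dG s x Dx).2.
move=> k; apply: (eq_Ck_on oD _ (cG k [::])) => x Dx.
apply/eqP; rewrite -subr_eq0 -normr_le0; apply/ler_addgt0Pr => e e0; rewrite add0r.
have e2 : 0 < e / 2 by exact: divr_gt0.
have [N1 N1P] := half_exp_small A e2; have [N2 N2P] := half_exp_small (B [::] * 2) e2.
pose N := maxn N1 N2; have h1 := fA x N Dx.
have h2 : `|G ([::], x) - \sum_(i < N) w i x| <= B [::] * 2 * half ^+ N := GP ([::], x) Dx N.
have h3 := N1P N (leq_maxl _ _); have h4 := N2P N (leq_maxr _ _).
have := ler_distD (\sum_(i < N) w i x) (G ([::], x)) (f x).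
move=> /le_trans; apply; rewrite (splitr e); apply: lerD; first exact: le_trans h2 (ltW h4).
by rewrite distrC; exact: le_trans h1 (ltW h3).
Qed.
End SmoothSeries.

(** * Local Lipschitz bounds from hypoellipticity *)

Section HypoellipticEstimate.
Context {R : realType} {n : nat} {M : topologicalType}.
Variables (S : @smooth_structure R n M) (O : orientation S) (X : vector_field S).
Hypotheses (M_hausdorff : hausdorff_space M) (M_compact : compact [set: M]).
Variable P : partition_of_unity O.
Notation vol_int := (vol_int P).
Notation L := (lie_real X).
Notation smooth := (smooth_real S).
Notation half := (2^-1 : R).
Notation cint := (smooth_real_continuous (S := S)).
Implicit Types p q : M.

Lemma density_functional (k : M -> R) : continuous k ->
  exists2 T : {linear Rinf S -> R^o}, rdist T & forall f : Rinf S, T f = vol_int (fun p => f p * k p).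
Proof.
move=> ck; pose t (f : Rinf S) : R^o := vol_int (fun p => f p * k p).
have tl : linear t.
  move=> a f g; have cf := cint (rinf_smooth f); have cg := cint (rinf_smooth g).
  have cfk := contM cf ck; have cgk := contM cg ck.
  transitivity (a * t f + t g); last by [].
  rewrite /t -(vol_intZ M_compact P a cfk) -(vol_intD M_compact P (contM (@cont_cst _ _ a) cfk) cgk).
  by congr vol_int; apply/funext => p; rewrite rinfDE rinfZE mulrDl -[a * _ * _]mulrA.
pose T := HB.pack_for {linear Rinf S -> R^o} t (GRing.isLinear.Build _ _ _ _ t tl).
exists T => //; have [B kB] := continuous_bounded M_compact ck.
apply: (@sup_rdist _ _ _ S M_compact T (B * vol_int (fun=> 1))) => f C fC.
have cfk := contM (cint (rinf_smooth f)) ck.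
have := @vol_int_bound _ _ _ S O M_compact P _ (C * B) cfk.
rewrite [C * B]mulrC mulrAC; apply=> p; rewrite normrM mulrC.
by apply: ler_pM.
Qed.

Lemma smooth_lipschitz p (f : M -> R) : smooth f -> exists C, forall x y, cball S p x -> cball S p y ->
  `|f (chart_bwd (chart_at S p) x) - f (chart_bwd (chart_at S p) y)| <= C * `|x - y|.
Proof.
move=> sf; pose F := ball_index S [:: p] 1.
have finF : finite_set F by exact: finite_ball_index.
have FI : F `<=` cinf_index S by exact: ball_index_cinf.
exists (n%:R * seminorm F f) => x y Bx By; set c := chart_at S p.
have Sc : atlas S c by exact: chart_at_atlas.
apply: (@MVT_rV_le _ _ (f \o chart_bwd c) (chart_fwd c p) y x (crad S p)) => //.
  by move=> z /(@cball_sub _ _ _ S p z); exact: smooth_real_differentiable sf Sc.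
move=> z i Bz; apply: (@seminorm_ge _ _ _ S F finF FI f (c, cball S p, [:: i]) z) => //.
by exists p, [:: i]; rewrite mem_head.
Qed.

Variable h : M -> R.
Hypotheses (hI : invariant_density X P h) (h_gt0 : forall p, 0 < h p).
Hypothesis GH_rep : forall (T : {linear Rinf S -> R^o}) (k : M -> R), rdist T -> smooth k ->
  (forall f : Rinf S, T (lie_rinf X f) = - vol_int (fun p => f p * k p)) -> vrep P T.

Variable s0 : seq M.
Hypothesis s0_cover : forall q, exists2 p, p \in s0 & copen S p q.
Notation q_ k := (seminorm (ball_index S s0 k)).

Let finF k : finite_set (ball_index S s0 k). Proof. exact: finite_ball_index. Qed.
Let FI k : ball_index S s0 k `<=` cinf_index S. Proof. exact: ball_index_cinf. Qed.

Lemma ball_seminorm_ge k (f : M -> R) p x l : smooth f -> p \in s0 -> cball S p x ->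
  (size l <= k)%N -> `|iter_partial l (f \o chart_bwd (chart_at S p)) x| <= q_ k f.
Proof.
move=> sf ps Bx lk.
apply: (@seminorm_ge _ _ _ S _ (finF k) (FI (k := k)) f (chart_at S p, cball S p, l) x) => //.
by exists p, l.
Qed.

Lemma ball_seminorm_ge_value k (f : M -> R) p : smooth f -> `|f p| <= q_ k f.
Proof.
move=> sf; have [q qs pq] := s0_cover p; have [cp _] := pq.
have := @ball_seminorm_ge k f q (chart_fwd (chart_at S q) p) [::] sf qs (copen_cball pq) (leq0n k).
by rewrite /= chart_fwdK.
Qed.

Lemma ball_seminorm_mono k m (f : M -> R) : smooth f -> (k <= m)%N -> q_ k f <= q_ m f.
Proof.
move=> sf km; apply: seminorm_le; first exact: (seminorm_ge0 (finF m) (FI (k := m))).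
move=> _ x [p [l [ps lk ->]]] /= Bx; apply: ball_seminorm_ge => //.
exact: leq_trans km.
Qed.

Lemma uniform_limit_continuous_half (u : M -> R) (s : nat -> M -> R) :
  (forall N, continuous (s N)) -> (forall p N, `|u p - s N p| <= 2 * half ^+ N) -> continuous u.
Proof.
move=> cs us p; apply/cvgrPdist_lt => e e0.
have e3 : 0 < e / 3 by exact: divr_gt0.
have [N NP] := half_exp_small (2 : R) e3; have hN := NP N (leqnn N).
have /cvgrPdist_lt/(_ _ e3) := cs N p; apply: filterS => q spq.
have h1 := us p N; have h2 := us q N; rewrite distrC in h2.
have := ler_distD (s N p) (u p) (u q); have := ler_distD (s N q) (s N p) (u q); lra.
Qed.

Section Series.
Variables (a : nat -> R) (psi : nat -> M -> R).
Hypotheses (a_half : forall i, 0 <= a i <= half ^+ i) (psi_smooth : forall i, smooth (psi i)).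
Hypotheses (psi_le1 : forall i p, `|psi i p| <= 1) (psi_q : forall i, q_ i (L (psi i)) <= 1).

Let term_le (v : R) i : `|v| <= 1 -> `|a i * v| <= 1 * half ^+ i.
Proof.
move=> v1; have /andP[a0 ah] := a_half i; rewrite normrM ger0_norm// mul1r -[leRHS]mulr1.
by apply: ler_pM.
Qed.

Let Lpsi_smooth i : smooth (L (psi i)). Proof. exact: lie_real_smooth. Qed.

Lemma lie_series_smooth (w : M -> R) :
  (forall p N, `|w p - \sum_(i < N) a i * L (psi i) p| <= 2 * half ^+ N) -> smooth w.
Proof.
move=> wP; apply: smooth_real_local => p; have [q qs [cp Bp]] := s0_cover p.
pose c := chart_at S q; pose D := [set x : 'rV[R]_n | `|x - chart_fwd c q| < crad S q].
have Sc : atlas S c by exact: chart_at_atlas.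
have oD : open D by exact: oball_open.
have DB x : D x -> cball S q x by move=> /ltW.
have DC x : D x -> chart_cod c x by move=> /DB/(@cball_sub _ _ _ S q x).
exists c, D; split=> //.
have oc := @chart_cod_open _ _ _ c.
have sw i : smooth_on (chart_cod c) (fun x => a i * (L (psi i) \o chart_bwd c) x).
  exact: (smooth_realZ (a i) (Lpsi_smooth i) Sc).
have sub_smooth (f : 'rV[R]_n -> R) : smooth_on (chart_cod c) f -> smooth_on D f.
  by move=> sf k; apply: Ck_on_sub (sf k).
apply: (@smooth_series _ _ D (fun i x => a i * (L (psi i) \o chart_bwd c) x) oD _ _ _ 2).
- by move=> i; apply: sub_smooth.
(* Terms of index at least the order of [s] are controlled by [psi_q], since the seminorm of index i
   includes all derivatives up to order i. The finitely many others are bounded by their own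
   seminorms. *)
- move=> s; exists (1 + \sum_(i < size s) q_ (size s) (L (psi i))) => i x Dx.
  rewrite (iter_partialZ (a i) s oc (Lpsi_smooth i Sc) (DC x Dx)) normrM.
  have /andP[a0 ah] := a_half i; rewrite ger0_norm// mulrC.
  have qge0 j : 0 <= q_ (size s) (L (psi j)).
    exact: (seminorm_ge0 (finF (size s)) (FI (k := size s)) (Lpsi_smooth j)).
  have sum0 : 0 <= \sum_(i < size s) q_ (size s) (L (psi i)) by apply: sumr_ge0.
  apply: ler_pM => //; have [si|is_] := leqP (size s) i.
    apply: le_trans (_ : q_ i (L (psi i)) <= _).
      by apply: ball_seminorm_ge => //; exact: DB.
    by apply: le_trans (psi_q i) _; rewrite lerDl.
  apply: le_trans (_ : q_ (size s) (L (psi i)) <= _).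
    by apply: ball_seminorm_ge => //; exact: DB.
  rewrite (bigD1 (Ordinal is_))//= addrCA lerDl addr_ge0//.
  by apply: sumr_ge0.
- by move=> x N Dx; exact: wP.
Qed.

(** The uniform limit [u] is a priori only continuous, but the derivatives of the partial sums
    converge to a smooth [w]. Passing to the limit in the integration by parts, the distribution u h
    has the smooth Lie derivative w h; hypoellipticity makes u h smooth, hence [u]. *)
Lemma hypoelliptic_series (u : M -> R) :
  (forall p N, `|u p - \sum_(i < N) a i * psi i p| <= 2 * half ^+ N) -> smooth u.
Proof.
move=> uP; pose s N p := \sum_(i < N) a i * psi i p.
have ss N : smooth (s N) by apply: smooth_real_sum => i; exact: smooth_realZ.
have cs N := cint (ss N).
have cu : continuous u by exact: (uniform_limit_continuous_half cs uP).
have [w wP] : exists w : M -> R, forall p N,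
    `|w p - \sum_(i < N) a i * L (psi i) p| <= 2 * half ^+ N.
  have ex p : exists l : R, forall N, `|l - \sum_(i < N) a i * L (psi i) p| <= 2 * half ^+ N.
    have [|l lP] := @geometric_limit R (fun i => a i * L (psi i) p) 1.
      move=> i; apply: term_le; apply: le_trans (psi_q i).
      exact: ball_seminorm_ge_value.
    by exists l => N; have := lP N; rewrite mul1r.
  by have [w wP] := choice ex; exists w.
have sw := lie_series_smooth wP; have cw := cint sw.
have sh := hI.1; have ch := cint sh.
have Ls N p : L (s N) p = \sum_(i < N) a i * L (psi i) p.
  rewrite (@lie_real_sum _ _ _ S X _ _ (fun i : 'I_N => fun q => a i * psi i q))//.
    by apply: eq_bigr => i _; rewrite lie_realZ.
  by move=> i; exact: smooth_realZ.
have [T dT TE] := density_functional (contM cu ch).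
have [|f|v sv Tv] := GH_rep dT (k := fun p => w p * h p).
- exact: smooth_realM.
(* The identity holds for the partial sums, and replacing them by [u] and [w] costs a constant times
   half^N. *)
- rewrite TE; apply/eqP; rewrite -subr_eq0 opprK -normr_le0; apply/ler_addgt0Pr => e e0; rewrite add0r.
  have sf := rinf_smooth f; have cf := cint sf; have clf := cint (lie_real_smooth X sf).
  have [B1 fB] := continuous_bounded M_compact cf.
  have [B2 lfB] := continuous_bounded M_compact clf.
  have [B3 hB] := continuous_bounded M_compact ch.
  have [N NP] := half_exp_small ((B2 + B1) * B3 * 2 * vol_int (fun=> 1)) e0.
  have cLs := cint (lie_real_smooth X (ss N)).
  have c1 := contM clf (contM cu ch); have c2 := contM cf (contM cw ch).
  have c3 := contM clf (contM (cs N) ch); have c4 := contM cf (contM cLs ch).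
  have c5 := contD c1 c2; have c6 := contD c3 c4.
  have parts := vol_int_parts M_compact hI sf (ss N).
  rewrite -(vol_intD M_compact P c1 c2) -[X in `|X|]subr0.
  have z : vol_int (fun p => L f p * (s N p * h p) + f p * (L (s N) p * h p)) = 0.
    by rewrite (vol_intD M_compact P c3 c4) parts addNr.
  rewrite -[X in _ - X]z -(vol_intB M_compact P c5 c6).
  have c7 := contB c5 c6.
  apply: le_trans (_ : ((B2 + B1) * B3 * (2 * half ^+ N)) * vol_int (fun=> 1) <= _); last first.
    apply: ltW; have := NP N (leqnn N).
    by rewrite (_ : _ * vol_int _ * half ^+ N = (B2 + B1) * B3 * (2 * half ^+ N) * vol_int (fun=> 1))//; ring.
  apply: (vol_int_bound M_compact P c7) => p.
  have -> : L f p * (u p * h p) + f p * (w p * h p) -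
      (L f p * (s N p * h p) + f p * (L (s N) p * h p)) =
      (L f p * (u p - s N p) + f p * (w p - L (s N) p)) * h p by ring.
  rewrite normrM -mulrA [B3 * _]mulrC mulrA; apply: ler_pM => //.
  apply: le_trans (ler_normD _ _) _; rewrite !normrM mulrDl; apply: lerD; apply: ler_pM => //.
    exact: uP.
  by rewrite Ls; exact: wP.
have E p : u p * h p - v p = 0.
  have cuv := contB (contM cu ch) (cint sv).
  apply: (vol_int_eq0 M_hausdorff M_compact (P := P) cuv) => f sf.
  have cf := cint sf; have := Tv (to_rinf sf); rewrite TE /= => e.
  have -> : (fun q => f q * (u q * h q - v q)) = fun q => f q * (u q * h q) - f q * v q.
    by apply/funext => q; rewrite mulrBr.
  rewrite (vol_intB M_compact P (contM cf (contM cu ch)) (contM cf (cint sv))).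
  by apply/eqP; rewrite subr_eq0; apply/eqP.
have hn0 p : h p != 0 by rewrite gt_eqF.
have -> : u = fun p => v p * (h p)^-1.
  by apply/funext => p; have /eqP := E p; rewrite subr_eq0 => /eqP <-; rewrite mulfK.
by apply: smooth_realM => //; exact: smooth_real_inv.
Qed.
End Series.

(* Otherwise a gliding hump [u = \sum_i a_i phi_(k i)] would have [X u] smooth, hence
   be smooth, without being Lipschitz on the ball. *)
Lemma lipschitz_bounded (phi : nat -> M -> R) p : (forall k, smooth (phi k)) ->
  (forall k q, `|phi k q| <= 1) -> (forall k, q_ k (L (phi k)) <= 1) ->
  exists C, forall k x y, cball S p x -> cball S p y ->
    `|phi k (chart_bwd (chart_at S p) x) - phi k (chart_bwd (chart_at S p) y)| <= C * `|x - y|.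
Proof.
move=> sphi phi1 phiq; apply: contrapT => nC; set c := chart_at S p in nC.
(* Pairs of distinct points of the ball, since [gliding_hump] asks for a positive [rho]. *)
pose J := {z : 'rV[R]_n * 'rV[R]_n | [/\ cball S p z.1, cball S p z.2 & 0 < `|z.1 - z.2|]}.
pose x (j : J) := chart_bwd c (sval j).1; pose y (j : J) := chart_bwd c (sval j).2.
pose rho (j : J) := `|(sval j).1 - (sval j).2|.
have rho0 j : 0 < rho j by have [_ _] := svalP j.
have lip f : smooth f -> exists C, forall j, `|f (x j) - f (y j)| <= C * rho j.
  move=> sf; have [C CP] := smooth_lipschitz p sf; exists C => j.
  by have [Bx By _] := svalP j; exact: CP.
have [||a [k [ah kk aP]]] := gliding_hump rho0 phi1 (x := x) (y := y).
- by move=> k; exact: lip.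
- move=> C; apply: contrapT => nk; apply: nC; exists C => k x' y' Bx By.
  have [x0|] := ltP 0 `|x' - y'|; last first.
    by rewrite normr_le0 subr_eq0 => /eqP ->; rewrite !subrr normr0 normr0 mulr0.
  rewrite leNgt; apply/negP => lt; apply: nk.
  by exists k, (exist _ (x', y') (And3 Bx By x0)).
have ex q : exists l : R, forall N, `|l - \sum_(i < N) a i * phi (k i) q| <= 2 * half ^+ N.
  have [|l lP] := @geometric_limit R (fun i => a i * phi (k i) q) 1.
    move=> i; have /andP[a0 ai] := ah i; rewrite normrM ger0_norm// mul1r -[leRHS]mulr1.
    by apply: ler_pM.
  by exists l => N; have := lP N; rewrite mul1r.
have [u uP] := choice ex.
have su : smooth u.
  apply: (@hypoelliptic_series a (fun i => phi (k i))) => // i.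
  (* Here [i <= k i] is used: the seminorm of index i is at most that of index k i. *)
  apply: le_trans (phiq (k i)); apply: ball_seminorm_mono => //.
  exact: lie_real_smooth.
have [C CP] := lip u su; have [j] := aP u uP C.
by rewrite ltNge CP.
Qed.
End HypoellipticEstimate.

(** One ultrafilter provides limits for all sequences in compact sets simultaneously, in place of a
    diagonal choice of subsequences. *)
Lemma ultra_limit (T : topologicalType) (K : set T) (G : set_system nat) (x : nat -> T) :
  UltraFilter G -> compact K -> (forall k, K (x k)) -> exists2 l, K l & x @ G --> l.
Proof.
move=> UG cK xK; have PG : ProperFilter G by exact: ultra_proper.
have [|l [Kl cl]] := cK (x @ G) _.
  have -> : (x @ G) K = G setT by congr G; apply/seteqP; split=> // k _; exact: xK.
  exact: filterT.
exists l => // V Vl; have [//|nV] := in_ultra_setVsetC (x @^-1` V) UG.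
by have [y []] := cl (~` V) V nV Vl.
Qed.

(** * From hypoellipticity to cohomology-freeness *)

Section HypoellipticCohomologyFree.
Context {R : realType} {n : nat} {M : topologicalType}.
Variables (S : @smooth_structure R n M) (O : orientation S) (X : vector_field S).
Hypotheses (M_hausdorff : hausdorff_space M) (M_compact : compact [set: M]).
Hypotheses (M_connected : connected [set: M]) (M_nonempty : exists p : M, True).
Variable P : partition_of_unity O.
Notation vol_int := (vol_int P).
Notation L := (lie_real X).
Notation smooth := (smooth_real S).
Notation cint := (smooth_real_continuous (S := S)).
Implicit Types p q : M.

Hypothesis invariant_smooth : forall T : {linear Rinf S -> R^o}, rdist T ->
  (forall f : Rinf S, T (lie_rinf X f) = 0) -> vrep P T.
Hypothesis GH_rep : forall (T : {linear Rinf S -> R^o}) (k : M -> R), rdist T -> smooth k ->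
  (forall f : Rinf S, T (lie_rinf X f) = - vol_int (fun p => f p * k p)) -> vrep P T.

Variable h : M -> R.
Hypotheses (hI : invariant_density X P h) (h_gt0 : forall p, 0 < h p).

Let sh : smooth h := hI.1.
Let ch : continuous h := cint sh.
Let V1 : 0 <= vol_int (fun=> 1).
Proof. by apply: (@vol_int_pos _ _ _ S O M_compact P (fun=> 1) _ _).1; first exact: cont_cst. Qed.

Let weak_bound (f g : M -> R) B C D : continuous f -> continuous g ->
  (forall p, `|f p| <= B) -> (forall p, `|g p| <= C) -> (forall p, `|h p| <= D) ->
  `|vol_int (fun p => f p * (g p * h p))| <= B * (C * D) * vol_int (fun=> 1).
Proof.
move=> cf cg fB gC hD; apply: (vol_int_bound M_compact P (contM cf (contM cg ch))) => p.
rewrite !normrM; apply: ler_pM => //; by apply: ler_pM.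
Qed.

(* No sequence of normalized functions with [X phi_k -> 0] can have mean zero and stay
   equicontinuous: its weak limits are invariant, hence zero. *)
Lemma equicontinuous_weak_limit (phi : nat -> M -> R) (pt : nat -> M) :
  (forall k, smooth (phi k)) -> (forall k q, `|phi k q| <= 1) ->
  (forall k, phi k (pt k) = 1) -> (forall k, vol_int (fun q => phi k q * h q) = 0) ->
  (forall k q, `|L (phi k) q| <= k.+1%:R^-1) ->
  ~ forall p, exists C, forall k x y, cball S p x -> cball S p y ->
    `|phi k (chart_bwd (chart_at S p) x) - phi k (chart_bwd (chart_at S p) y)| <= C * `|x - y|.
Proof.
move=> sphi phi1 phipt phi0 Lphi lip.
(* The limit functional [t] sends every [f] at once to the limit along [G] of the integrals of phi_k
   f h; linearity passes to the limit. *)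
have [G [UG ooG]] := ultraFilterLemma (eventually_filter : ProperFilter \oo).
have PG : ProperFilter G by exact: ultra_proper.
have [p _ ptp] := ultra_limit UG M_compact (fun k => I : [set: M] (pt k)).
have [D hD] := continuous_bounded M_compact ch.
pose c (f : Rinf S) k := vol_int (fun q => phi k q * (f q * h q)).
have cB (f : Rinf S) B : (forall q, `|f q| <= B) ->
    forall k, `[- (B * D * vol_int (fun=> 1)), B * D * vol_int (fun=> 1)]%classic (c f k).
  move=> fB k; rewrite /= in_itv /= -ler_norml.
  have := weak_bound (cint (sphi k)) (cint (rinf_smooth f)) (phi1 k) fB hD.
  by rewrite mul1r.
have lim f : exists l : R, c f @ G --> l.
  have [B fB] := continuous_bounded M_compact (cint (rinf_smooth f)).
  have [l _ cl] := ultra_limit UG (@segment_compact _ _ _) (cB f B fB).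
  by exists l.
have [t tP] := choice lim.
have uniq (b : nat -> R) (l l' : R) : b @ G --> l -> b @ G --> l' -> l = l'.
  by move=> bl bl'; exact: (cvg_unique (@norm_hausdorff _ R) bl bl').
have tl : linear (t : Rinf S -> R^o).
  move=> a f g; apply: (uniq (c (a *: f + g))); first exact: tP.
  have -> : c (a *: f + g) = fun k => a * c f k + c g k.
    apply/funext => k; have cp := cint (sphi k).
    have c1 := contM cp (contM (cint (rinf_smooth f)) ch).
    have c2 := contM cp (contM (cint (rinf_smooth g)) ch).
    rewrite /c -(vol_intZ M_compact P a c1) -(vol_intD M_compact P (contM (@cont_cst _ _ a) c1) c2).
    by congr vol_int; apply/funext => q; rewrite rinfDE rinfZE; ring.
  by apply: cvgD; [apply: cvgM; [exact: cvg_cst|exact: tP]|exact: tP].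
pose T := HB.pack_for {linear Rinf S -> R^o} (t : Rinf S -> R^o)
  (GRing.isLinear.Build _ _ _ _ (t : Rinf S -> R^o) tl).
have dT : rdist T.
  apply: (@sup_rdist _ _ _ S M_compact T (D * vol_int (fun=> 1))) => f B fB.
  have [l lB cl] := ultra_limit UG (@segment_compact _ _ _) (cB f B fB).
  have -> : T f = l by exact: (uniq _ _ _ (tP f) cl).
  by rewrite [_ * B]mulrC mulrA; move: lB; rewrite /= in_itv /= -ler_norml.
(* Integration by parts moves the field onto phi_k, where it gives at most 1 / (k + 1). *)
have TX (f : Rinf S) : T (lie_rinf X f) = 0.
  apply: (uniq (c (lie_rinf X f))); first exact: tP.
  have [B fB] := continuous_bounded M_compact (cint (rinf_smooth f)).
  pose E := `|B * D * vol_int (fun=> 1)| + 1.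
  have E0 : 0 < E by rewrite ltr_wpDl.
  have cE k : `|c (lie_rinf X f) k| <= E * k.+1%:R^-1.
    have -> : c (lie_rinf X f) k = - vol_int (fun q => L (phi k) q * (f q * h q)).
      rewrite (vol_int_parts M_compact hI (sphi k) (rinf_smooth f)) opprK.
      by [].
    rewrite normrN; apply: le_trans (weak_bound (cint (lie_real_smooth X (sphi k)))
      (cint (rinf_smooth f)) (Lphi k) fB hD) _.
    rewrite -mulrA mulrC ler_pM2r ?invr_gt0//.
    by apply: le_trans (ler_norm _) _; rewrite lerDl.
  apply/cvgrPdist_lt => e e0; apply: ooG.
  exists (Num.truncn (E / e)).+1 => // k /= Nk; rewrite sub0r normrN.
  apply: le_lt_trans (cE k) _; rewrite ltr_pdivrMr// -ltr_pdivrMl// mulrC.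
  apply: lt_le_trans (truncnS_gt _) _; rewrite ler_nat.
  exact: leq_trans Nk (leqnSn k).
have [k0 sk0 Tk0] := invariant_smooth dT TX.
have k0I : invariant_density X P k0.
  by split=> // f sf; have := TX (to_rinf sf); rewrite Tk0.
have [b k0b] := invariant_density_unique M_hausdorff M_compact invariant_smooth M_connected hI h_gt0 k0I.
(* By uniqueness [T] is [b] times integration against [h]. On the constant 1 it is a limit of means
   equal to 0, which gives b = 0. *)
have T0 f : T f = 0.
  have E (g : Rinf S) : T g = b * vol_int (fun q => g q * h q).
    rewrite Tk0 -(vol_intZ M_compact P b (contM (cint (rinf_smooth g)) ch)).
    by congr vol_int; apply/funext => q; rewrite k0b mulrCA.
  pose one := @to_rinf _ _ _ S (fun=> 1) (smooth_real_cst 1).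
  have T1 : T one = 0.
    apply: (uniq (c one)); first exact: tP.
    rewrite (_ : c one = fun=> 0); first exact: cvg_cst.
    by apply/funext => k; rewrite -[RHS](phi0 k); congr vol_int; apply/funext => q; rewrite mul1r.
  move: T1; rewrite E (_ : (fun q => one q * h q) = h); last by apply/funext => q; rewrite mul1r.
  move=> /eqP; rewrite mulf_eq0 [X in _ || X](gt_eqF (vol_int_gt0 M_compact P M_nonempty ch h_gt0)).
  by rewrite orbF => /eqP b0; rewrite E b0 mul0r.
have [C CP] := lip p; set d := chart_at S p in CP.
(* With this radius [phi k] varies by at most 1/2 on [V]; if [V] contains [pt k], then [phi k] is at
   least 1/2 on [V]. *)
pose delta := Num.min (crad S p) (4 * (`|C| + 1))^-1.
have C1 : 0 < `|C| + 1 by rewrite ltr_wpDl.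
have delta0 : 0 < delta by rewrite lt_min crad_gt0 invr_gt0 mulr_gt0.
pose V := chart_dom d `&` chart_fwd d @^-1` ball (chart_fwd d p) delta.
have oV : open V by apply: chart_image_open; exact: ball_open.
have Vp : V p by split; [exact: chart_at_dom|exact: ballxx].
have VB q : V q -> `|chart_fwd d q - chart_fwd d p| < delta.
  by move=> [_]; rewrite /= -ball_normE /= distrC.
have V_near k q : V (pt k) -> V q -> 2^-1 <= phi k q.
  move=> Vk Vq; have Bk : cball S p (chart_fwd d (pt k)).
    by apply: ltW; apply: lt_le_trans (VB _ Vk) _; rewrite ge_min lexx.
  have Bq : cball S p (chart_fwd d q).
    by apply: ltW; apply: lt_le_trans (VB _ Vq) _; rewrite ge_min lexx.
  have := CP k _ _ Bk Bq; rewrite (chart_fwdK Vk.1) (chart_fwdK Vq.1) phipt => h1.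
  have h2 : C * `|chart_fwd d (pt k) - chart_fwd d q| <= 2^-1.
    apply: le_trans (_ : (`|C| + 1) * (delta + delta) <= _).
      apply: le_trans (ler_norm _) _; rewrite normrM normr_id; apply: ler_pM => //.
        by rewrite lerDl.
      have := ler_distD (chart_fwd d p) (chart_fwd d (pt k)) (chart_fwd d q).
      move=> /le_trans; apply; apply: lerD; apply: ltW; first exact: VB.
      by rewrite distrC; exact: VB.
    have : delta <= (4 * (`|C| + 1))^-1 by rewrite ge_min lexx orbT.
    rewrite -(ler_pM2l C1) invfM mulrCA divff ?gt_eqF// mulr1.
    by lra.
  have := ler_norm (1 - phi k q); lra.
(* Against a bump in [V] the integrals stay above a positive constant for all [k] with [pt k] in
   [V], which contradicts T = 0. *)
have [chi [K [schi chi0 chip cK [KV chiK]]]] :=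
  chart_bump M_hausdorff (chart_at_atlas S p) (chart_at_dom S p) oV Vp.
have chiV q : ~ V q -> chi q = 0 by move=> nV; apply: chiK => /KV[].
have cchi := cint schi; have cchih := contM cchi ch.
have m0 : 0 < vol_int (fun q => chi q * h q).
  have [|_] := @vol_int_pos _ _ _ S O M_compact P _ cchih.
    by move=> q; rewrite mulr_ge0// ltW.
  by apply; exists p; rewrite mulr_gt0.
have c_ge k : V (pt k) -> 2^-1 * vol_int (fun q => chi q * h q) <= c (to_rinf schi) k.
  move=> Vk; have c1 := contM (cint (sphi k)) cchih.
  have c2 := contM (@cont_cst _ _ (2^-1 : R)) cchih.
  rewrite -(vol_intZ M_compact P 2^-1 cchih) -subr_ge0 -(vol_intB M_compact P c1 c2).
  apply: (vol_int_pos M_compact P (contB c1 c2) _).1 => q; rewrite -mulrBl.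
  have [Vq|nV] := pselect (V q); last by rewrite chiV// mul0r mulr0.
  by rewrite mulr_ge0 ?subr_ge0 ?V_near// mulr_ge0// ltW.
have GV : G (pt @^-1` V) by apply: ptp; exact: open_nbhs_nbhs.
have e0 : 0 < 2^-1 * vol_int (fun q => chi q * h q) by rewrite mulr_gt0.
have tchi : c (to_rinf schi) @ G --> (0 : R).
  by rewrite -[X in _ --> X](T0 (to_rinf schi)); exact: tP.
have Ge : G [set k | `|0 - c (to_rinf schi) k| < 2^-1 * vol_int (fun q => chi q * h q)].
  by move/cvgrPdist_lt: tchi; exact.
have [k [/= Vk]] := filter_ex (filterI GV Ge).
rewrite sub0r normrN; apply/negP; rewrite -leNgt.
by apply: le_trans (c_ge k Vk) (ler_norm _).
Qed.

Variable s0 : seq M.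
Hypothesis s0_cover : forall q, exists2 p, p \in s0 & copen S p q.
Notation q_ k := (seminorm (ball_index S s0 k)).
Let finF k : finite_set (ball_index S s0 k). Proof. exact: finite_ball_index. Qed.
Let FI k : ball_index S s0 k `<=` cinf_index S. Proof. exact: ball_index_cinf. Qed.

Lemma hypoelliptic_estimate : exists k C, 0 <= C /\ forall phi, smooth phi ->
  vol_int (fun q => phi q * h q) = 0 -> forall p, `|phi p| <= C * q_ k (L phi).
Proof.
apply: contrapT => nE.
have ex k : exists z : (M -> R) * M, [/\ smooth z.1, forall q, `|z.1 q| <= 1, z.1 z.2 = 1,
    vol_int (fun q => z.1 q * h q) = 0 & q_ k (L z.1) <= k.+1%:R^-1].
  (* The estimate of order k with constant k + 1 fails for some function, which is then
     normalized. *)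
  apply: contrapT => nz; apply: nE; exists k, k.+1%:R; split=> // phi sphi phi0 p.
  rewrite leNgt; apply/negP => lt; apply: nz.
  have cphi := cint sphi; have cn : continuous (fun q => `|phi q|) by exact: cont_norm.
  have [r _ rP] := continuous_attains_max M_compact cn closedT (ex_intro _ p I).
  have sL := lie_real_smooth X sphi.
  have q0 : 0 <= q_ k (L phi) by exact: (seminorm_ge0 (@finF k) (FI (k := k)) sL).
  have phir : 0 < `|phi r|.
    by apply: lt_le_trans (rP p I); apply: le_lt_trans lt; rewrite mulr_ge0.
  have phir0 : phi r != 0 by rewrite -normr_gt0.
  (* Dividing by the signed value at the maximum [r] of |phi|, rather than by its absolute value,
     makes the new value there equal to 1. *)
  exists (fun q => (phi r)^-1 * phi q, r); split=> /=.
  - exact: smooth_realZ.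
  - by move=> q; rewrite normrM normfV ler_pdivrMl// mulr1; exact: rP.
  - by rewrite mulVf.
  - have -> : (fun q => (phi r)^-1 * phi q * h q) = fun q => (phi r)^-1 * (phi q * h q).
      by apply/funext => q; rewrite mulrA.
    by rewrite (vol_intZ M_compact P _ (contM cphi ch)) phi0 mulr0.
  - have -> : L (fun q => (phi r)^-1 * phi q) = fun q => (phi r)^-1 * L phi q.
      by apply/funext => q; exact: lie_realZ.
    apply: le_trans (seminormZ (@finF k) (FI (k := k)) _ sL) _.
    rewrite normfV ler_pdivrMl// ler_pdivlMr// mulrC.
    by apply: ltW; apply: lt_le_trans lt (rP p I).
have [z zP] := choice ex; pose phi k := (z k).1; pose pt k := (z k).2.
have sphi k : smooth (phi k) by have [] := zP k.
have phi1 k : forall q, `|phi k q| <= 1 by have [] := zP k.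
have phiq k : q_ k (L (phi k)) <= k.+1%:R^-1 by have [] := zP k.
apply: (@equicontinuous_weak_limit phi pt sphi phi1).
- by move=> k; have [] := zP k.
- by move=> k; have [] := zP k.
- move=> k q; apply: le_trans (phiq k).
  by apply: ball_seminorm_ge_value => //; exact: lie_real_smooth.
- move=> p; apply: (lipschitz_bounded M_hausdorff M_compact hI h_gt0 GH_rep s0_cover p sphi phi1).
  move=> k; apply: le_trans (phiq k) _; rewrite invf_le1// ler1n//.
Qed.

(** A functional with T (X f) = - vol_int (f g h) is, up to the density [h], a weak solution of X u
    = g. It exists because the estimate bounds the prescribed values by a seminorm of X f;
    hypoellipticity represents it by a smooth [v], and u = v / h. *)
Lemma GH_rep_CF : real_cohomology_free X.
Proof.
have [k [C [C0 CP]]] := hypoelliptic_estimate.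
move=> g0 sg0; have V0 := vol_int_gt0 M_compact P M_nonempty ch h_gt0.
pose mean f := vol_int (fun q => f q * h q) / vol_int h.
have meanB f : smooth f -> vol_int (fun q => (f q - mean f) * h q) = 0.
  move=> sf; have c1 := contM (cint sf) ch.
  have -> : (fun q => (f q - mean f) * h q) = fun q => f q * h q - mean f * h q.
    by apply/funext => q; rewrite mulrBl.
  rewrite (vol_intB M_compact P c1 (contM (@cont_cst _ _ (mean f)) ch)).
  by rewrite (vol_intZ M_compact P _ ch) divfK ?subrr// gt_eqF.
exists (mean g0); pose g q := g0 q - mean g0.
have sg : smooth g by apply: smooth_realB => //; exact: smooth_real_cst.
have cg := cint sg.
have [B1 gB] := continuous_bounded M_compact cg; have [B2 hB] := continuous_bounded M_compact ch.
have [p0 _] := M_nonempty.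
have B10 : 0 <= B1 by apply: le_trans (normr_ge0 _) (gB p0).
have B20 : 0 <= B2 by apply: le_trans (normr_ge0 _) (hB p0).
pose C' := C * (B1 * B2) * vol_int (fun=> 1).
have C'0 : 0 <= C' by rewrite !mulr_ge0.
have ss := seminorm_sublinear (@finF k) (FI (k := k)) C'0.
pose m (f : Rinf S) := vol_int (fun q => f q * (g q * h q)).
have cgh := contM cg ch.
have [tm dtm tmE] := density_functional M_compact P cgh.
have lin a (f f' : Rinf S) : lie_rinf X (a *: f + f') = a *: lie_rinf X f + lie_rinf X f'.
  exact: lie_rinf_linear.
have lin0 : lie_rinf X 0 = 0.
  by have := lin (-1) 0 0; rewrite scaler0 addr0 => ->; rewrite scaleN1r addNr.
pose W := [set x : Rinf S * R | exists f : Rinf S, x = (lie_rinf X f, - tm f)].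
have [||T [Ts TW]] := @hahn_banach _ _ _ W ss.
- split.
  + by exists 0; rewrite lin0 linear0 oppr0.
  + move=> _ _ [f ->] [f' ->]; exists (f + f') => /=.
    by rewrite -[f in RHS]scale1r lin !scale1r linearD opprD.
  + move=> a _ a0 [f ->]; exists (a *: f) => /=.
    have := lin a f 0; rewrite addr0 lin0 addr0 => ->.
    have tmZ : tm (a *: f) = a * tm f by rewrite linearZ.
    by rewrite tmZ mulrN.
- move=> _ [f ->] /=; have sf := rinf_smooth f.
  (* The estimate concerns functions of mean zero. Subtracting the mean changes neither X f nor the
     integral against g h, as [g] has mean zero. *)
  pose f0 q := f q - mean f.
  have sf0 : smooth f0 by apply: smooth_realB => //; exact: smooth_real_cst.
  have Lf0 : L f0 = L f.
    by apply/funext => q; rewrite lie_realB ?lie_real_cst ?subr0//; exact: smooth_real_cst.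
  have -> : tm f = vol_int (fun q => f0 q * (g q * h q)).
    rewrite tmE; have c1 := contM (cint sf) cgh.
    have -> : (fun q => f0 q * (g q * h q)) = fun q => f q * (g q * h q) - mean f * (g q * h q).
      by apply/funext => q; rewrite mulrBl.
    rewrite (vol_intB M_compact P c1 (contM (@cont_cst _ _ (mean f)) cgh)).
    by rewrite (vol_intZ M_compact P _ cgh) meanB// mulr0 subr0.
  rewrite lerNl; apply: le_trans (_ : - `|vol_int (fun q => f0 q * (g q * h q))| <= _); last first.
    by have := lexx `|vol_int (fun q => f0 q * (g q * h q))|; rewrite {1}ler_norml => /andP[].
  rewrite lerN2; apply: le_trans (weak_bound (cint sf0) cg (CP f0 sf0 (meanB f sf)) gB hB) _.
  by rewrite Lf0 /C' le_eqVlt; apply/orP; left; apply/eqP; ring.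
have Tm f : T (lie_rinf X f) = - tm f.
  apply/eqP; rewrite eq_le; apply/andP; split; last first.
    exact: (TW (lie_rinf X f, - tm f) (ex_intro _ f erefl)).
  have := TW _ (ex_intro _ (- f) erefl); rewrite /= linearN opprK.
  have := lin (-1) f 0; rewrite addr0 lin0 addr0 !scaleN1r => ->.
  by rewrite linearN lerNr.
have [|||v sv Tv] := GH_rep (k := fun q => g q * h q) (T := T).
- exact: (seminorm_rdist (@finF k) (FI (k := k)) C'0).
- exact: smooth_realM.
- by move=> f; rewrite Tm tmE.
have hn0 q : h q != 0 by rewrite gt_eqF.
pose u q := v q * (h q)^-1.
have su : smooth u by apply: smooth_realM => //; exact: smooth_real_inv.
exists u; split=> // p; apply/eqP; rewrite -subr_eq0 -/(g p).
have sLu := lie_real_smooth X su.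
have cLg := contB (cint sLu) cg; have cLgh := contM cLg ch.
have := vol_int_eq0 M_hausdorff M_compact (P := P) (S := S) cLgh.
move=> /(_ _ p)/eqP; rewrite mulf_eq0 (negbTE (hn0 p)) orbF; apply => f sf.
have cf := cint sf.
have -> : (fun q => f q * ((L u q - g q) * h q)) =
    fun q => f q * (L u q * h q) - f q * (g q * h q).
  by apply/funext => q; ring.
rewrite (vol_intB M_compact P (contM cf (contM (cint sLu) ch)) (contM cf cgh)).
have := vol_int_parts M_compact hI sf su.
have -> : (fun q => L f q * (u q * h q)) = fun q => lie_rinf X (to_rinf sf) q * v q.
  by apply/funext => q; rewrite /u divfK.
rewrite -Tv Tm tmE => /eqP; rewrite eqr_opp => /eqP ->.
by rewrite subrr.
Qed.
End HypoellipticCohomologyFree.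

(** * The equivalences *)

Section Equivalence.
Context {R : realType} {n : nat} {M : topologicalType}.
Variables (S : @smooth_structure R n M) (O : orientation S) (X : vector_field S).
Hypotheses (M_hausdorff : hausdorff_space M) (M_compact : compact [set: M]).

Let condition3 := [/\ volume_preserving X, stable X &
  (forall U, invariant_dist X U -> smooth_dist O U)].

(** [connected] admits the empty space, on which no density has positive mass. There all functions
    coincide and all integrals are 0. *)
Lemma empty_manifold : ~ (exists p : M, True) ->
  [/\ globally_hypoelliptic O X, cohomology_free X & condition3].
Proof.
move=> M0; have [P smooth_distE] := smooth_distP O M_hausdorff M_compact.
have CE (f g : Cinf S) : f = g by apply: Cinf_eq => p; case: M0; exists p.
have V0 (f : M -> R) : vol_int P f = 0.
  rewrite -(vol_int0 M_compact P); congr vol_int; apply/funext => p; case: M0; by exists p.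
have sd (U : {linear Cinf S -> R[i]^o}) : smooth_dist O U.
  apply/smooth_distE; exists 0; apply/funext => f.
  by rewrite /cvol_int !V0 (CE f 0) linear0.
split; first by move=> U _ _; exact: sd.
  by move=> f; exists 0, 0 => p; case: M0; exists p.
split=> [|f _|U _]; last exact: sd.
- exists (vol_form P 0) => c x _ cx; case: M0; by exists (chart_bwd c x).
- by exists 0.
Qed.

Hypotheses (M_connected : connected [set: M]) (M_nonempty : exists p : M, True).

Lemma GH_CF : globally_hypoelliptic O X -> cohomology_free X.
Proof.
move=> GH; have [P smooth_distE] := smooth_distP O M_hausdorff M_compact.
have inv (T : {linear Rinf S -> R^o}) (dT : rdist T) := GH_invariant M_compact smooth_distE GH dT.
have rep (T : {linear Rinf S -> R^o}) k (dT : rdist T) := @GH_real _ _ _ _ _ _ _ smooth_distE T k GH dT.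
have [h hI h0] := invariant_density_exists M_hausdorff M_compact M_connected inv M_nonempty.
have [s0 s0P] := copen_cover S M_compact.
apply/real_cohomology_freeP.
exact: (GH_rep_CF M_hausdorff M_compact M_connected M_nonempty inv rep hI h0 s0P).
Qed.

Lemma CF_GH : cohomology_free X -> globally_hypoelliptic O X.
Proof.
move=> /real_cohomology_freeP CF U _.
have [P smooth_distE] := smooth_distP O M_hausdorff M_compact.
have [h hI h0] := CF_density M_hausdorff M_compact P M_nonempty CF.
move=> /smooth_distE[k Uk]; apply: (CF_smooth_dist M_compact hI h0 M_nonempty CF smooth_distE) => f.
exact: (congr1 (fun V => V f) Uk).
Qed.

Lemma CF_condition3 : cohomology_free X -> condition3.
Proof.
move=> /real_cohomology_freeP CF.
have [P smooth_distE] := smooth_distP O M_hausdorff M_compact.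
have [h hI h0] := CF_density M_hausdorff M_compact P M_nonempty CF.
split.
- exact: (density_volume_preserving M_hausdorff M_compact hI h0).
- exact: (CF_stable M_compact hI h0 M_nonempty CF).
- move=> U [_ UX]; apply: (@CF_smooth_dist _ _ _ _ _ _ M_compact P h hI h0 M_nonempty CF smooth_distE U 0) => f.
  rewrite -[LHS]/(lie_dist X U f) UX; apply: complex_ext; rewrite /= -(vol_int0 M_compact P).
    by congr vol_int; apply/funext => p; rewrite /= complex_ReM /= !mulr0 subr0.
  by congr vol_int; apply/funext => p; rewrite /= complex_ImM /= !mulr0 addr0.
Qed.

Lemma condition3_CF : condition3 -> cohomology_free X.
Proof.
move=> [_ stX INV]; have [P smooth_distE] := smooth_distP O M_hausdorff M_compact.
apply/real_cohomology_freeP.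
apply: (stable_CF M_hausdorff M_compact (P := P) M_connected _ M_nonempty stX) => T dT.
exact: (invariant_vrep smooth_distE INV dT).
Qed.
End Equivalence.

Theorem theorem3p10 (R : realType) (n : nat) (M : topologicalType)
    (S : @smooth_structure R n M) (O : orientation S) (X : vector_field S)
    (M_hausdorff : hausdorff_space M) (M_compact : compact [set: M])
    (M_connected : connected [set: M]) :
  (globally_hypoelliptic O X <-> cohomology_free X) /\
  (cohomology_free X <->
    [/\ volume_preserving X, stable X &
        (forall U, invariant_dist X U -> smooth_dist O U)]).
Proof.
have [M0|M0] := pselect (exists p : M, True); last first.
  by have [GH CF C3] := empty_manifold O X M_hausdorff M_compact M0.
split; split.
- exact: GH_CF.
- exact: CF_GH.
- exact: CF_condition3.
- exact: condition3_CF.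
Qed.
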